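(* In $\exp(\hat{\mathfrak t}_4)$ one has $$\Psi_2(t_{12}+t_{34}\,|\,t_{23},t_{14})=2^{Z-t_{23}}\;\Phi_{1/2}^{1,23,4}\;\Phi^{1,2,3}\;(\Phi^{12,3,4})^{-1},$$ where $Z=\sum_{1\le i<j\le4}t_{ij}$ is a generator of the center of $\mathfrak t_4$, and $$\Phi^{12,3,4}=\Phi(t_{13}+t_{23},t_{34}),\qquad \Phi^{1,2,3}=\Phi(t_{12},t_{23}),\qquad \Phi_{1/2}^{1,23,4}=\Phi_{1/2}(t_{12}+t_{13},t_{24}+t_{34}),$$ with $\Phi$, $\Phi_{1/2}$, $\Psi_2$ and $\mathfrak t_4$ as defined in the context.
   Context: $\mathfrak t_4$ is the complex Lie algebra with generators $t_{ij}$, $1\le i\neq j\le4$, and relations $t_{ij}=t_{ji}$ ($i\neq j$), $[t_{ij}+t_{ik},t_{jk}]=0$ ($i,j,k$ distinct), $[t_{ij},t_{kl}]=0$ ($i,j,k,l$ distinct). It is graded with each $t_{ij}$ of degree $1$, and $\hat{\mathfrak t}_4$ is its degree completion. Let $\hat{\mathfrak f}_2$ (resp. $\hat{\mathfrak f}_3$) be the topologically free complex Lie algebra generated by $A,B$ (resp. $A,b_0,b_1$), i.e. the degree completion of the free Lie algebra, all generators having degree $1$. For $x$ in a pronilpotent Lie algebra and $a\in\mathbb C\setminus\mathbb R_-$, $a^x:=\exp(x\ln a)$, where $\ln a$ has imaginary part in $]-\pi,\pi[$. Definition of $\Phi$ (the Knizhnik–Zamolodchikov associator) and $\Phi_{1/2}$: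 let $G_0,G_1,G_{1/2}$ be the $\exp(\hat{\mathfrak f}_2)$-valued solutions on $]0,1[$ of $$(dG)G^{-1}=\Big(\frac{A}{u}+\frac{B}{u-1}\Big)du$$ such that $G_0(u)\simeq u^{A}$ as $u\to0^+$, $G_1(u)\simeq(1-u)^{B}$ as $u\to1^-$ (i.e. $G_0(u)u^{-A}\to1$, $G_1(u)(1-u)^{-B}\to1$), and $G_{1/2}(1/2)=1$. Then $\Phi(A,B):=G_1^{-1}G_0$ and $\Phi_{1/2}(A,B):=G_{1/2}^{-1}G_0$, both constant elements of $\exp(\hat{\mathfrak f}_2)$. Definition of $\Psi_2$ (the analogue of $\Phi$ for square roots of unity): $\Psi_2(A|b_0,b_1)=H_1^{-1}H_0\in\exp(\hat{\mathfrak f}_3)$, where $H_0,H_1$ are the $\exp(\hat{\mathfrak f}_3)$-valued solutions on $]0,1[$ of $$(dH)H^{-1}=\Big(\frac{A}{z}+\frac{b_0}{z-1}+\frac{b_1}{z+1}\Big)dz$$ such that $H_0(z)\simeq z^{A}$ as $z\to0^+$ and $H_1(z)\simeq(1-z)^{b_0}$ as $z\to1^-$ (same meaning of $\simeq$). For degree-one elements $x,y$ (resp. $x,y_0,y_1$) of $\mathfrak t_4$, $\Phi(x,y)$ and $\Phi_{1/2}(x,y)$ (resp. $\Psi_2(x|y_0,y_1)$) denote the images in $\exp(\hat{\mathfrak t}_4)$ of $\Phi(A,B)$ and $\Phi_{1/2}(A,B)$ (resp. $\Psi_2(A|b_0,b_1)$) under the morphism induced by $A\mapsto x$, $B\mapsto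 y$ (resp. $A\mapsto x$, $b_0\mapsto y_0$, $b_1\mapsto y_1$). *)

(* Defs.v *)
(* The complex numbers are R[i], for R : realType. *)
From HB Require Import structures.
From mathcomp Require Import all_boot all_order all_algebra.
From mathcomp Require Import complex.
From mathcomp Require Import all_classical all_reals all_analysis.

Set Implicit Arguments.
Unset Strict Implicit.
Unset Printing Implicit Defensive.

Import Order.TTheory GRing.Theory Num.Theory.
Import numFieldNormedType.Exports.

Local Open Scope classical_set_scope.
Local Open Scope ring_scope.
Local Open Scope complex_scope.

(* K<<T>>, the degree completion of the free associative algebra K<T>: a series
   is the family of its coefficients, indexed by the words over T. *)
Definition ncseries (K : fieldType) (T : finType) : Type := seq T -> K.

HB.instance Definition _ (K : fieldType) (T : finType) :=
  GRing.Lmodule.copy (ncseries K T) (seq T -> (K^o : lmodType K)).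

Section NCSeriesRing.
Variables (K : fieldType) (T : finType).
Local Notation S := (ncseries K T).
Implicit Types (f g h : S) (w : seq T) (a : T).

Definition ncone : S := fun w => (nilp w)%:R.

Definition ncmul f g : S :=
  fun w => \sum_(k < (size w).+1) f (take k w) * g (drop k w).

Lemma ncseriesP f g : (forall w, f w = g w) <-> f = g.
Proof. by split=> [fg|->//]; apply/funext. Qed.

Lemma ncaddE f g w : (f + g) w = f w + g w. Proof. by []. Qed.
Lemma ncoppE f w : (- f) w = - f w. Proof. by []. Qed.
Lemma ncsubE f g w : (f - g) w = f w - g w. Proof. by []. Qed.
Lemma ncscaleE c f w : (c *: f) w = c * f w. Proof. by []. Qed.
Lemma nczeroE w : (0 : S) w = 0. Proof. by []. Qed.
Lemma ncsumE I (r : seq I) (P : pred I) (F : I -> S) w :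
  (\sum_(i <- r | P i) F i) w = \sum_(i <- r | P i) F i w.
Proof. by elim/big_rec2: _ => // i x y _ <-. Qed.

Definition ncshift a f : S := fun w => f (a :: w).

Lemma ncmul_nil f g : ncmul f g [::] = f [::] * g [::].
Proof. by rewrite /ncmul big_ord_recl big_ord0 addr0. Qed.

Lemma ncmul_cons f g a w :
  ncmul f g (a :: w) = f [::] * g (a :: w) + ncmul (ncshift a f) g w.
Proof. by rewrite /ncmul big_ord_recl. Qed.

Fact ncmulDl : left_distributive ncmul +%R.
Proof.
move=> f g h; apply/ncseriesP => w; rewrite ncaddE /ncmul -big_split /=.
by apply: eq_bigr => k _; rewrite ncaddE mulrDl.
Qed.

Fact ncmulDr : right_distributive ncmul +%R.
Proof.
move=> f g h; apply/ncseriesP => w; rewrite ncaddE /ncmul -big_split /=.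
by apply: eq_bigr => k _; rewrite ncaddE mulrDr.
Qed.

Fact ncscaleAl c f g : c *: ncmul f g = ncmul (c *: f) g.
Proof.
apply/ncseriesP => w; rewrite ncscaleE /ncmul big_distrr /=.
by apply: eq_bigr => k _; rewrite ncscaleE mulrA.
Qed.

Fact ncscaleAr c f g : c *: ncmul f g = ncmul f (c *: g).
Proof.
apply/ncseriesP => w; rewrite ncscaleE /ncmul big_distrr /=.
by apply: eq_bigr => k _; rewrite ncscaleE mulrCA.
Qed.

Fact ncmulA : associative ncmul.
Proof.
move=> f g h; apply/ncseriesP => w; elim: w f g => [|a w IHw] f g.
  by rewrite !ncmul_nil mulrA.
have shiftM : ncshift a (ncmul f g) =
    f [::] *: ncshift a g + ncmul (ncshift a f) g.
  by apply/ncseriesP => v; rewrite /ncshift ncmul_cons.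
rewrite 3!ncmul_cons ncmul_nil shiftM ncmulDl -ncscaleAl.
by rewrite ncaddE ncscaleE IHw mulrDr mulrA -addrA.
Qed.

Fact ncmul1f : left_id ncone ncmul.
Proof.
move=> f; apply/ncseriesP => w; rewrite /ncmul big_ord_recl /= take0 drop0 mul1r.
by rewrite big1 ?addr0 // => k _; case: w k => [|a w] [k ltk]; rewrite ?mul0r.
Qed.

Fact ncmulf1 : right_id ncone ncmul.
Proof.
move=> f; apply/ncseriesP => w.
rewrite /ncmul big_ord_recr /= take_size drop_size mulr1.
rewrite big1 ?add0r // => k _.
by rewrite /ncone /nilp size_drop subn_eq0 leqNgt ltn_ord mulr0.
Qed.

Fact ncone_neq0 : ncone != 0.
Proof.
by apply/eqP => /ncseriesP/(_ [::])/eqP; rewrite /ncone /= oner_eq0.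
Qed.

HB.instance Definition _ := GRing.Zmodule_isNzRing.Build S
  ncmulA ncmul1f ncmulf1 ncmulDl ncmulDr ncone_neq0.

HB.instance Definition _ := GRing.Lmodule_isLalgebra.Build K S ncscaleAl.

HB.instance Definition _ := GRing.Lalgebra_isAlgebra.Build K S ncscaleAr.

Lemma nc1E w : (1 : S) w = (nilp w)%:R. Proof. by []. Qed.

Lemma ncmulE f g w :
  (f * g) w = \sum_(k < (size w).+1) f (take k w) * g (drop k w).
Proof. by []. Qed.

Lemma ncexp_small f : f [::] = 0 ->
  forall n w, (size w < n)%N -> (f ^+ n) w = 0.
Proof.
move=> f0; elim=> [//|n IHn] w; rewrite ltnS => szw; rewrite exprS ncmulE.
apply: big1 => -[[|k] ltk] _ /=; first by rewrite take0 f0 mul0r.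
rewrite IHn ?mulr0 // size_drop; apply: leq_trans szw.
by rewrite ltn_subrL /=; case: (size w) ltk.
Qed.

(* Geometric series; inverts 1 - f when f has no constant term. *)
Definition ncgeom f : S := fun w => \sum_(k < (size w).+1) (f ^+ k) w.

Definition ncunit f := f [::] != 0.

Definition ncinv f : S :=
  if ncunit f then (f [::])^-1 *: ncgeom (1 - (f [::])^-1 *: f) else f.

Lemma ncgeomE f n w : f [::] = 0 -> (size w <= n)%N ->
  ncgeom f w = (\sum_(k < n.+1) f ^+ k) w.
Proof.
move=> f0 szw; rewrite ncsumE /ncgeom -!(big_mkord xpredT (fun k => (f ^+ k) w)).
rewrite [RHS](big_cat_nat _ (n := (size w).+1)) //= [X in _ + X]big_nat_cond.
by rewrite [X in _ + X]big1 ?addr0 // => k /andP[/andP[+ _] _]; exact: ncexp_small.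
Qed.

Lemma ncgeomMl f : f [::] = 0 -> ncgeom f * (1 - f) = 1.
Proof.
move=> f0; apply/ncseriesP => w; set n := size w.
transitivity (((\sum_(k < n.+1) f ^+ k) * (1 - f)) w).
  rewrite !ncmulE; apply: eq_bigr => k _; rewrite (@ncgeomE _ n) //.
  by rewrite size_take_min geq_minr.
have comf : GRing.comm (\sum_(k < n.+1) f ^+ k) (1 - f).
  apply: commr_sym; apply: commr_sum => k _.
  by apply: commrX; apply: commr_sym; apply: commrB; [exact: commr1 | ].
rewrite comf -opprB mulNr -subrX1 opprB ncsubE.
by rewrite (ncexp_small f0) // subr0.
Qed.

Lemma ncgeomMr f : f [::] = 0 -> (1 - f) * ncgeom f = 1.
Proof.
move=> f0; apply/ncseriesP => w; set n := size w.
transitivity (((1 - f) * (\sum_(k < n.+1) f ^+ k)) w).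
  rewrite !ncmulE; apply: eq_bigr => k _; rewrite (@ncgeomE _ n) //.
  by rewrite size_drop leq_subr.
rewrite -opprB mulNr -subrX1 opprB ncsubE.
by rewrite (ncexp_small f0) // subr0.
Qed.

Lemma ncunit_decomp f : ncunit f ->
  let g := 1 - (f [::])^-1 *: f in g [::] = 0 /\ f = f [::] *: (1 - g).
Proof.
move=> uf; split; first by rewrite ncsubE ncscaleE nc1E mulVf // subrr.
by rewrite opprB addrCA subrr addr0 scalerA divff // scale1r.
Qed.

Fact ncmulVf : {in ncunit, left_inverse 1 ncinv *%R}.
Proof.
move=> f uf; rewrite -topredE /= in uf; have [] := ncunit_decomp uf.
rewrite /ncinv uf; set g := 1 - _ => g0 fE.
rewrite [X in _ * X]fE -scalerAl -scalerAr scalerA mulVf //.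
by rewrite scale1r ncgeomMl.
Qed.

Fact ncmulfV : {in ncunit, right_inverse 1 ncinv *%R}.
Proof.
move=> f uf; rewrite -topredE /= in uf; have [] := ncunit_decomp uf.
rewrite /ncinv uf; set g := 1 - _ => g0 fE.
rewrite [X in X * _]fE -scalerAl -scalerAr scalerA mulfV //.
by rewrite scale1r ncgeomMr.
Qed.

Fact ncunitP f g : g * f = 1 /\ f * g = 1 -> ncunit f.
Proof.
case=> /ncseriesP/(_ [::]); rewrite [LHS]ncmul_nil nc1E /= => gf _.
by apply/eqP => f0; move: gf => /eqP; rewrite f0 mulr0 eq_sym oner_eq0.
Qed.

Fact ncinv_out : {in [predC ncunit], ncinv =1 id}.
Proof. by move=> f; rewrite inE /= -topredE /= /ncinv => /negbTE ->. Qed.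

HB.instance Definition _ := GRing.NzRing_hasMulInverse.Build S
  ncmulVf ncmulfV ncunitP ncinv_out.

End NCSeriesRing.

Section FreeLie.
Variables (K : fieldType) (T : finType).
Local Notation S := (ncseries K T).

Definition ncletter (a : T) : S := fun w => (w == [:: a])%:R.

Definition nchom (n : nat) (f : S) : S := fun w => f w *+ (size w == n).

Definition bracket (x y : S) : S := x * y - y * x.

(* The free Lie algebra on T is realized as the Lie subalgebra of K<T>
   generated by the letters (Magnus-Witt). *)
Inductive lie_poly : S -> Prop :=
| lie_letter a : lie_poly (ncletter a)
| lie_lin c x y : lie_poly x -> lie_poly y -> lie_poly (c *: x + y)
| lie_bracket x y : lie_poly x -> lie_poly y -> lie_poly (bracket x y)
| lie_zero : lie_poly 0.

(* Degree completion of a graded subspace P. *)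
Definition degree_completion (P : S -> Prop) (f : S) : Prop :=
  forall n, P (nchom n f).

Definition lie_series : S -> Prop := degree_completion lie_poly.

(* Exponential series of x; only meaningful when x has no constant term, so that
   x ^+ k vanishes on the words of length smaller than k. *)
Definition ncexp (x : S) : S :=
  fun w => \sum_(k < (size w).+1) (k`!%:R)^-1 * (x ^+ k) w.

(* The group attached to the completed free Lie algebra, inside K<<T>>^*. *)
Definition exp_lie (g : S) : Prop := exists2 x, lie_series x & g = ncexp x.

End FreeLie.

(* Image of f under the continuous algebra morphism sending the letter a to s a;
   only meaningful when the s a have no constant term. *)
Definition ncsubst (K : fieldType) (T U : finType) (s : T -> ncseries K U)
    (f : ncseries K T) : ncseries K U :=
  fun w => \sum_(n < (size w).+1) \sum_(v : n.-tuple T)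
    f v * (\prod_(a <- v) s a) w.

Section KZ.
Variable R : realType.
Local Notation C := R[i].

(* a^x, for a > 0 (where the principal logarithm is the real one) *)
Definition ncpow (T : finType) (a : R) (x : ncseries C T) : ncseries C T :=
  ncexp ((ln a)%:C *: x).

(* Derivatives and limits of functions R -> C<<T>> are taken coefficientwise. *)
Definition nc_is_derive (T : finType) (G : R -> ncseries C T) (u : R)
    (D : ncseries C T) : Prop :=
  forall w, is_derive u 1 (fun v => complex.Re (G v w)) (complex.Re (D w)) /\
            is_derive u 1 (fun v => complex.Im (G v w)) (complex.Im (D w)).

Definition nc_cvg (T : finType) (F : set_system R) (G : R -> ncseries C T)
    (l : ncseries C T) : Prop :=
  forall w, (fun v => complex.Re (G v w)) @ F --> complex.Re (l w) /\
            (fun v => complex.Im (G v w)) @ F --> complex.Im (l w).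

(* exp-valued solutions on ]0,1[ of (dG) G^-1 = omega(u) du *)
Definition exp_solution (T : finType) (omega : R -> ncseries C T)
    (G : R -> ncseries C T) : Prop :=
  forall u : R, 0 < u < 1 ->
    exp_lie (G u) /\
    exists2 D, nc_is_derive G u D & D * (G u)^-1 = omega u.

Definition equiv_at0 (T : finType) (x : ncseries C T)
    (G : R -> ncseries C T) : Prop :=
  nc_cvg 0^'+ (fun u => G u * ncpow u (- x)) 1.

Definition equiv_at1 (T : finType) (x : ncseries C T)
    (G : R -> ncseries C T) : Prop :=
  nc_cvg 1^'- (fun u => G u * ncpow (1 - u) (- x)) 1.

Definition f2A : ncseries C 'I_2 := ncletter C (inord 0).
Definition f2B : ncseries C 'I_2 := ncletter C (inord 1).

Definition KZ_form (u : R) : ncseries C 'I_2 :=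
  (u^-1)%:C *: f2A + ((u - 1)^-1)%:C *: f2B.

Definition is_Phi (Phi : ncseries C 'I_2) : Prop :=
  exists G0 G1 : R -> ncseries C 'I_2,
    [/\ exp_solution KZ_form G0, equiv_at0 f2A G0,
        exp_solution KZ_form G1, equiv_at1 f2B G1 &
        forall u : R, 0 < u < 1 -> Phi = (G1 u)^-1 * G0 u].

Definition is_Phi_half (Phi_half : ncseries C 'I_2) : Prop :=
  exists G0 Gh : R -> ncseries C 'I_2,
    [/\ exp_solution KZ_form G0, equiv_at0 f2A G0,
        exp_solution KZ_form Gh, Gh 2^-1 = 1 &
        forall u : R, 0 < u < 1 -> Phi_half = (Gh u)^-1 * G0 u].

Definition f3A : ncseries C 'I_3 := ncletter C (inord 0).
Definition f3b0 : ncseries C 'I_3 := ncletter C (inord 1).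
Definition f3b1 : ncseries C 'I_3 := ncletter C (inord 2).

Definition KZ2_form (z : R) : ncseries C 'I_3 :=
  (z^-1)%:C *: f3A + ((z - 1)^-1)%:C *: f3b0 + ((z + 1)^-1)%:C *: f3b1.

Definition is_Psi2 (Psi2 : ncseries C 'I_3) : Prop :=
  exists H0 H1 : R -> ncseries C 'I_3,
    [/\ exp_solution KZ2_form H0, equiv_at0 f3A H0,
        exp_solution KZ2_form H1, equiv_at1 f3b0 H1 &
        forall z : R, 0 < z < 1 -> Psi2 = (H1 z)^-1 * H0 z].

(* [eval2 f x y] is f(x, y), and [eval3 f x y0 y1] is f(x | y0, y1). *)
Definition eval2 (T : finType) (f : ncseries C 'I_2) (x y : ncseries C T) :=
  ncsubst (tnth [tuple x; y]) f.

Definition eval3 (T : finType) (f : ncseries C 'I_3)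
    (x y0 y1 : ncseries C T) :=
  ncsubst (tnth [tuple x; y0; y1]) f.

End KZ.

Section T4.
Variable R : realType.
Local Notation C := R[i].

(* The generators t_ij, i != j; the strands 1, ..., 4 are the ordinals 0, ..., 3. *)
Definition t4_gen : finType := {p : 'I_4 * 'I_4 | p.1 != p.2}.

Local Notation S := (ncseries C t4_gen).

(* t_ij as a series (0 when i = j, a case which is never used) *)
Definition tij (i j : 'I_4) : S :=
  if insub (i, j) is Some a then ncletter C (a : t4_gen) else 0.

Inductive t4_relator : S -> Prop :=
| t4_sym i j : i != j -> t4_relator (tij i j - tij j i)
| t4_tri i j k : i != j -> i != k -> j != k ->
    t4_relator (bracket (tij i j + tij i k) (tij j k))
| t4_comm i j k l : uniq [:: i; j; k; l] ->
    t4_relator (bracket (tij i j) (tij k l)).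

(* The Lie ideal of the free Lie algebra generated by the relators:
   t_4 is the quotient of [lie_poly] by [t4_ideal]. *)
Inductive t4_ideal : S -> Prop :=
| t4_ideal_rel r : t4_relator r -> t4_ideal r
| t4_ideal_lin c x y : t4_ideal x -> t4_ideal y -> t4_ideal (c *: x + y)
| t4_ideal_bracket x y : t4_ideal x -> lie_poly y -> t4_ideal (bracket x y)
| t4_ideal_zero : t4_ideal 0.

(* x represents a central element of t_4 *)
Definition t4_central (x : S) : Prop :=
  lie_poly x /\ forall y, lie_poly y -> t4_ideal (bracket x y).

(* The relators are homogeneous, so the degree completion of t_4 is the quotient
   of [lie_series] by [degree_completion t4_ideal], and its group is the quotient
   of [exp_lie]: two elements exp x and exp y of the latter have the same image
   iff x and y are equal in the completion of t_4. *)
Definition eq_exp_t4 (g h : S) : Prop :=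
  exists x y : S,
    [/\ lie_series x, lie_series y, g = ncexp x, h = ncexp y &
        degree_completion t4_ideal (x - y)].

Local Notation strand k := (inord k.-1 : 'I_4).

Definition t12 : S := tij (strand 1) (strand 2).
Definition t13 : S := tij (strand 1) (strand 3).
Definition t14 : S := tij (strand 1) (strand 4).
Definition t23 : S := tij (strand 2) (strand 3).
Definition t24 : S := tij (strand 2) (strand 4).
Definition t34 : S := tij (strand 3) (strand 4).

Definition t4_Z : S := \sum_(i < 4) \sum_(j < 4 | (i < j)%N) tij i j.

End T4.

Arguments t12 {R}.
Arguments t13 {R}.
Arguments t14 {R}.
Arguments t23 {R}.
Arguments t24 {R}.
Arguments t34 {R}.
Arguments t4_Z {R}.

(* Main.v *)
From HB Require Import structures.
Require Import Defs.
From mathcomp Require Import all_boot all_order all_algebra.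
From mathcomp Require Import complex.
From mathcomp Require Import all_classical all_reals all_analysis.
From mathcomp Require Import ring lra zify.

Set Implicit Arguments.
Unset Strict Implicit.
Unset Printing Implicit Defensive.

Import Order.TTheory GRing.Theory Num.Theory.
Import numFieldNormedType.Exports.

Local Open Scope classical_set_scope.
Local Open Scope ring_scope.

(** The identity is the comparison of two ways of solving one linear
    differential equation. The Knizhnik-Zamolodchikov connection of four points
    on a line, at 0, xy, y and 1, is the connection on the square 0 < x, y < 1
<<
      d - (t12 dx/x + t23 dx/(x - 1) + (t12 + t13 + t23) dy/y + t34 dy/(y - 1)
           + t24 d(xy)/(xy - 1)),
>>
    and the relations of t_4 say that it is flat ([omega_comm]). Its sections in
    the direction of y are governed by Phi(t13 + t23, t34) on the side x = 0 and
    by Phi_1/2(t12 + t13, t24 + t34) on the side x = 1 followed up to y = 1/2,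
    while on the side y = 0 one moves from x = 0 to x = 1 with Phi(t12, t23). On
    the hyperbola y = 1/(1 + x), which joins (0, 1) to (1, 1/2), the connection
    has poles at x = 0, 1, -1 only, with residues t12 + t34, t23 and t14 - Z;
    after multiplication by (1 + x)^Z it is the equation that defines
    Psi2(t12 + t34 | t23, t14) ([omega_hyp], [mder_hyp_psi]). So the flat section
    with standard asymptotics at the corner x = y = 0, restricted to the
    hyperbola, is a right multiple of (1 + x)^(-Z) H_0(x). The end (0, 1) shows
    that the constant is Phi(t13 + t23, t34) ([hyp_match_at0]); the end (1, 1/2)
    then expresses Psi2 through the other factors ([hyp_match_at1]). The power
    2^(Z - t23) comes from (1 + x)^Z at x = 1 and from y^t23 at y = 1/2.

    All this takes place in matrices. The Lie algebra t_4 acts on noncommutative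
    series in three letters x_1, x_2, x_3: t_i4 by the left multiplication by
    x_i, and t_ij by the derivation of the infinitesimal braid action. This
    representation is faithful because t_4 is the sum of the free Lie algebra on
    t_14, t_24, t_34, of the free Lie algebra on t_13, t_23 and of a line
    ([t4_decomposition], [t4_decomposition_uniq], [t4_ev_faithful]), and the same
    decomposition gives the center ([t4_centerP]). Truncated to words of bounded
    length, the operators become matrices that strictly raise a degree, on which
    the exponential is polynomial and injective; hence two elements of the group
    with the same image in all truncations are equal ([eq_exp_t4_of_ev]). That
    both sides belong to the group is the Baker-Campbell-Hausdorff theorem
    ([exp_lieM]). As the coefficients of the associators are real
    ([is_Phi_real]), real matrices suffice, and the identity to be proved is
    [ev3_psiE].

    The estimates only distinguish functions that grow more slowly than all the
    negative powers of the variable, like the powers u^A, from negligible ones,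
    which are u times such a function. Solutions with standard asymptotics are
    powers up to a negligible error ([regular_singular_rate]), and negligible
    errors stay negligible when they are multiplied by powers on both sides. *)

(** * Lie series and the group they generate *)

Section NCSums.
Variables (K : fieldType) (T : finType).
Local Notation S := (ncseries K T).
Implicit Types (f g x y : S) (w : seq T) (F G : nat -> S).

Definition order_ge k f := forall w, (size w < k)%N -> f w = 0.

(** The sum of such a family is finite on each word; [ncsum] is then a genuine
    infinite sum. *)
Definition summable F := forall k, order_ge k (F k).

Definition ncsum F : S := fun w => \sum_(k < (size w).+1) F k w.

Definition eq_below n f g := forall w, (size w < n)%N -> f w = g w.

Lemma nc_unitE f : (f \is a GRing.unit) = (f [::] != 0). Proof. by []. Qed.

Lemma ncsum_trunc F n w : summable F -> (size w < n)%N ->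
  ncsum F w = \sum_(k < n) F k w.
Proof.
move=> sF szw; rewrite /ncsum -!(big_mkord xpredT (fun k => F k w)).
rewrite [RHS](big_cat_nat _ (n := (size w).+1)) //= [X in _ + X]big_nat_cond.
by rewrite [X in _ + X]big1 ?addr0 // => k /andP[/andP[ltk _] _]; exact: sF.
Qed.

Lemma order_geM j k f g : order_ge j f -> order_ge k g -> order_ge (j + k) (f * g).
Proof.
move=> of_ og w szw; rewrite ncmulE; apply: big1 => -[i lti] _ /=.
have [lt_ij|le_ji] := ltnP i j.
  by rewrite of_ ?mul0r // size_take_min (leq_ltn_trans (geq_minl _ _)).
rewrite [g _]og ?mulr0 // size_drop.
by rewrite ltn_subLR // (leq_trans szw) // leq_add2r.
Qed.

Lemma order_geZ k c f : order_ge k f -> order_ge k (c *: f).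
Proof. by move=> of_ w szw; rewrite ncscaleE of_ // mulr0. Qed.

Lemma order_geB k f g : order_ge k f -> order_ge k g -> order_ge k (f - g).
Proof. by move=> of_ og w szw; rewrite ncsubE of_ // og // subr0. Qed.

Lemma order_ge1 f : f [::] = 0 -> order_ge 1 f.
Proof. by move=> f0 [|a w]. Qed.

Lemma summable_exp x : x [::] = 0 -> summable (fun k => x ^+ k).
Proof. by move=> x0 k w; exact: ncexp_small. Qed.

Lemma summable_scale (c : nat -> K) F : summable F -> summable (fun k => c k *: F k).
Proof. by move=> sF k; exact: order_geZ. Qed.

Lemma ncsumMr F y : summable F -> ncsum F * y = ncsum (fun k => F k * y).
Proof.
move=> sF; apply/ncseriesP => w.
transitivity (((\sum_(k < (size w).+1) F k) * y) w).
  rewrite !ncmulE; apply: eq_bigr => i _; congr (_ * _).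
  rewrite ncsumE (@ncsum_trunc _ (size w).+1) // ltnS size_take_min.
  exact: geq_minr.
by rewrite mulr_suml ncsumE.
Qed.

Lemma big_triangle (V : nmodType) (n : nat) (H : nat -> nat -> V) :
    (forall j k, (n <= j + k)%N -> H j k = 0) ->
  \sum_(j < n) \sum_(k < n) H j k = \sum_(m < n) \sum_(j < m.+1) H j (m - j)%N.
Proof.
move=> H0; transitivity (\sum_(j < n) \sum_(m < n | (j <= m)%N) H j (m - j)%N).
  apply: eq_bigr => -[j ltj] _ /=.
  rewrite -(big_mkord xpredT (H j)).
  rewrite -(big_mkord (fun m => j <= m)%N (fun m => H j (m - j)%N)).
  rewrite [RHS](big_cat_nat (leq0n j) (ltnW ltj)) /=.
  rewrite [X in _ = X + _]big_nat_cond [X in _ = X + _]big1 ?add0r; last first.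
    by move=> m /andP[/andP[_ ltm]]; rewrite leqNgt ltm.
  rewrite [LHS](big_cat_nat (leq0n _) (leq_subr j n)) /=.
  rewrite [X in _ + X]big_nat_cond [X in _ + X]big1 ?addr0; last first.
    by move=> k /andP[/andP[lek ltk] _]; apply: H0; rewrite -leq_subLR.
  transitivity (\sum_(0 + j <= i < n | (j <= i)%N) H j (i - j)%N); last by rewrite add0n.
  by rewrite big_addn; apply: eq_big => k; rewrite ?leq_addl ?addnK.
rewrite (exchange_big_dep xpredT) //=; apply: eq_bigr => m _.
by rewrite (big_ord_widen n (fun k => H k (m - k)%N)).
Qed.

Lemma ncsumM F G : summable F -> summable G ->
  ncsum F * ncsum G = ncsum (fun n => \sum_(k < n.+1) F k * G (n - k)%N).
Proof.
move=> sF sG; apply/ncseriesP => w; set n := (size w).+1.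
transitivity (((\sum_(k < n) F k) * (\sum_(k < n) G k)) w).
  rewrite !ncmulE; apply: eq_bigr => i _; rewrite !ncsumE.
  rewrite -!(@ncsum_trunc _ n) // ltnS ?size_take_min ?geq_minr //.
  by rewrite size_drop leq_subr.
rewrite mulr_suml ncsumE.
under eq_bigr => j _ do rewrite mulr_sumr ncsumE.
rewrite (big_triangle (H := fun j k => (F j * G k) w)) => [|j k lejk].
  by apply: eq_bigr => m _; rewrite ncsumE.
exact: (@order_geM j k).
Qed.

Lemma ncsum_shift F : summable F -> F 0%N = 0 ->
  ncsum F = ncsum (fun k => F k.+1).
Proof.
move=> sF F0; apply/ncseriesP => w; rewrite /ncsum big_ord_recl /= F0 add0r.
by rewrite [RHS]big_ord_recr /= sF // addr0.
Qed.

End NCSums.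

Section Exponential.
Variables (K : numFieldType) (T : finType).
Local Notation S := (ncseries K T).
Implicit Types (f g x y : S) (w : seq T).

Lemma ncexpE x : ncexp x = ncsum (fun k => (k`!%:R)^-1 *: x ^+ k).
Proof. by []. Qed.

Lemma ncexp_nil x : ncexp x [::] = 1.
Proof. by rewrite /ncexp big_ord_recl big_ord0 addr0 expr0 fact0 invr1 mul1r. Qed.

Lemma fact_neq0 n : n`!%:R != 0 :> K.
Proof. by rewrite pnatr_eq0 -lt0n fact_gt0. Qed.

Lemma bin_fact_inv n k : (k <= n)%N ->
  (n`!%:R)^-1 * 'C(n, k)%:R = (k`!%:R)^-1 * ((n - k)`!%:R)^-1 :> K.
Proof.
move=> lekn; apply: (mulfI (fact_neq0 n)); rewrite mulrA mulfV ?fact_neq0 // mul1r.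
by rewrite -(bin_fact lekn) !natrM -invfM mulfK // mulf_neq0 ?fact_neq0.
Qed.

Lemma ncexpD x y : x [::] = 0 -> y [::] = 0 -> x * y = y * x ->
  ncexp (x + y) = ncexp x * ncexp y.
Proof.
move=> x0 y0 cxy; rewrite !ncexpE ncsumM; first last.
- exact/summable_scale/summable_exp.
- exact/summable_scale/summable_exp.
congr ncsum; apply/funext => n; rewrite addrC exprDn_comm // scaler_sumr.
apply: eq_bigr => -[k ltk] _ /=; rewrite -scalerAl -scalerAr scalerA.
rewrite -[(_ * _) *+ _]scaler_nat scalerA bin_fact_inv //.
by congr (_ *: _); apply: commrX; apply: commr_sym; apply: commrX.
Qed.

Lemma ncexp0 : ncexp (0 : S) = 1.
Proof.
apply/ncseriesP => w; rewrite /ncexp big_ord_recl expr0 fact0 invr1 mul1r.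
by rewrite big1 ?addr0 // => k _; rewrite exprS mul0r nczeroE mulr0.
Qed.

Lemma ncexpNr x : x [::] = 0 -> ncexp x * ncexp (- x) = 1.
Proof.
move=> x0; rewrite -ncexpD ?subrr ?ncexp0 ?ncoppE ?x0 ?oppr0 //.
by rewrite mulrN mulNr.
Qed.

Lemma ncexp_unit x : ncexp x \is a GRing.unit.
Proof. by rewrite nc_unitE ncexp_nil oner_eq0. Qed.

Lemma ncexp_inv x : x [::] = 0 -> (ncexp x)^-1 = ncexp (- x).
Proof.
by move=> x0; apply: (mulrI (ncexp_unit x)); rewrite mulrV ?ncexp_unit // ncexpNr.
Qed.

Definition ad_iter x k y : S := iter k (bracket x) y.

Lemma bracketE x y : bracket x y = x * y - y * x. Proof. by []. Qed.

Lemma mul_ad x y : x * y = bracket x y + y * x.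
Proof. by rewrite bracketE subrK. Qed.

Lemma exprM_ad x y n :
  x ^+ n * y = \sum_(k < n.+1) (ad_iter x k y * x ^+ (n - k)) *+ 'C(n, k).
Proof.
elim: n => [|n IHn].
  by rewrite big_ord_recl big_ord0 /= expr0 mul1r mulr1 addr0 mulr1n.
rewrite exprS -mulrA IHn mulr_sumr.
transitivity (\sum_(k < n.+1) (ad_iter x k.+1 y * x ^+ (n - k)) *+ 'C(n, k) +
              \sum_(k < n.+1) (ad_iter x k y * x ^+ (n.+1 - k)) *+ 'C(n, k)).
  rewrite -big_split; apply: eq_bigr => -[k ltk] _ /=.
  rewrite mulrnAr mulrA [x * ad_iter _ _ _]mul_ad mulrDl mulrnDl.
  by congr (_ + _ *+ _); rewrite -mulrA -exprS subSn.
rewrite [X in _ + X]big_ord_recl [X in X + _]big_ord_recr /= [RHS]big_ord_recl.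
rewrite [X in _ = _ + X]big_ord_recr /= !bin0 !binn.
rewrite addrCA; congr (_ + _); rewrite !subSS !subnn addrC addrCA addrA.
congr (_ + _); rewrite -big_split; apply: eq_bigr => -[k ltk] _ /=.
by rewrite /bump /= add1n !subSS -mulrnDr binS addnC.
Qed.

Lemma sum_exprM_ad x y n :
  \sum_(i < n.+1) x ^+ i * y * x ^+ (n - i) =
  \sum_(k < n.+1) (ad_iter x k y * x ^+ (n - k)) *+ 'C(n.+1, k.+1).
Proof.
elim: n => [|n IHn]; first by rewrite !big_ord_recl !big_ord0 /= expr0 mul1r mulr1n.
rewrite big_ord_recr /= subnn expr0 mulr1 exprM_ad.
transitivity ((\sum_(i < n.+1) x ^+ i * y * x ^+ (n - i)) * x +
   \sum_(k < n.+2) (ad_iter x k y * x ^+ (n.+1 - k)) *+ 'C(n.+1, k)).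
  congr (_ + _); rewrite mulr_suml; apply: eq_bigr => -[k ltk] _ /=.
  by rewrite -[RHS]mulrA -exprSr subSn.
rewrite IHn mulr_suml.
transitivity (\sum_(k < n.+2) (ad_iter x k y * x ^+ (n.+1 - k)) *+ 'C(n.+1, k.+1)+
   \sum_(k < n.+2) (ad_iter x k y * x ^+ (n.+1 - k)) *+ 'C(n.+1, k)).
  congr (_ + _); rewrite [RHS]big_ord_recr /= bin_small // mulr0n addr0.
  apply: eq_bigr => -[k ltk] _ /=.
  by rewrite mulrnAl -mulrA -exprSr subSn.
by rewrite -[LHS]big_split; apply: eq_bigr => k _ /=; rewrite -mulrnDr -binS.
Qed.

Lemma order_ge_bracket j k x y :
  order_ge j x -> order_ge k y -> order_ge (j + k) (bracket x y).
Proof.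
by move=> ox oy; apply: order_geB; [|rewrite addnC]; exact: order_geM.
Qed.

Lemma summable_ad x y : x [::] = 0 -> summable (fun k => ad_iter x k y).
Proof.
move=> x0; elim=> [//|k IHk]; rewrite -add1n.
by apply: order_ge_bracket => //; exact: order_ge1.
Qed.

(** Conjugation by [ncexp x] is the exponential of the bracket with [x]: move
    [y] to the left through [x ^+ k] one factor at a time ([exprM_ad]). *)
Lemma ncexpM_ad x y : x [::] = 0 ->
  ncexp x * y = ncsum (fun k => (k`!%:R)^-1 *: ad_iter x k y) * ncexp x.
Proof.
move=> x0; rewrite ncexpE ncsumMr; last exact/summable_scale/summable_exp.
rewrite ncsumM; [|exact/summable_scale/summable_ad|exact/summable_scale/summable_exp].
congr ncsum; apply/funext => n; rewrite -scalerAl exprM_ad scaler_sumr.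
apply: eq_bigr => -[k ltk] _ /=; rewrite -scalerAl -scalerAr scalerA.
by rewrite -[(_ * _) *+ _]scaler_nat scalerA bin_fact_inv.
Qed.

(** The derivation that multiplies by the degree. In characteristic 0 it has no
    kernel in positive degree, so that its logarithmic derivative determines a
    series. *)
Definition degree_der f : S := fun w => (size w)%:R * f w.

Lemma degree_der_nil f : degree_der f [::] = 0. Proof. exact: mul0r. Qed.

Lemma degree_derM f g :
  degree_der (f * g) = degree_der f * g + f * degree_der g.
Proof.
apply/ncseriesP => w; rewrite ncaddE /degree_der !ncmulE mulr_sumr -big_split.
apply: eq_bigr => -[k ltk] _ /=; rewrite size_takel // size_drop.
by rewrite natrB // [in RHS]mulrCA -mulrA -mulrDl addrC subrK.
Qed.

Lemma degree_der1 : degree_der 1 = 0.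
Proof. by apply/ncseriesP => -[|a w]; rewrite /degree_der ?mul0r // nc1E mulr0. Qed.

Lemma degree_derX x n :
  degree_der (x ^+ n.+1) = \sum_(i < n.+1) x ^+ i * degree_der x * x ^+ (n - i).
Proof.
elim: n => [|n IHn]; first by rewrite big_ord_recl big_ord0 expr1 /= mul1r mulr1 addr0.
rewrite exprSr degree_derM IHn [RHS]big_ord_recr /= subnn; rewrite expr0 mulr1; congr (_ + _).
rewrite mulr_suml; apply: eq_bigr => -[k ltk] _ /=.
by rewrite -[LHS]mulrA -exprSr subSn.
Qed.

(** The Leibniz rule on [x ^+ n.+1] gives a sum over the position of the factor
    that is derived; moving this factor to the left produces the iterated
    brackets ([sum_exprM_ad]). *)
Lemma degree_der_exp x : x [::] = 0 ->
  degree_der (ncexp x) =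
  ncsum (fun k => (k.+1`!%:R)^-1 *: ad_iter x k (degree_der x)) * ncexp x.
Proof.
move=> x0; pose F k : S := (k`!%:R)^-1 *: degree_der (x ^+ k).
have oder k f : order_ge k f -> order_ge k (degree_der f).
  by move=> of_ w szw; rewrite /degree_der of_ // mulr0.
have sF : summable F by move=> k; apply/order_geZ/oder/summable_exp.
have -> : degree_der (ncexp x) = ncsum F.
  apply/ncseriesP => w; rewrite /degree_der /ncexp mulr_sumr.
  by apply: eq_bigr => k _; rewrite mulrCA.
rewrite ncsum_shift // /F; last by rewrite expr0 degree_der1 scaler0.
rewrite ncexpE ncsumM; first last.
- exact/summable_scale/summable_exp.
- exact/summable_scale/summable_ad.
congr ncsum; apply/funext => n; rewrite degree_derX sum_exprM_ad scaler_sumr.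
apply: eq_bigr => -[k ltk] _ /=; rewrite -scalerAl -scalerAr scalerA.
by rewrite -[(_ * _) *+ _]scaler_nat scalerA bin_fact_inv.
Qed.

Lemma eq_belowM n f f' g g' : f [::] = 0 -> g [::] = 0 ->
    f' [::] = 0 -> g' [::] = 0 -> eq_below n f f' -> eq_below n g g' ->
  eq_below n.+1 (f * g) (f' * g').
Proof.
move=> f0 g0 f'0 g'0 ff gg w; rewrite ltnS => szw; rewrite !ncmulE.
apply: eq_bigr => -[[|k] ltk] _ /=; first by rewrite take0 f0 f'0 !mul0r.
rewrite gg; last first.
  by rewrite size_drop (leq_trans _ szw) // ltn_subrL /=; case: (size w) ltk.
move: ltk; rewrite ltnS leq_eqVlt => /predU1P[k1|ltk].
  by rewrite k1 drop_size g'0 !mulr0.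
by rewrite ff // size_takel ?(leq_trans ltk) // ltnW.
Qed.

Lemma eq_below_bracket n f f' g g' : f [::] = 0 -> g [::] = 0 ->
    f' [::] = 0 -> g' [::] = 0 -> eq_below n f f' -> eq_below n g g' ->
  eq_below n.+1 (bracket f g) (bracket f' g').
Proof.
move=> f0 g0 f'0 g'0 ff gg w szw; rewrite !bracketE !ncsubE.
by rewrite (eq_belowM f0 g0 f'0 g'0 ff gg) // (eq_belowM g0 f0 g'0 f'0 gg ff).
Qed.

Lemma eq_belowW n f g : eq_below n.+1 f g -> eq_below n f g.
Proof. by move=> fg w szw; apply: fg; rewrite ltnS ltnW. Qed.

Lemma nilM f g : (f * g) [::] = f [::] * g [::].
Proof. by rewrite ncmulE big_ord_recl big_ord0 addr0. Qed.

Lemma nil_bracket f g : bracket f g [::] = 0.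
Proof. by rewrite bracketE ncsubE !nilM mulrC subrr. Qed.

(** The equation [ncexp z = g] determines [z] degree by degree, since the terms
    of degree at least 2 in [z] only involve shorter words. *)
Lemma nclog_exists g : g [::] = 1 -> exists2 z : S, z [::] = 0 & ncexp z = g.
Proof.
move=> g1; pose step z : S := g - (ncexp z - z).
have step0 (z : S) : z [::] = 0 -> step z [::] = 0.
  by move=> z0; rewrite /step !ncsubE ncexp_nil z0 subr0 g1 subrr.
have step_eq n (z z' : S) : z [::] = 0 -> z' [::] = 0 -> eq_below n z z' ->
    eq_below n.+1 (step z) (step z').
  move=> z0 z'0 zz w szw; rewrite /step ![(g - _) w]ncsubE; congr (_ - _).
  rewrite !ncsubE !ncexpE !(@ncsum_trunc _ _ _ (size w).+2) //; first last.
  - exact/summable_scale/summable_exp.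
  - exact/summable_scale/summable_exp.
  rewrite !big_ord_recl /= /bump /= !expr1 !fact0 !invr1 !scale1r !expr0.
  rewrite !(addrC (z w)) !(addrC (z' w)) !addrA !addrK; congr (_ + _).
  apply: eq_bigr => k _; rewrite !ncscaleE !add1n !(exprS _ k.+1); congr (_ * _).
  have zzk : eq_below n (z ^+ k.+1) (z' ^+ k.+1).
    elim: (k : nat) => [|m IHm]; first by rewrite !expr1.
    rewrite !(exprS _ m.+1); apply: eq_belowW; apply: eq_belowM => //.
    - by rewrite exprS nilM z0 mul0r.
    - by rewrite exprS nilM z'0 mul0r.
  apply: (@eq_belowM n) => //.
  - by rewrite exprS nilM z0 mul0r.
  - by rewrite exprS nilM z'0 mul0r.
pose z_ n := iter n step (0 : S).
have z_0 n : z_ n [::] = 0 by elim: n => [//|n IHn]; exact: step0.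
have z_S n : eq_below n (z_ n) (z_ n.+1).
  by elim: n => [//|n IHn]; exact: (step_eq n _ _ (z_0 n) (z_0 n.+1) IHn).
have z_D n m : eq_below n (z_ n) (z_ (n + m)%N).
  elim: m => [|m IHm] w szw; first by rewrite addn0.
  by rewrite IHm // addnS z_S // (leq_trans szw) // leq_addr.
pose z : S := fun w => z_ (size w).+1 w.
have zE n : eq_below n z (z_ n).
  by move=> w szw; rewrite /z (z_D (size w).+1 (n - (size w).+1)%N) // subnKC.
have z0 : z [::] = 0 by exact: z_0.
have stepz : step z = z.
  apply/ncseriesP => w; rewrite (step_eq (size w).+1 z (z_ (size w).+1)) //.
  - by rewrite (zE (size w).+2).
exists z => //; apply/esym/subr0_eq; apply: (addIr z); rewrite add0r -[RHS]stepz.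
by rewrite /step opprB [RHS]addrA addrAC.
Qed.

End Exponential.
Section LieSeries.
Variables (K : numFieldType) (T : finType).
Local Notation S := (ncseries K T).
Implicit Types (f g x y : S) (w : seq T) (n : nat).

Lemma nchomE n f w : nchom n f w = f w *+ (size w == n). Proof. by []. Qed.

Lemma nchom_nil f : nchom 0 f = f [::] *: 1.
Proof.
apply/ncseriesP => -[|a w]; rewrite nchomE ncscaleE nc1E /= ?mulr1 //.
by rewrite mulr0.
Qed.

Lemma nchomD n f g : nchom n (f + g) = nchom n f + nchom n g.
Proof. by apply/ncseriesP => w; rewrite ncaddE !nchomE ncaddE mulrnDl. Qed.

Lemma nchomZ n c f : nchom n (c *: f) = c *: nchom n f.
Proof. by apply/ncseriesP => w; rewrite ncscaleE !nchomE ncscaleE mulrnAr. Qed.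

Lemma nchomB n f g : nchom n (f - g) = nchom n f - nchom n g.
Proof. by rewrite -scaleN1r nchomD nchomZ scaleN1r. Qed.

Lemma nchom0 n : nchom n 0 = 0 :> S.
Proof. by apply/ncseriesP => w; rewrite nchomE nczeroE mul0rn. Qed.

Lemma nchomM n f g :
  nchom n (f * g) = \sum_(k < n.+1) nchom k f * nchom (n - k) g.
Proof.
apply/ncseriesP => w; rewrite nchomE ncsumE.
have [<-|neq_wn] := eqVneq; last first.
  rewrite mulr0n big1 // => -[k ltk] _ /=; rewrite ncmulE big1 // => -[j ltj] _ /=.
  rewrite !nchomE size_takel // size_drop.
  have [ejk|] := eqVneq j k; last by rewrite mulr0n mul0r.
  have [e|] := eqVneq; last by rewrite mulr0n mulr0.
  by case/eqP: neq_wn; rewrite -(subnKC (ltj : j <= _)%N) e ejk subnKC.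
rewrite mulr1n ncmulE; apply: eq_bigr => k _; rewrite ncmulE (bigD1 k) //=.
rewrite !nchomE size_takel -1?ltnS // size_drop !eqxx !mulr1n big1 ?addr0 //.
move=> j /negbTE jk; rewrite nchomE size_takel -1?ltnS //.
by rewrite -[_ == _ :> nat]/(j == k) jk mulr0n mul0r.
Qed.

Lemma nchom_bracket n f g :
  nchom n (bracket f g) = \sum_(k < n.+1) bracket (nchom k f) (nchom (n - k) g).
Proof.
rewrite bracketE nchomB !nchomM sumrB; congr (_ - _).
rewrite (reindex_inj rev_ord_inj) /=; apply: eq_bigr => -[k ltk] _ /=.
by rewrite subSS subKn.
Qed.

Lemma lie_poly_nil x : lie_poly x -> x [::] = 0.
Proof.
elim=> [a|c {}x y _ x0 _ y0|{}x y _ _ _ _|] //; last exact: nil_bracket.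
by rewrite ncaddE ncscaleE x0 y0 mulr0 addr0.
Qed.

Lemma lie_polyZ c x : lie_poly x -> lie_poly (c *: x).
Proof. by move=> lx; rewrite -[_ *: _]addr0; exact/lie_lin/lie_zero. Qed.

Lemma lie_polyD x y : lie_poly x -> lie_poly y -> lie_poly (x + y).
Proof. by move=> lx; rewrite -[x in x + _]scale1r; exact: lie_lin. Qed.

Lemma lie_polyB x y : lie_poly x -> lie_poly y -> lie_poly (x - y).
Proof. by move=> lx ly; rewrite addrC -scaleN1r; exact: lie_lin. Qed.

Lemma lie_poly_sum I (r : seq I) (P : pred I) (F : I -> S) :
  (forall i, P i -> lie_poly (F i)) -> lie_poly (\sum_(i <- r | P i) F i).
Proof. by move=> lF; elim/big_ind: _ => //; [exact: lie_zero|exact: lie_polyD]. Qed.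

Lemma lie_polyMn x n : lie_poly x -> lie_poly (x *+ n).
Proof. by rewrite -scaler_nat; exact: lie_polyZ. Qed.

Lemma lie_poly_hom n x : lie_poly x -> lie_poly (nchom n x).
Proof.
move=> lx; elim: lx n => [a|c {}x y _ lx _ ly|{}x y _ lx _ ly|] n.
- have -> : nchom n (ncletter K a) = ncletter K a *+ (n == 1)%N.
    apply/ncseriesP => w; rewrite nchomE /ncletter; case: (eqVneq w [:: a]) => [->|wa].
      by rewrite eq_sym; case: eqP; rewrite ?mulr1n ?eqxx // !mulr0n.
    by rewrite mul0rn; case: eqP; rewrite ?mulr1n ?(negbTE wa).
  exact/lie_polyMn/lie_letter.
- by rewrite nchomD nchomZ; apply: lie_lin.
- by rewrite nchom_bracket; apply: lie_poly_sum => k _; apply: lie_bracket.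
- by rewrite nchom0; exact: lie_zero.
Qed.

Lemma lie_poly_series x : lie_poly x -> lie_series x.
Proof. by move=> lx n; exact: lie_poly_hom. Qed.

Lemma lie_series_nil x : lie_series x -> x [::] = 0.
Proof. by move/(_ 0%N)/lie_poly_nil; rewrite nchomE mulr1n. Qed.

Lemma lie_seriesZ c x : lie_series x -> lie_series (c *: x).
Proof. by move=> lx n; rewrite nchomZ; exact: lie_polyZ. Qed.

Lemma lie_seriesD x y : lie_series x -> lie_series y -> lie_series (x + y).
Proof. by move=> lx ly n; rewrite nchomD; exact: lie_polyD. Qed.

Lemma lie_series_bracket x y :
  lie_series x -> lie_series y -> lie_series (bracket x y).
Proof.
by move=> lx ly n; rewrite nchom_bracket; apply: lie_poly_sum => k _; exact: lie_bracket.
Qed.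

Lemma lie_series_ad x y k : lie_series x -> lie_series y -> lie_series (ad_iter x k y).
Proof. by move=> lx ly; elim: k => [//|k IHk]; exact: lie_series_bracket. Qed.

Lemma nchom_ncsum n (F : nat -> S) :
  nchom n (ncsum F) = \sum_(k < n.+1) nchom n (F k).
Proof.
apply/ncseriesP => w; rewrite nchomE ncsumE; have [<-|swn] := eqVneq.
  by rewrite mulr1n; apply: eq_bigr => k _; rewrite nchomE eqxx mulr1n.
by rewrite mulr0n big1 // => k _; rewrite nchomE (negbTE swn) mulr0n.
Qed.

Lemma lie_series_sum (F : nat -> S) :
  (forall k, lie_series (F k)) -> lie_series (ncsum F).
Proof. by move=> lF n; rewrite nchom_ncsum; apply: lie_poly_sum => k _; exact: lF. Qed.

Lemma lie_series_degree_der x : lie_series x -> lie_series (degree_der x).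
Proof.
move=> lx n; have -> : nchom n (degree_der x) = n%:R *: nchom n x.
  apply/ncseriesP => w; rewrite ncscaleE !nchomE /degree_der -mulrnAr.
  by case: eqP => [->//|_]; rewrite mulr0n !mulr0.
exact: lie_polyZ.
Qed.

Lemma eq_below_nchom n f g : eq_below n.+1 f g -> nchom n f = nchom n g.
Proof.
move=> fg; apply/ncseriesP => w; rewrite !nchomE.
by have [swn|//] := eqVneq; rewrite fg // swn.
Qed.

(** In degree n, the logarithmic derivative of [ncexp z] is n times [z], up to
    iterated brackets of components of smaller degree. *)
Lemma lie_series_log (z : S) : z [::] = 0 ->
  lie_series (degree_der (ncexp z) * (ncexp z)^-1) -> lie_series z.
Proof.
move=> z0; rewrite degree_der_exp // mulrK ?ncexp_unit //; set L := ncsum _ => lL.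
suff lz n : forall m, (m < n)%N -> lie_poly (nchom m z).
  by move=> n; exact: (lz n.+1).
elim: n => [//|n IHn] m; rewrite ltnS leq_eqVlt => /predU1P[->|]; last exact: IHn.
pose z' : S := fun w => z w *+ (size w < n)%N.
have z'0 : z' [::] = 0 by rewrite /z' z0 mul0rn.
have lz' : lie_series z'.
  move=> k; have [ltkn|lenk] := ltnP k n.
    have -> : nchom k z' = nchom k z; last exact: IHn.
    apply/ncseriesP => w; rewrite !nchomE /z'.
    by case: eqP => [->|//]; rewrite ltkn !mulr1n.
  have -> : nchom k z' = 0; last exact: lie_zero.
  apply/ncseriesP => w; rewrite nchomE /z'.
  by case: eqP => [->|//]; rewrite ltnNge lenk.
have zz' : eq_below n z z' by move=> w szw; rewrite /z' szw mulr1n.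
have dzz' : eq_below n (degree_der z) (degree_der z').
  by move=> w szw; rewrite /degree_der zz'.
have ad0 (x : S) k : ad_iter x k (degree_der x) [::] = 0.
  by case: k => [|k]; [exact: degree_der_nil|exact: nil_bracket].
have ldz : lie_poly (nchom n (degree_der z)).
  have f1 : ((1`!)%:R)^-1 = 1 :> K by rewrite invr1.
  have := lL n; rewrite nchom_ncsum big_ord_recl /= f1 scale1r => H.
  rewrite -[nchom n _](addrK (\sum_(i < n) nchom n
     (((bump 0 i).+1)`!%:R^-1 *: ad_iter z (bump 0 i) (degree_der z)))).
  apply: lie_polyB => //; apply: lie_poly_sum => k _; rewrite nchomZ.
  apply: lie_polyZ; rewrite /bump leq0n add1n.
  rewrite (@eq_below_nchom n _ (ad_iter z' k.+1 (degree_der z'))).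
    exact/lie_series_ad/lie_series_degree_der.
  apply: (eq_below_bracket z0 (ad0 z k) z'0 (ad0 z' k) zz').
  elim: (k : nat) => [//|j IHj]; apply: eq_belowW.
  exact: (eq_below_bracket z0 (ad0 z j) z'0 (ad0 z' j) zz').
case: n {IHn zz' dzz' z' z'0 lz'} ldz => [|n] ldz.
  rewrite nchom_nil z0 scale0r; exact: lie_zero.
have -> : nchom n.+1 z = (n.+1%:R)^-1 *: nchom n.+1 (degree_der z).
  apply/ncseriesP => w; rewrite ncscaleE !nchomE /degree_der.
  by case: eqP => [->|_]; rewrite ?mulr0n ?mulr0 // !mulr1n mulKf ?pnatr_eq0.
exact: lie_polyZ.
Qed.

(** Belonging to the group is thus a condition on the logarithmic derivative,
    which behaves well under products. *)
Lemma exp_lieP g :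
  exp_lie g <-> g [::] = 1 /\ lie_series (degree_der g * g^-1).
Proof.
split=> [[x lx ->]|[g1 lg]].
  split; first exact: ncexp_nil.
  rewrite degree_der_exp ?lie_series_nil // mulrK ?ncexp_unit //.
  apply: lie_series_sum => k; apply/lie_seriesZ/lie_series_ad => //.
  exact: lie_series_degree_der.
have [z z0 zg] := nclog_exists g1; exists z => //.
by apply: lie_series_log => //; rewrite zg.
Qed.

Lemma exp_lie_nil g : exp_lie g -> g [::] = 1.
Proof. by case/exp_lieP. Qed.

Lemma exp_lie_unit g : exp_lie g -> g \is a GRing.unit.
Proof. by move/exp_lie_nil => g1; rewrite nc_unitE g1 oner_eq0. Qed.

(** The Baker-Campbell-Hausdorff theorem: the logarithmic derivative of a
    product is the sum of the one of the first factor and of a conjugate of the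
    one of the second factor, and conjugation preserves Lie series. *)
Lemma exp_lieM g h : exp_lie g -> exp_lie h -> exp_lie (g * h).
Proof.
move=> eg eh; have [g1 lg] := (exp_lieP g).1 eg; have [h1 lh] := (exp_lieP h).1 eh.
have [ug uh] := (exp_lie_unit eg, exp_lie_unit eh).
apply/exp_lieP; split; first by rewrite nilM g1 h1 mulr1.
have -> : degree_der (g * h) / (g * h) =
    degree_der g / g + g * (degree_der h / h) / g.
  by rewrite degree_derM invrM // mulrDl !mulrA mulrK.
apply: lie_seriesD => //; case: eg => x lx gE.
rewrite {1}gE ncexpM_ad ?lie_series_nil // -gE mulrK //; apply: lie_series_sum => k.
exact/lie_seriesZ/lie_series_ad.
Qed.

Lemma exp_lieV g : exp_lie g -> exp_lie g^-1.
Proof.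
case=> x lx ->; rewrite ncexp_inv ?lie_series_nil //; exists (- x) => //.
by rewrite -scaleN1r; exact: lie_seriesZ.
Qed.

End LieSeries.

(** * Evaluation of noncommutative series *)

Section WordSums.
Variables (T : finType) (V : nmodType).
Implicit Types (F : seq T -> V) (k : nat).

Definition wsum k F : V := \sum_(v : k.-tuple T) F v.

Lemma eq_wsum k F G : (forall v, size v = k -> F v = G v) -> wsum k F = wsum k G.
Proof. by move=> FG; apply: eq_bigr => v _; rewrite FG ?size_tuple. Qed.

Lemma wsum0 F : wsum 0 F = F [::].
Proof.
rewrite /wsum (bigD1 [tuple]) //= big1 ?addr0 // => v /eqP nv.
by case: nv; exact: tuple0.
Qed.

Lemma wsumS k F : wsum k.+1 F = \sum_a wsum k (fun v => F (a :: v)).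
Proof.
rewrite /wsum pair_bigA /=.
rewrite (reindex (fun p : T * k.-tuple T => cons_tuple p.1 p.2)) //=.
exists (fun t : k.+1.-tuple T => (thead t, behead_tuple t)) => [[a v] _|v _] /=.
  by congr pair; apply/val_inj.
by rewrite [RHS](tuple_eta v); apply/val_inj.
Qed.

Lemma wsum_cat j k (F : seq T -> seq T -> V) :
  wsum j (fun v => wsum k (F v)) = wsum (j + k) (fun u => F (take j u) (drop j u)).
Proof.
elim: j F => [|j IHj] F.
  by rewrite wsum0 add0n; apply: eq_wsum => v _; rewrite take0 drop0.
by rewrite addSn !wsumS; apply: eq_bigr => a _; rewrite (IHj (fun v => F (a :: v))).
Qed.

Lemma wsum_pick k F (w : seq T) : size w = k ->
  (forall v, v != w -> F v = 0) -> wsum k F = F w.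
Proof.
move=> szw F0; have szwk : size w == k by apply/eqP.
rewrite /wsum (bigD1 (Tuple szwk)) //= big1 ?addr0 // => v nv; apply: F0.
by apply: contraNN nv => /eqP vw; apply/eqP/val_inj.
Qed.

End WordSums.

Section Evaluation.
Variables (K : fieldType) (T : finType).
Local Notation S := (ncseries K T).

Section Truncated.
Variables (A : algType K) (s : T -> A).
Implicit Types (f g : S) (n : nat) (c : K).

Definition word_prod (v : seq T) : A := \prod_(a <- v) s a.

Lemma word_prod_cat u v : word_prod (u ++ v) = word_prod u * word_prod v.
Proof. exact: big_cat. Qed.

Lemma word_prod_nil : word_prod [::] = 1. Proof. exact: big_nil. Qed.

Lemma word_prod_cons a v : word_prod (a :: v) = s a * word_prod v.
Proof. exact: big_cons. Qed.

(** The value of f at [s], truncated at words of length n: exact when the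
    products of n values of [s] vanish. *)
Definition evn n f : A := \sum_(k < n) wsum k (fun v => f v *: word_prod v).

Lemma evn_lin n c f g : evn n (c *: f + g) = c *: evn n f + evn n g.
Proof.
rewrite /evn scaler_sumr -big_split; apply: eq_bigr => k _ /=.
rewrite /wsum scaler_sumr -big_split; apply: eq_bigr => v _ /=.
by rewrite ncaddE ncscaleE scalerDl scalerA.
Qed.

Lemma evn0 n : evn n 0 = 0.
Proof.
by rewrite /evn big1 // => k _; rewrite /wsum big1 // => v _; rewrite nczeroE scale0r.
Qed.

Lemma evnD n f g : evn n (f + g) = evn n f + evn n g.
Proof. by rewrite -[f]scale1r evn_lin !scale1r. Qed.

Lemma evnZ n c f : evn n (c *: f) = c *: evn n f.
Proof. by rewrite -[c *: f]addr0 evn_lin evn0 addr0. Qed.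

Lemma evnB n f g : evn n (f - g) = evn n f - evn n g.
Proof. by rewrite -scaleN1r evnD evnZ scaleN1r. Qed.

Lemma evn_sum n I (r : seq I) (P : pred I) (F : I -> S) :
  evn n (\sum_(i <- r | P i) F i) = \sum_(i <- r | P i) evn n (F i).
Proof. by elim/big_rec2: _ => [|i x y _ <-]; rewrite ?evn0 // evnD. Qed.

Lemma eq_evn n f g : eq_below n f g -> evn n f = evn n g.
Proof.
move=> fg; apply: eq_bigr => -[k ltk] _; apply: eq_wsum => v szv.
by rewrite fg // szv.
Qed.

Lemma evn1 n : (0 < n)%N -> evn n 1 = 1.
Proof.
case: n => // n _; rewrite /evn big_ord_recl wsum0 nc1E /= scale1r word_prod_nil.
rewrite big1 ?addr0 // => k _; rewrite /wsum big1 // => v _.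
by rewrite nc1E /nilp size_tuple /= scale0r.
Qed.

Lemma evn_letter n a : (1 < n)%N -> evn n (ncletter K a) = s a.
Proof.
case: n => // -[//|n] _; rewrite /evn !big_ord_recl /= wsum0 /ncletter /= scale0r add0r.
rewrite (@wsum_pick _ _ _ _ [:: a]) // => [|v /negbTE -> //]; last by rewrite scale0r.
rewrite eqxx scale1r word_prod_cons word_prod_nil mulr1 big1 ?addr0 // => k _.
rewrite /wsum big1 // => v _; case: eqP => [E|_]; last by rewrite scale0r.
by have := size_tuple v; rewrite E.
Qed.

(** The double sum defining the product of two evaluations differs from the
    evaluation of the product by words of length at least n, which any additive
    map may be used to kill. *)
Lemma evnM_mod (V : nmodType) (phi : A -> V) n f g :
    phi 0 = 0 -> {morph phi : x y / x + y} ->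
    (forall c u, (n <= size u)%N -> phi (c *: word_prod u) = 0) ->
  phi (evn n f * evn n g) = phi (evn n (f * g)).
Proof.
move=> phi0 phiD phi_big.
pose H j m := wsum m (fun u => (f (take j u) * g (drop j u)) *: word_prod u).
have -> : evn n f * evn n g = \sum_(j < n) \sum_(k < n) H j (j + k)%N.
  rewrite /evn mulr_suml; apply: eq_bigr => j _; rewrite mulr_sumr.
  apply: eq_bigr => k _.
  transitivity (wsum j (fun v => wsum k (fun w =>
      (f v * g w) *: word_prod (v ++ w)))).
    rewrite /wsum mulr_suml; apply: eq_bigr => v _; rewrite mulr_sumr.
    by apply: eq_bigr => w _; rewrite word_prod_cat -scalerAl -scalerAr scalerA.
  by rewrite wsum_cat; apply: eq_wsum => u _; rewrite cat_take_drop.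
have phi_sum I (r : seq I) (F : I -> A) :
    phi (\sum_(i <- r) F i) = \sum_(i <- r) phi (F i).
  exact: (big_morph phi phiD phi0).
rewrite phi_sum; under eq_bigr do rewrite phi_sum.
rewrite (big_triangle (H := fun j k => phi (H j (j + k)%N))) => [|j k lejk].
  rewrite /evn phi_sum; apply: eq_bigr => m _.
  rewrite -phi_sum; congr phi.
  transitivity (\sum_(i < m.+1) H i m).
    by apply: eq_bigr => i _; rewrite subnKC // -ltnS.
  rewrite /H /wsum exchange_big /=; apply: eq_bigr => u _.
  by rewrite -scaler_suml ncmulE size_tuple.
rewrite /H /wsum phi_sum big1 // => u _; apply: phi_big.
by rewrite size_tuple.
Qed.

Section Nilpotent.
Variable n : nat.
Hypothesis prod0 : forall u, (n <= size u)%N -> word_prod u = 0.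

Lemma nilpotent_gt0 : (0 < n)%N.
Proof.
by case: n prod0 => // /(_ [::] isT)/eqP; rewrite word_prod_nil oner_eq0.
Qed.

Lemma nil_evnM f g : evn n (f * g) = evn n f * evn n g.
Proof.
by apply/esym/(@evnM_mod _ id) => // c u /prod0 ->; rewrite scaler0.
Qed.

Lemma nil_evn1 : evn n 1 = 1. Proof. exact: evn1 nilpotent_gt0. Qed.

Lemma nil_evn_letter a : evn n (ncletter K a) = s a.
Proof.
have [lt1n|le1n] := ltnP 1 n; first exact: evn_letter.
have sa0 : s a = 0 by rewrite -(prod0 (u := [:: a])) // word_prod_cons word_prod_nil mulr1.
rewrite sa0 /evn; move: le1n nilpotent_gt0; case: n => // -[|//] _ _.
by rewrite big_ord_recl big_ord0 wsum0 /ncletter /= scale0r addr0.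
Qed.

Lemma nil_evnX f k : evn n (f ^+ k) = evn n f ^+ k.
Proof. by elim: k => [|k IHk]; rewrite ?expr0 ?nil_evn1 // !exprS nil_evnM IHk. Qed.

Lemma nil_evn_exp (x : S) : x [::] = 0 ->
  evn n (ncexp x) = \sum_(k < n) (k`!%:R)^-1 *: evn n x ^+ k.
Proof.
move=> x0; rewrite (@eq_evn _ _ (\sum_(k < n) (k`!%:R)^-1 *: x ^+ k)).
  by rewrite evn_sum; apply: eq_bigr => k _; rewrite evnZ nil_evnX.
move=> w szw; rewrite ncsumE.
by rewrite -(@ncsum_trunc _ _ (fun k => (k`!%:R)^-1 *: x ^+ k)) //
  ; exact/summable_scale/summable_exp.
Qed.

End Nilpotent.
End Truncated.
End Evaluation.

Lemma comm_scale (K : fieldType) (A : algType K) (c : K) (x y : A) :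
  GRing.comm x y -> GRing.comm x (c *: y).
Proof. by rewrite /GRing.comm -scalerAl -scalerAr => ->. Qed.

Section Substitution.
Variables (K : fieldType) (T U : finType) (s : T -> ncseries K U).
Hypothesis s_nil : forall a, s a [::] = 0.
Implicit Types (f g : ncseries K T).

Lemma order_ge_word_prod v : order_ge (size v) (word_prod s v).
Proof.
elim: v => [//|a v IHv]; rewrite word_prod_cons /= -add1n.
by apply: order_geM => //; exact: order_ge1.
Qed.

Lemma ncsubst_evn f n w : (size w < n)%N -> ncsubst s f w = evn s n f w.
Proof.
move=> szw; rewrite /ncsubst.
transitivity (\sum_(k < (size w).+1) (wsum k (fun v => f v *: word_prod s v)) w).
  by apply: eq_bigr => k _; rewrite /wsum ncsumE.
rewrite /evn ncsumE -!(big_mkord xpredT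
  (fun k => (wsum k (fun v => f v *: word_prod s v)) w)).
rewrite [RHS](big_cat_nat (leq0n _) szw) //= [X in _ + X]big_nat_cond.
rewrite [X in _ + X]big1 ?addr0 // => k /andP[/andP[ltk _] _].
rewrite /wsum ncsumE big1 // => v _; rewrite ncscaleE order_ge_word_prod ?mulr0 //.
by rewrite size_tuple.
Qed.

Lemma ncsubstM f g : ncsubst s (f * g) = ncsubst s f * ncsubst s g.
Proof.
apply/ncseriesP => w; set n := (size w).+1.
have szw : (size w < n)%N by [].
rewrite (ncsubst_evn _ szw).
rewrite -(@evnM_mod _ _ _ s _ (fun h : ncseries K U => h w)) //; last first.
  by move=> c u lenu; rewrite ncscaleE order_ge_word_prod ?mulr0 // (leq_trans szw).
rewrite !ncmulE; apply: eq_bigr => -[k ltk] _ /=.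
rewrite -!(@ncsubst_evn _ n) // ?size_drop ?size_takel //.
by rewrite ltnS leq_subr.
Qed.

Lemma ncsubst_lin c f g : ncsubst s (c *: f + g) = c *: ncsubst s f + ncsubst s g.
Proof.
apply/ncseriesP => w; rewrite ncaddE ncscaleE !(@ncsubst_evn _ (size w).+1) //.
by rewrite evn_lin.
Qed.

Lemma ncsubst0 : ncsubst s 0 = 0.
Proof. by apply/ncseriesP => w; rewrite (@ncsubst_evn _ (size w).+1) // evn0. Qed.

Lemma ncsubstD f g : ncsubst s (f + g) = ncsubst s f + ncsubst s g.
Proof. by rewrite -[f]scale1r ncsubst_lin !scale1r. Qed.

Lemma ncsubstZ c f : ncsubst s (c *: f) = c *: ncsubst s f.
Proof. by rewrite -[c *: f]addr0 ncsubst_lin ncsubst0 addr0. Qed.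

Lemma ncsubstB f g : ncsubst s (f - g) = ncsubst s f - ncsubst s g.
Proof. by rewrite -scaleN1r ncsubstD ncsubstZ scaleN1r. Qed.

Lemma ncsubst1 : ncsubst s 1 = 1.
Proof. by apply/ncseriesP => w; rewrite (@ncsubst_evn _ (size w).+1) // evn1. Qed.

Lemma ncsubst_letter a : ncsubst s (ncletter K a) = s a.
Proof.
by apply/ncseriesP => w; rewrite (@ncsubst_evn _ (size w).+2) // evn_letter.
Qed.

Lemma ncsubst_bracket f g :
  ncsubst s (bracket f g) = bracket (ncsubst s f) (ncsubst s g).
Proof. by rewrite /bracket ncsubstB !ncsubstM. Qed.

Lemma ncsubstX f k : ncsubst s (f ^+ k) = ncsubst s f ^+ k.
Proof. by elim: k => [|k IHk]; rewrite ?expr0 ?ncsubst1 // !exprS ncsubstM IHk. Qed.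

Lemma eq_below_ncsubst n f g : eq_below n f g -> eq_below n (ncsubst s f) (ncsubst s g).
Proof. by move=> fg w szw; rewrite !(ncsubst_evn _ szw) (eq_evn _ fg). Qed.

Lemma ncsubst_exp (x : ncseries K T) : x [::] = 0 -> ncsubst s (ncexp x) = ncexp (ncsubst s x).
Proof.
move=> x0; apply/ncseriesP => w; set n := (size w).+1.
pose e (y : ncseries K T) : ncseries K T := \sum_(k < n) (k`!%:R)^-1 *: y ^+ k.
rewrite (@eq_below_ncsubst n _ (e x)) //; last first.
  move=> v szv; rewrite /e ncsumE.
  by rewrite -(@ncsum_trunc _ _ (fun k => (k`!%:R)^-1 *: x ^+ k)) //
    ; exact/summable_scale/summable_exp.
rewrite /e (@ncsubst_evn _ n) // evn_sum ncsumE; apply: eq_bigr => k _.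
by rewrite evnZ ncscaleE -ncsubstX (@ncsubst_evn _ n).
Qed.

Lemma lie_poly_ncsubst f : (forall a, lie_poly (s a)) ->
  lie_poly f -> lie_poly (ncsubst s f).
Proof.
move=> lie_s; elim=> [a|c x y _ lx _ ly|x y _ lx _ ly|].
- by rewrite ncsubst_letter.
- by rewrite ncsubst_lin //; exact: lie_lin.
- by rewrite ncsubst_bracket //; exact: lie_bracket.
- by rewrite ncsubst0 //; exact: lie_zero.
Qed.

(** Checked on words: the words longer than n that appear in the substitution
    are killed by [sigma]. *)
Lemma evn_ncsubst (A : algType K) (sigma : U -> A) n f :
    (forall u, (n <= size u)%N -> word_prod sigma u = 0) ->
  evn sigma n (ncsubst s f) = evn (fun a => evn sigma n (s a)) n f.
Proof.
move=> prod0; rewrite (@eq_evn _ _ _ _ _ _ (evn s n f)); last first.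
  by move=> w; exact: ncsubst_evn.
rewrite /(evn s) evn_sum; apply: eq_bigr => k _; rewrite evn_sum; apply: eq_bigr => v _.
rewrite evnZ; congr (_ *: _).
elim: (v : seq T) => [|a w IHw]; first by rewrite !word_prod_nil nil_evn1.
by rewrite !word_prod_cons nil_evnM // IHw.
Qed.

End Substitution.

Section HomogeneousSubstitution.
Variables (K : numFieldType) (T U : finType) (s : T -> ncseries K U).
Hypothesis lie_s : forall a, lie_poly (s a).
Hypothesis hom_s : forall a w, size w != 1 -> s a w = 0.
Implicit Types (f g : ncseries K T).

Let s_nil a : s a [::] = 0. Proof. exact: hom_s. Qed.

Lemma hom_word_prod v w : size v != size w -> word_prod s v w = 0.
Proof.
elim: v w => [|a v IHv] w szvw.
  by rewrite word_prod_nil nc1E /nilp eq_sym (negbTE szvw).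
rewrite word_prod_cons ncmulE big1 // => -[k ltk] _ /=.
have [szk|szk] := eqVneq (size (take k w)) 1%N; last by rewrite hom_s ?mul0r.
rewrite IHv ?mulr0 // size_drop; have k1 : k = 1%N by rewrite -szk size_takel.
by move: szvw ltk; rewrite k1; case: (size w) => [//|m] /=; rewrite subn1 eqSS.
Qed.

Lemma ncsubst_hom n f : nchom n (ncsubst s f) = ncsubst s (nchom n f).
Proof.
apply/ncseriesP => w; rewrite nchomE /ncsubst.
have hom_only g : \sum_(k < (size w).+1) \sum_(v : k.-tuple T) g v * word_prod s v w =
    \sum_(v : (size w).-tuple T) g v * word_prod s v w.
  rewrite big_ord_recr /= big1 ?add0r // => k _; rewrite big1 // => v _.
  by rewrite hom_word_prod ?mulr0 // size_tuple neq_ltn ltn_ord.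
rewrite !hom_only; case: (eqVneq (size w) n) => [szw|szw].
  by rewrite mulr1n; apply: eq_bigr => v _; rewrite nchomE size_tuple; case: eqP szw.
rewrite mulr0n big1 // => v _.
by rewrite nchomE size_tuple (negbTE szw) mulr0n mul0r.
Qed.

Lemma lie_series_ncsubst f : lie_series f -> lie_series (ncsubst s f).
Proof. by move=> lf n; rewrite ncsubst_hom; apply: lie_poly_ncsubst. Qed.

Lemma exp_lie_ncsubst g : exp_lie g -> exp_lie (ncsubst s g).
Proof.
case=> x lx ->; rewrite ncsubst_exp ?lie_series_nil //.
by exists (ncsubst s x) => //; exact: lie_series_ncsubst.
Qed.

End HomogeneousSubstitution.

(** * Matrices that strictly raise a degree *)

Section GradedMatrices.
Variables (K : numFieldType) (n : nat) (d : 'I_n.+1 -> nat) (N : nat).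
Hypothesis ltdN : forall i, (d i < N)%N.
Local Notation M := 'M[K]_n.+1.
Implicit Types (X Y : M).

(** The entries of X vanish unless the row index has degree at least k more than
    the column index; d is the degree of the basis vectors. *)
Definition raises k X := forall i j, (d i < d j + k)%N -> X i j = 0.

Lemma raises_eq0 k X : (N <= k)%N -> raises k X -> X = 0.
Proof.
move=> leNk rX; apply/matrixP => i j; rewrite mxE rX //.
by rewrite (leq_trans (ltdN i)) // (leq_trans leNk) // leq_addl.
Qed.

Lemma raisesW j k X : (j <= k)%N -> raises k X -> raises j X.
Proof. by move=> lejk rX a b lt; apply: rX; rewrite (leq_trans lt) // leq_add2l. Qed.

Lemma raises0 k : raises k 0. Proof. by move=> i j _; rewrite mxE. Qed.

Lemma raisesD k X Y : raises k X -> raises k Y -> raises k (X + Y).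
Proof. by move=> rX rY i j lt; rewrite mxE rX // rY // addr0. Qed.

Lemma raisesZ k c X : raises k X -> raises k (c *: X).
Proof. by move=> rX i j lt; rewrite mxE rX // mulr0. Qed.

Lemma raisesN k X : raises k X -> raises k (- X).
Proof. by move=> rX; rewrite -scaleN1r; exact: raisesZ. Qed.

Lemma raisesB k X Y : raises k X -> raises k Y -> raises k (X - Y).
Proof. by move=> rX rY; apply: raisesD => //; exact: raisesN. Qed.

Lemma raises_sum k I (r : seq I) (P : pred I) (F : I -> M) :
  (forall i, P i -> raises k (F i)) -> raises k (\sum_(i <- r | P i) F i).
Proof. by move=> rF; elim/big_ind: _ => //; [exact: raises0|exact: raisesD]. Qed.

Lemma raisesM j k X Y : raises j X -> raises k Y -> raises (j + k) (X * Y).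
Proof.
move=> rX rY a b lt; rewrite mxE big1 // => c _.
have [ltac|leac] := ltnP (d a) (d c + j); first by rewrite rX // mul0r.
rewrite (rY c b) ?mulr0 // -(ltn_add2r j) (leq_ltn_trans leac) //.
by rewrite -addnA [(k + j)%N]addnC.
Qed.

Lemma raises_1 : raises 0 1.
Proof. by move=> i j; rewrite addn0 => ltij; rewrite mxE; case: eqP ltij => [->|//]; rewrite ltnn. Qed.

Lemma raises_exp X k : raises 1 X -> raises k (X ^+ k).
Proof.
move=> rX; elim: k => [|k IHk]; first exact: raises_1.
by rewrite exprS -add1n; exact: raisesM.
Qed.

Lemma raises_word_prod (T : finType) (s : T -> M) v :
  (forall a, raises 1 (s a)) -> raises (size v) (word_prod s v).
Proof.
move=> rs; elim: v => [|a v IHv]; first by rewrite word_prod_nil; exact: raises_1.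
by rewrite word_prod_cons /= -add1n; exact: raisesM.
Qed.

Lemma raises_word_prod0 (T : finType) (s : T -> M) v :
  (forall a, raises 1 (s a)) -> (N <= size v)%N -> word_prod s v = 0.
Proof. by move=> rs le; apply: (raises_eq0 le); exact: raises_word_prod. Qed.

Lemma raises_expN X k : raises 1 X -> (N <= k)%N -> X ^+ k = 0.
Proof. by move=> rX le; apply: (raises_eq0 le); exact: raises_exp. Qed.

Lemma raises_evn (T : finType) (s : T -> M) (f : ncseries K T) :
  (forall a, raises 1 (s a)) -> f [::] = 0 -> raises 1 (evn s N f).
Proof.
move=> rs f0; apply: raises_sum => -[[|k] ltk] _ /=.
  by rewrite wsum0 f0 scale0r; exact: raises0.
apply: raises_sum => v _; apply: raisesZ.
by apply: (@raisesW _ (size v)); [rewrite size_tuple|exact: raises_word_prod].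
Qed.

Definition mexp X : M := \sum_(k < N) (k`!%:R)^-1 *: X ^+ k.

Lemma evn_exp (T : finType) (s : T -> M) (x : ncseries K T) :
    (forall a, raises 1 (s a)) -> x [::] = 0 ->
  evn s N (ncexp x) = mexp (evn s N x).
Proof.
move=> rs x0; apply: nil_evn_exp => // u leu; exact: raises_word_prod0.
Qed.

Lemma N_gt0 : (0 < N)%N. Proof. exact: leq_trans (ltdN ord0). Qed.

Lemma mexpE X : mexp X = 1 + \sum_(k < N.-1) (k.+1`!%:R)^-1 *: X ^+ k.+1.
Proof.
by rewrite /mexp; case: N N_gt0 => // m _; rewrite big_ord_recl fact0 invr1 scale1r expr0.
Qed.

Lemma raises_mexp1 X : raises 1 X -> raises 1 (mexp X - 1).
Proof.
move=> rX; rewrite mexpE addrC addrA addNr add0r; apply: raises_sum => k _.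
by apply/raisesZ/(@raisesW _ k.+1) => //; exact: raises_exp.
Qed.

Lemma mexp0 : mexp 0 = 1.
Proof. by rewrite mexpE big1 ?addr0 // => k _; rewrite expr0n scaler0. Qed.

Lemma mexpD X Y : raises 1 X -> raises 1 Y -> X * Y = Y * X ->
  mexp (X + Y) = mexp X * mexp Y.
Proof.
move=> rX rY cXY; rewrite /mexp mulr_suml.
under [RHS]eq_bigr do rewrite mulr_sumr.
rewrite (big_triangle (H := fun j k =>
  ((j`!%:R)^-1 *: X ^+ j) * ((k`!%:R)^-1 *: Y ^+ k))) => [|j k lejk]; last first.
  rewrite -scalerAl -scalerAr (_ : X ^+ j * Y ^+ k = 0) ?scaler0 //.
  by apply: (raises_eq0 lejk); apply: raisesM; exact: raises_exp.
apply: eq_bigr => m _; rewrite addrC exprDn_comm // scaler_sumr.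
apply: eq_bigr => -[k ltk] _ /=; rewrite -scalerAl -scalerAr scalerA.
rewrite -[(_ * _) *+ _]scaler_nat scalerA bin_fact_inv //.
by congr (_ *: _); apply: commrX; apply: commr_sym; apply: commrX.
Qed.

Lemma mexpNr X : raises 1 X -> mexp X * mexp (- X) = 1.
Proof.
move=> rX; rewrite -mexpD ?subrr ?mexp0 //; first exact: raisesN.
by rewrite mulrN mulNr.
Qed.

Lemma mexpNl X : raises 1 X -> mexp (- X) * mexp X = 1.
Proof.
move=> rX; rewrite -mexpD ?addNr ?mexp0 //; first exact: raisesN.
by rewrite mulrN mulNr.
Qed.

Lemma comm_mexp X Y : GRing.comm X Y -> GRing.comm X (mexp Y).
Proof.
move=> cXY; apply: commr_sum => k _; apply: commr_sym.
by rewrite /GRing.comm -scalerAl -scalerAr; congr (_ *: _); apply/commr_sym/commrX.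
Qed.

Lemma comm_evn (T : finType) (s : T -> M) (f : ncseries K T) X :
  (forall a, GRing.comm X (s a)) -> GRing.comm X (evn s N f).
Proof.
move=> cXs; apply: commr_sum => k _; apply: commr_sum => v _.
rewrite /GRing.comm -scalerAl -scalerAr; congr (_ *: _).
by apply: commr_prod => a _.
Qed.

Definition agree k X Y := forall i j, (d i < d j + k)%N -> X i j = Y i j.

(** Each factor raises the degree, so that one more degree of a product is
    determined. *)
Lemma agreeM k X X' Y Y' : raises 1 X -> raises 1 X' -> raises 1 Y -> raises 1 Y' ->
  agree k X X' -> agree k Y Y' -> agree k.+1 (X * Y) (X' * Y').
Proof.
move=> rX rX' rY rY' aX aY i j lt; rewrite !mxE; apply: eq_bigr => l _.
have [lelj|ltjl] := leqP (d l) (d j).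
  by rewrite rY ?addn1 // rY' ?addn1 // !mulr0.
have [leil|ltli] := leqP (d i) (d l).
  by rewrite rX ?addn1 // rX' ?addn1 // !mul0r.
rewrite aX ?aY //.
  by rewrite -ltnS (leq_ltn_trans ltli) // -addnS.
by rewrite (leq_trans lt) // addnS -addSn leq_add2r.
Qed.

(** By induction on the degree: the powers of X beyond the first only depend on
    entries that raise the degree less. *)
Lemma mexp_inj X Y : raises 1 X -> raises 1 Y -> mexp X = mexp Y -> X = Y.
Proof.
move=> rX rY eXY; suff aXY k : agree k X Y.
  by apply/matrixP => i j; apply: (aXY N); rewrite (leq_trans (ltdN i)) // leq_addl.
elim: k => [|k IHk].
  move=> i j; rewrite addn0 => lt; rewrite rX ?rY //; exact: leq_trans (leq_addr _ _).
have [N1|N2] := leqP N 1.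
  by rewrite (raises_eq0 N1 rX) (raises_eq0 N1 rY).
have expE (Z : M) : mexp Z = 1 + Z + \sum_(m < N.-2) (m.+2`!%:R)^-1 *: Z ^+ m.+2.
  rewrite mexpE; case: N N2 => [|[|m]] // _.
  by rewrite big_ord_recl invr1 scale1r expr1 addrA.
have aX m : agree k.+1 (X ^+ m.+2) (Y ^+ m.+2).
  elim: m => [|m IHm]; first exact: agreeM.
  rewrite !(exprS _ m.+2); apply: agreeM => //.
  - exact/(@raisesW _ m.+2)/raises_exp.
  - exact/(@raisesW _ m.+2)/raises_exp.
  - by move=> i j lt; apply: IHm; rewrite (leq_trans lt) // addnS.
move=> i j lt; have /matrixP/(_ i j) := eXY; rewrite !expE.
rewrite !(mxE, summxE) => /eqP; rewrite -!addrA.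
rewrite (inj_eq (addrI _)) => /eqP.
have -> : \sum_(m < N.-2) ((m.+2)`!%:R^-1 *: Y ^+ m.+2) i j =
          \sum_(m < N.-2) ((m.+2)`!%:R^-1 *: X ^+ m.+2) i j.
  by apply: eq_bigr => m _; rewrite [LHS]mxE [RHS]mxE aX.
exact: addIr.
Qed.

End GradedMatrices.

(** * Graded operators on noncommutative series and their matrices *)

Section Operators.
Variables (K : numFieldType) (T : finType).
Local Notation S := (ncseries K T).
Implicit Types (f g h : S) (F G : S -> S) (u v w : seq T) (s : T -> S).

(** Linear operators that raise the degree by 1, and whose values on words of
    length k.+1 only depend on the argument in length k. The last condition
    makes them compatible with truncation. *)
Definition shifting F :=
  [/\ forall c f g, F (c *: f + g) = c *: F f + F g,
      forall f, F f [::] = 0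
    & forall k f g, (forall w, size w = k -> f w = g w) ->
        forall w, size w = k.+1 -> F f w = F g w].

Lemma shifting0 F : shifting F -> F 0 = 0.
Proof.
by case=> Flin _ _; have := Flin (-1) 0 0; rewrite scaler0 addr0 scaleN1r addNr.
Qed.

Lemma shiftingD F f g : shifting F -> F (f + g) = F f + F g.
Proof. by case=> Flin _ _; have := Flin 1 f g; rewrite !scale1r. Qed.

Lemma shiftingZ F c f : shifting F -> F (c *: f) = c *: F f.
Proof. by move=> sF; case: (sF) => /(_ c f 0) + _ _; rewrite (shifting0 sF) !addr0. Qed.

Lemma shifting_sum F I (r : seq I) (P : pred I) (H : I -> S) : shifting F ->
  F (\sum_(i <- r | P i) H i) = \sum_(i <- r | P i) F (H i).
Proof. by move=> sF; elim/big_rec2: _ => [|i x y _ <-]; rewrite ?shifting0 ?shiftingD. Qed.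

Lemma shifting_add F G : shifting F -> shifting G -> shifting (fun f => F f + G f).
Proof.
move=> [F1 F2 F3] [G1 G2 G3]; split=> [c f g|f|k f g fg w szw].
- by rewrite F1 G1 scalerDr addrACA.
- by rewrite ncaddE F2 G2 addr0.
- by rewrite !ncaddE (F3 _ _ _ fg) // (G3 _ _ _ fg).
Qed.

Definition delta w : S := fun u => (u == w)%:R.

Lemma deltaE w u : delta w u = (u == w)%:R. Proof. by []. Qed.

Lemma delta_nil : delta [::] = 1.
Proof. by apply/ncseriesP => -[|a w]. Qed.

Lemma shifting_delta F w u : shifting F -> size u != (size w).+1 -> F (delta w) u = 0.
Proof.
move=> sF; case: (sF) => _ F0 Fk; case: u => [|a u] szu; first exact: F0.
rewrite (Fk (size u) _ 0) ?shifting0 // => v szv; rewrite deltaE nczeroE.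
by case: eqP => // vw; case/eqP: szu; rewrite /= -szv vw.
Qed.

Definition lmul f g : S := f * g.

Lemma letterM a f u :
  (ncletter K a * f) u = if u is b :: u' then (b == a)%:R * f u' else 0.
Proof.
case: u => [|b u]; first by rewrite nilM mul0r.
rewrite ncmulE !big_ord_recl /= /ncletter /= mul0r add0r take0 drop0 big1 ?addr0.
  by rewrite eqseq_cons eqxx andbT.
move=> k _; case: u k => [|c u] k; first by case: k.
by rewrite eqseq_cons andbF mul0r.
Qed.

Lemma shifting_lmul a : shifting (lmul (ncletter K a)).
Proof.
split=> [c f g|f|k f g fg [//|b w] /= [szw]]; first by rewrite /lmul mulrDr scalerAr.
  by rewrite /lmul letterM.
by rewrite /lmul !letterM fg.
Qed.

Lemma lmul_delta a w : lmul (ncletter K a) (delta w) = delta (a :: w).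
Proof.
apply/ncseriesP => -[|b u]; rewrite /lmul letterM !deltaE //.
by rewrite eqseq_cons -natrM mulnb.
Qed.

Lemma ncseries_cons f : f = f [::] *: 1 + \sum_a ncletter K a * ncshift a f.
Proof.
apply/ncseriesP => -[|a w]; rewrite ncaddE ncscaleE nc1E ncsumE /= ?mulr1 ?mulr0 ?add0r.
  by rewrite big1 ?addr0 // => a _; rewrite letterM.
rewrite (bigD1 a) //= letterM eqxx mul1r big1 ?addr0 // => b /negbTE ba.
by rewrite letterM eq_sym ba mul0r.
Qed.

Lemma ncshiftM a f g :
  ncshift a (f * g) = f [::] *: ncshift a g + ncshift a f * g.
Proof. by apply/ncseriesP => w; rewrite /ncshift ncaddE ncscaleE [LHS]ncmul_cons. Qed.

Lemma ncshift_lin a c f g : ncshift a (c *: f + g) = c *: ncshift a f + ncshift a g.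
Proof. by []. Qed.

Lemma ncshift1 a : ncshift a 1 = 0 :> S. Proof. by []. Qed.

Lemma ncshift_letter a b : ncshift a (ncletter K b) = (a == b)%:R *: 1 :> S.
Proof.
apply/ncseriesP => w; rewrite /ncshift /ncletter ncscaleE nc1E eqseq_cons -natrM mulnb.
by case: w.
Qed.

Fixpoint derivation s f u : K :=
  (\sum_a s a * ncshift a f) u +
  if u is b :: u' then derivation s (ncshift b f) u' else 0.

(** The derivation that maps the letter a to [s a]; the recursion on the word at
    which the value is read makes it total on series. *)
Definition der s f : S := derivation s f.

Lemma derE s f : der s f =
  \sum_a s a * ncshift a f + \sum_a ncletter K a * der s (ncshift a f).
Proof.
apply/ncseriesP => -[|b u]; rewrite ncaddE /der /=; congr (_ + _); rewrite ncsumE.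
  by rewrite big1 // => a _; rewrite letterM.
rewrite (bigD1 b) //= letterM eqxx mul1r big1 ?addr0 // => a /negbTE ab.
by rewrite letterM eq_sym ab mul0r.
Qed.

Lemma der_lin s c f g : der s (c *: f + g) = c *: der s f + der s g.
Proof.
apply/ncseriesP => u; elim: u f g => [|b u IHu] f g; rewrite ncaddE ncscaleE /der /=.
  rewrite !addr0 !ncsumE mulr_sumr -big_split; apply: eq_bigr => a _ /=.
  by rewrite ncshift_lin mulrDr -scalerAr.
rewrite mulrDr addrACA; congr (_ + _).
  rewrite !ncsumE mulr_sumr -big_split; apply: eq_bigr => a _ /=.
  by rewrite ncshift_lin mulrDr -scalerAr.
by have := IHu (ncshift b f) (ncshift b g); rewrite ncaddE ncscaleE.
Qed.

Lemma derM s f g : der s (f * g) = der s f * g + f * der s g.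
Proof.
have derD f' g' : der s (f' + g') = der s f' + der s g'.
  by have := der_lin s 1 f' g'; rewrite !scale1r.
apply/ncseriesP => u; elim: u f g => [|b u IHu] f g.
  rewrite ncaddE !nilM /der /= !addr0 !ncsumE mulr_sumr mulr_suml -big_split.
  by apply: eq_bigr => a _ /=; rewrite ncshiftM mulrDr ncaddE !nilM ncscaleE mulrA mulrCA addrC.
have -> : der s (f * g) (b :: u) =
    (\sum_a s a * ncshift a (f * g)) (b :: u) + der s (ncshift b (f * g)) u by [].
rewrite ncshiftM der_lin ncaddE ncscaleE IHu ncaddE.
have -> : \sum_a s a * ncshift a (f * g) =
    f [::] *: (\sum_a s a * ncshift a g) + (\sum_a s a * ncshift a f) * g.
  rewrite scaler_sumr mulr_suml -big_split; apply: eq_bigr => a _ /=.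
  by rewrite ncshiftM mulrDr -scalerAr mulrA.
rewrite {1}(derE s f) mulrDl !ncaddE ncscaleE.
have -> : ((\sum_a ncletter K a * der s (ncshift a f)) * g) (b :: u) =
    (der s (ncshift b f) * g) u.
  rewrite mulr_suml ncsumE (bigD1 b) //= -mulrA letterM eqxx mul1r big1 ?addr0 //.
  by move=> a /negbTE ab; rewrite -mulrA letterM eq_sym ab mul0r.
have -> : (f * der s g) (b :: u) =
    f [::] * ((\sum_a s a * ncshift a g) (b :: u) + der s (ncshift b g) u) +
    (ncshift b f * der s g) u.
  by rewrite [LHS]ncmul_cons.
rewrite mulrDr; set x1 := f [::] * _; set x2 := (_ * g) _; set x3 := f [::] * _.
ring.
Qed.

Lemma der0 s : der s 0 = 0.
Proof. by have := der_lin s (-1) 0 0; rewrite scaler0 addr0 scaleN1r addNr. Qed.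

Lemma der1 s : der s 1 = 0.
Proof.
apply/ncseriesP => -[|b u]; rewrite /der /= ncsumE big1 ?add0r //.
- by move=> a _; rewrite ncshift1 mulr0.
- by rewrite ncshift1 -[derivation s 0]/(der s 0) der0.
- by move=> a _; rewrite ncshift1 mulr0.
Qed.

Lemma der_letter s a : der s (ncletter K a) = s a.
Proof.
rewrite derE (bigD1 a) //= ncshift_letter eqxx scale1r mulr1 big1 ?addr0.
  rewrite big1 ?addr0 // => b _; rewrite ncshift_letter.
  have := der_lin s (b == a)%:R 1 0; rewrite der1 der0 !addr0 scaler0 => ->.
  by rewrite mulr0.
by move=> b /negbTE ba; rewrite ncshift_letter ba scale0r mulr0.
Qed.

Lemma shifting_der s : (forall a w, size w != 2 -> s a w = 0) -> shifting (der s).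
Proof.
move=> s2; split=> [|f|]; first exact: der_lin.
  by rewrite /der /= addr0 ncsumE big1 // => a _; rewrite nilM s2 ?mul0r.
suff H k : forall f g w, (forall v, size v = k -> f v = g v) ->
    size w = k.+1 -> der s f w = der s g w.
  by move=> k f g fg w szw; exact: (H k).
elim: k => [|k IHk] f g [//|b w] fg [szw]; rewrite /der /=; congr (_ + _).
- rewrite !ncsumE; apply: eq_bigr => a _; rewrite !ncmulE; apply: eq_bigr => -[i lti] _.
  rewrite /= s2 ?mul0r // size_takel //=.
  by move: lti; rewrite /= szw; case: i => [|[|]].
- move: szw => /size0nil ->; rewrite /= !addr0 !ncsumE; apply: eq_bigr => a _.
  by rewrite !nilM s2 ?mul0r.
- rewrite !ncsumE; apply: eq_bigr => a _; rewrite !ncmulE; apply: eq_bigr => -[i lti] _.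
  have [e2|ne2] := eqVneq (size (take i (b :: w))) 2; last by rewrite !s2 ?mul0r.
  rewrite /ncshift fg //= size_drop.
  by move: e2; rewrite size_takel //= => ->; rewrite /= szw subSS subn1.
- by apply: IHk => // v szv; rewrite /ncshift fg //= szv.
Qed.

(** A derivation that kills the letters satisfies F f = \sum_a a * F (a^-1 f),
    and one more letter is removed at each step. *)
Lemma derivation_eq0 F :
    (forall c f g, F (c *: f + g) = c *: F f + F g) ->
    (forall f g, F (f * g) = F f * g + f * F g) ->
    (forall a, F (ncletter K a) = 0) ->
  forall f, F f = 0.
Proof.
move=> Flin FM Fa f.
have FD f' g' : F (f' + g') = F f' + F g' by have := Flin 1 f' g'; rewrite !scale1r.
have F0 : F 0 = 0 by have := Flin (-1) 0 0; rewrite scaler0 addr0 scaleN1r addNr.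
have F1 : F 1 = 0.
  have := FM 1 1; rewrite !mulr1 mul1r => /eqP.
  by rewrite -subr_eq0 opprD addrA subrr add0r oppr_eq0 => /eqP.
have Fsum (H : T -> S) : F (\sum_a H a) = \sum_a F (H a).
  by elim/big_rec2: _ => [//|a x y _ <-]; rewrite FD.
apply/ncseriesP => u; elim: u f => [|b u IHu] f.
all: rewrite [f]ncseries_cons Flin F1 scaler0 add0r Fsum ncsumE nczeroE.
  by rewrite big1 // => a _; rewrite FM Fa mul0r add0r letterM.
rewrite big1 // => a _; rewrite FM Fa mul0r add0r letterM.
by rewrite IHu mulr0.
Qed.

Definition is_derivation F :=
  (forall c f g, F (c *: f + g) = c *: F f + F g) /\
  (forall f g, F (f * g) = F f * g + f * F g).

Lemma der_is_derivation s : is_derivation (der s).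
Proof. by split; [exact: der_lin|exact: derM]. Qed.

Lemma is_derivationD F G :
  is_derivation F -> is_derivation G -> is_derivation (fun f => F f + G f).
Proof.
move=> [Fl FM] [Gl GM]; split=> [c f g|f g]; first by rewrite Fl Gl scalerDr addrACA.
by rewrite FM GM mulrDl mulrDr addrACA.
Qed.

Lemma derivation_comm (D E : S -> S) : is_derivation D -> is_derivation E ->
    (forall a, D (E (ncletter K a)) = E (D (ncletter K a))) ->
  forall f, D (E f) = E (D f).
Proof.
move=> [Dl DM] [El EM] DE f; apply/eqP; rewrite -subr_eq0; apply/eqP.
have DD g h : D (g + h) = D g + D h by have := Dl 1 g h; rewrite !scale1r.
have ED g h : E (g + h) = E g + E h by have := El 1 g h; rewrite !scale1r.
apply: (@derivation_eq0 (fun f => D (E f) - E (D f))) => [c g h|g h|a].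
- by rewrite El Dl Dl El scalerBr opprD addrACA.
- rewrite EM DM DD ED !DM !EM mulrBl mulrBr.
  apply/ncseriesP => w; rewrite !(ncsubE, ncaddE); ring.
- by rewrite DE subrr.
Qed.

End Operators.

Section OperatorMatrices.
Variables (K : numFieldType) (T : finType) (N : nat).
Local Notation S := (ncseries K T).
Implicit Types (f g : S) (F G : S -> S) (u v w : seq T).

(** The words of length at most N index the matrices; the predecessor is there
    because matrices of size n.+1 form a ring. *)
Definition wdim := #|{: N.-bseq T}|.-1.

Lemma wdimE : wdim.+1 = #|{: N.-bseq T}|.
Proof. by rewrite prednK //; apply/card_gt0P; exists [bseq]. Qed.

Definition wd (i : 'I_wdim.+1) : seq T := enum_val (cast_ord wdimE i).

Lemma wd_inj : injective wd.
Proof. by move=> i j /val_inj/enum_val_inj/cast_ord_inj. Qed.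

Lemma size_wd i : (size (wd i) < N.+1)%N.
Proof. exact: size_bseq. Qed.

Lemma wd_onto w : (size w <= N)%N -> exists i, wd i = w.
Proof.
move=> szw; exists (cast_ord (esym wdimE) (enum_rank (Bseq szw))).
by rewrite /wd cast_ordKV enum_rankK.
Qed.

Local Notation dg := (fun i => size (wd i)).

Definition mxop F : 'M[K]_wdim.+1 := \matrix_(i, j) F (delta K (wd j)) (wd i).

Lemma mxopE F i j : mxop F i j = F (delta K (wd j)) (wd i).
Proof. by rewrite mxE. Qed.

Lemma raises_mxop F : shifting F -> raises dg 1 (mxop F).
Proof.
move=> sF i j; rewrite addn1 => lt; rewrite mxopE shifting_delta //.
by rewrite neq_ltn lt.
Qed.

(** The truncation loses no term of a product, since the values of F f on words
    of length at most N only involve those of f on shorter words. *)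
Lemma mxop_comp F G : shifting F -> (forall f, G f [::] = 0) ->
  mxop (fun f => F (G f)) = mxop F * mxop G.
Proof.
move=> sF G0; apply/matrixP => i j; rewrite mxopE [RHS]mxE.
pose g := G (delta K (wd j)).
pose g' : S := \sum_k g (wd k) *: delta K (wd k).
have gg' w : (size w <= N)%N -> g w = g' w.
  move=> /wd_onto[k <-]; rewrite /g' ncsumE (bigD1 k) //= ncscaleE deltaE eqxx mulr1.
  rewrite big1 ?addr0 // => l; rewrite ncscaleE deltaE eq_sym.
  by rewrite (inj_eq wd_inj) eq_sym => /negbTE ->; rewrite mulr0.
case: (sF) => _ F0 Fk; rewrite -/g.
have -> : F g (wd i) = F g' (wd i).
  have := size_wd i; case: (wd i) => [|a u] szu; first by rewrite !F0.
  by apply: (Fk (size u)) => // v szv; apply: gg'; rewrite szv -ltnS ltnW.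
rewrite /g' shifting_sum // ncsumE; apply: eq_bigr => k _.
by rewrite shiftingZ // ncscaleE !mxopE mulrC.
Qed.

Lemma mxop_add F G : mxop (fun f => F f + G f) = mxop F + mxop G.
Proof. by apply/matrixP => i j; rewrite !mxE. Qed.

Lemma eq_mxop F G : F =1 G -> mxop F = mxop G.
Proof. by move=> FG; apply/matrixP => i j; rewrite !mxE FG. Qed.

Lemma evn_mxop (U : finType) (F : U -> S -> S) (f : ncseries K U) i j :
    (forall a, shifting (F a)) ->
  evn (fun a => mxop (F a)) N.+1 f i j =
  \sum_(k < N.+1) wsum k (fun v : seq U => f v * foldr F (delta K (wd j)) v (wd i)).
Proof.
move=> sF.
have prodE (v : seq U) : word_prod (fun a => mxop (F a)) v i j = foldr F (delta K (wd j)) v (wd i).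
  suff: word_prod (fun a => mxop (F a)) v = mxop (fun g => foldr F g v).
    by move=> ->; rewrite mxopE.
  elim: v => [|a v IHv].
    rewrite word_prod_nil; apply/matrixP => k l; rewrite !mxE /= deltaE.
    by rewrite (inj_eq wd_inj).
  rewrite word_prod_cons IHv.
  case: v {IHv} => [|b v].
    rewrite [X in _ * X](_ : _ = 1) ?mulr1; last first.
      by apply/matrixP => k l; rewrite !mxE /= deltaE (inj_eq wd_inj).
    by apply: eq_mxop.
  rewrite -mxop_comp //= => g; by case: (sF b).
rewrite summxE; apply: eq_bigr => k _; rewrite /wsum summxE.
by apply: eq_bigr => v _; rewrite mxE prodE.
Qed.

Lemma size_foldr_shifting (U : finType) (F : U -> S -> S) (v : seq U) w u :
    (forall a, shifting (F a)) -> size u != (size w + size v)%N ->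
  foldr F (delta K w) v u = 0.
Proof.
move=> sF; elim: v u => [|a v IHv] u /=.
  by rewrite addn0 deltaE; case: (eqVneq u w) => [->|//]; rewrite eqxx.
case: (sF a) => _ F0 Fk; rewrite addnS; case: u => [|b u] szu; first by rewrite F0.
rewrite (Fk (size u) _ 0) ?shifting0 // => v' szv'.
by rewrite IHv ?nczeroE // szv'.
Qed.

End OperatorMatrices.

(** * The structure of the Lie algebra t_4 *)

Section Brackets.
Variables (K : numFieldType) (T : finType).
Local Notation S := (ncseries K T).
Implicit Types (f g h : S).

Lemma bracket_linl c f g h : bracket (c *: f + g) h = c *: bracket f h + bracket g h.
Proof.
by rewrite !bracketE mulrDl mulrDr scalerBr -scalerAl -scalerAr opprD addrACA.
Qed.

Lemma bracketDl f g h : bracket (f + g) h = bracket f h + bracket g h.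
Proof. by rewrite -[f in LHS]scale1r bracket_linl scale1r. Qed.

Lemma bracketC f g : bracket f g = - bracket g f.
Proof. by rewrite !bracketE opprB. Qed.

Lemma bracketDr f g h : bracket f (g + h) = bracket f g + bracket f h.
Proof. by rewrite !(bracketC f) bracketDl opprD. Qed.

Lemma bracket0r f : bracket f 0 = 0. Proof. by rewrite bracketE mulr0 mul0r subrr. Qed.

Lemma bracketff f : bracket f f = 0. Proof. by rewrite bracketE subrr. Qed.

Lemma bracketZl c f g : bracket (c *: f) g = c *: bracket f g.
Proof. by rewrite -[c *: f]addr0 bracket_linl [bracket 0 g]bracketC bracket0r oppr0 addr0. Qed.

Lemma bracketZr c f g : bracket f (c *: g) = c *: bracket f g.
Proof. by rewrite bracketC bracketZl -scalerN -bracketC. Qed.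

Lemma bracketNr f g : bracket f (- g) = - bracket f g.
Proof. by rewrite -scaleN1r bracketZr scaleN1r. Qed.

Lemma bracketNl f g : bracket (- f) g = - bracket f g.
Proof. by rewrite -scaleN1r bracketZl scaleN1r. Qed.

Lemma bracketBl f g h : bracket (f - g) h = bracket f h - bracket g h.
Proof. by rewrite bracketDl bracketNl. Qed.

Lemma bracketBr f g h : bracket f (g - h) = bracket f g - bracket f h.
Proof. by rewrite bracketDr bracketNr. Qed.

Lemma jacobi f g h :
  bracket f (bracket g h) = bracket (bracket f g) h + bracket g (bracket f h).
Proof.
apply/ncseriesP => w.
rewrite ncaddE !bracketE !(mulrBl, mulrBr) !mulrA !ncsubE; ring.
Qed.

Lemma der_bracket s f g :
  der s (bracket f g) = bracket (der s f) g + bracket f (der s g).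
Proof.
have -> : bracket f g = -1 *: (g * f) + f * g by rewrite scaleN1r addrC.
rewrite der_lin scaleN1r !derM !bracketE opprD addrC [- _ - _]addrC.
by rewrite [in RHS]addrACA [- (_ * der s f) - _]addrC [RHS]addrACA addrACA.
Qed.

End Brackets.

Section Representation.
Variable K : numFieldType.
Local Notation S3 := (ncseries K 'I_3).
Local Notation S4 := (ncseries K t4_gen).
Local Notation x := (ncletter K).
Implicit Types (a b c e : 'I_3) (f g : S3).

(** The infinitesimal Artin action of the pure braids on the free group *)
Definition braid_image a b c : S3 :=
  if c == a then bracket (x a) (x b) else if c == b then bracket (x b) (x a) else 0.

Definition braid_der a b : S3 -> S3 := der (braid_image a b).

Lemma braid_imageC a b : a != b -> braid_image a b =1 braid_image b a.
Proof.
move=> ab c; rewrite /braid_image; case: (eqVneq c a) => [->|//].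
by rewrite (negbTE ab).
Qed.

Lemma braid_derC a b : a != b -> braid_der a b = braid_der b a.
Proof. by move=> ab; congr der; apply/funext; exact: braid_imageC. Qed.

Lemma braid_der_letter a b c : braid_der a b (x c) = braid_image a b c.
Proof. exact: der_letter. Qed.

Lemma braid_derl a b : braid_der a b (x a) = bracket (x a) (x b).
Proof. by rewrite braid_der_letter /braid_image eqxx. Qed.

Lemma braid_derr a b : a != b -> braid_der a b (x b) = bracket (x b) (x a).
Proof. by move=> ab; rewrite braid_derC // braid_derl. Qed.

Lemma braid_dern a b c : c != a -> c != b -> braid_der a b (x c) = 0.
Proof. by move=> /negbTE ca /negbTE cb; rewrite braid_der_letter /braid_image ca cb. Qed.

Lemma shifting_braid_der a b : shifting (braid_der a b).
Proof.
apply: shifting_der => c w szw; rewrite /braid_image.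
have H e e' : bracket (x e) (x e') w = 0.
  rewrite bracketE ncsubE !letterM; case: w szw => [|k [|l [|m w]]] //= _;
  by rewrite /ncletter /= ?eqseq_cons ?andbF /= ?mulr0 subrr.
by case: ifP => // _; case: ifP.
Qed.

(** The representation of t_4 on series in three letters: the last strand acts
    by multiplication, the others by derivations. *)
Definition t4_op (i j : 'I_4) : S3 -> S3 :=
  match unlift ord_max i, unlift ord_max j with
  | Some a, Some b => braid_der a b
  | Some a, None | None, Some a => lmul (x a)
  | None, None => fun=> 0
  end.

Lemma shifting_t4_op i j : shifting (t4_op i j).
Proof.
rewrite /t4_op; case: unlift => [a|]; case: unlift => [b|].
- exact: shifting_braid_der.
- exact: shifting_lmul.
- exact: shifting_lmul.
- by split=> // c f g; rewrite scaler0 addr0.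
Qed.

Lemma unlift_eq n (h i j : 'I_n) : (unlift h i == unlift h j) = (i == j).
Proof.
case: (unliftP h i) => [i' ->|->]; case: (unliftP h j) => [j' ->|->] //.
- by rewrite (inj_eq (@lift_inj _ h)).
- by rewrite [RHS]eq_sym (negbTE (neq_lift h i')).
- by rewrite (negbTE (neq_lift h j')).
- by rewrite !eqxx.
Qed.

Lemma t4_opC i j : i != j -> t4_op i j = t4_op j i.
Proof.
rewrite -(unlift_eq ord_max) /t4_op.
by case: unlift => [a|]; case: unlift => [b|] //= ab; exact: braid_derC.
Qed.

Lemma braid_der_lmul a b c f :
  braid_der a b (x c * f) = braid_image a b c * f + x c * braid_der a b f.
Proof. by rewrite /braid_der derM der_letter. Qed.

Lemma braid_der_tri a b c f : a != b -> a != c -> b != c ->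
  braid_der a b (braid_der b c f) + braid_der a c (braid_der b c f) =
  braid_der b c (braid_der a b f) + braid_der b c (braid_der a c f).
Proof.
move=> ab ac bc; rewrite -(shiftingD _ _ (shifting_braid_der b c)).
apply: (derivation_comm (D := fun f => braid_der a b f + braid_der a c f)) f => [||e].
- by apply: is_derivationD; exact: der_is_derivation.
- exact: der_is_derivation.
rewrite (shiftingD _ _ (shifting_braid_der b c)) /=.
have bra i j g h : braid_der i j (bracket g h) =
  bracket (braid_der i j g) h + bracket g (braid_der i j h) by exact: der_bracket.
have bra0 i j : braid_der i j 0 = 0 by exact: der0.
have [->|ea] := eqVneq e a.
  rewrite !(braid_derl a) braid_dern // !bra0 !bra !braid_derl braid_derr //.
  rewrite braid_dern // ![bracket 0 _]bracketC !bracket0r oppr0 !add0r.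
  by rewrite [bracket (x c) _]bracketC bracketNr subrr.
have [->|eb] := eqVneq e b.
  have ba : b != a by rewrite eq_sym.
  have ca : c != a by rewrite eq_sym.
  have cb : c != b by rewrite eq_sym.
  rewrite !(braid_derl b) braid_derr // (braid_dern ba bc) bra0 !bra.
  rewrite !braid_derl !braid_derr // !braid_dern //.
  rewrite ![bracket 0 _]bracketC !bracket0r oppr0 !add0r !addr0.
  apply/ncseriesP => w.
  rewrite ?bracketE ?(mulrBl, mulrBr) ?mulrA ?(ncsubE, ncaddE, nczeroE); ring.
have [->|ec] := eqVneq e c.
  have ba : b != a by rewrite eq_sym.
  have ca : c != a by rewrite eq_sym.
  have cb : c != b by rewrite eq_sym.
  rewrite !(braid_derr bc) (braid_derr ac) (braid_dern ca cb) bra0 !bra.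
  rewrite !braid_derr // !braid_dern //.
  rewrite ![bracket 0 _]bracketC !bracket0r oppr0 !add0r !addr0.
  apply/ncseriesP => w.
  rewrite ?bracketE ?(mulrBl, mulrBr) ?mulrA ?(ncsubE, ncaddE, nczeroE); ring.
by rewrite !(braid_dern ea eb) (braid_dern eb ec) (braid_dern ea ec) !bra0.
Qed.

(** The defining relations of t_4, checked on the letters when all the operators
    are derivations, and by the Leibniz rule when the last strand occurs. *)
Lemma t4_op_tri i j k f : i != j -> i != k -> j != k ->
  t4_op i j (t4_op j k f) + t4_op i k (t4_op j k f) =
  t4_op j k (t4_op i j f) + t4_op j k (t4_op i k f).
Proof.
rewrite -!(unlift_eq ord_max) /t4_op.
case: (unlift ord_max i) => [a|]; case: (unlift ord_max j) => [b|];
  case: (unlift ord_max k) => [c|] //=.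
- exact: braid_der_tri.
- move=> ab _ _; rewrite /lmul braid_der_lmul -braid_der_letter braid_derr //.
  apply/ncseriesP => w.
  rewrite ?bracketE ?(mulrBl, mulrBr) ?mulrA ?(ncsubE, ncaddE, nczeroE); ring.
- move=> _ ac _; rewrite /lmul braid_der_lmul -braid_der_letter braid_derr //.
  apply/ncseriesP => w.
  rewrite ?bracketE ?(mulrBl, mulrBr) ?mulrA ?(ncsubE, ncaddE, nczeroE); ring.
- move=> _ _ bc; rewrite /lmul !braid_der_lmul -!braid_der_letter braid_derr // braid_derl.
  apply/ncseriesP => w.
  rewrite ?bracketE ?(mulrBl, mulrBr) ?mulrA ?(ncsubE, ncaddE, nczeroE); ring.
Qed.

Lemma t4_op_comm i j k l f : uniq [:: i; j; k; l] ->
  t4_op i j (t4_op k l f) = t4_op k l (t4_op i j f).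
Proof.
have uE : uniq [:: i; j; k; l] = uniq (map (unlift ord_max) [:: i; j; k; l]).
  by rewrite map_inj_uniq // => p q /eqP; rewrite unlift_eq => /eqP.
rewrite {}uE /t4_op /=.
case: (unlift ord_max i) => [a|]; case: (unlift ord_max j) => [b|];
  case: (unlift ord_max k) => [c|]; case: (unlift ord_max l) => [e|] //=;
  rewrite !inE /= ?orbT //= ?andbF //.
- move=> u; have := max_card (mem [:: a; b; c; e]); rewrite card_ord.
  by rewrite (card_uniqP _) //= !inE.
all: rewrite /= ?orbF ?andbT => /andP[].
- move=> /norP[ab ac] bc; rewrite /lmul braid_der_lmul -braid_der_letter braid_dern.
  + by rewrite mul0r add0r.
  + by rewrite eq_sym.
  + by rewrite eq_sym.
- move=> /norP[ab ae] be; rewrite /lmul braid_der_lmul -braid_der_letter braid_dern.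
  + by rewrite mul0r add0r.
  + by rewrite eq_sym.
  + by rewrite eq_sym.
- move=> /norP[ac ae] ce; rewrite /lmul braid_der_lmul -braid_der_letter braid_dern //.
  by rewrite mul0r add0r.
- move=> /norP[bc be] ce; rewrite /lmul braid_der_lmul -braid_der_letter braid_dern //.
  by rewrite mul0r add0r.
Qed.

End Representation.

Section T4Algebra.
Variable R : realType.
Local Notation C := R[i].
Local Notation S4 := (ncseries C t4_gen).
Implicit Types (x y z : S4) (i j k l : 'I_4) (c : C).

Lemma t4_idealZ c x : t4_ideal x -> t4_ideal (c *: x).
Proof. by move=> Ix; rewrite -[_ *: _]addr0; exact/t4_ideal_lin/t4_ideal_zero. Qed.

Lemma t4_idealD x y : t4_ideal x -> t4_ideal y -> t4_ideal (x + y).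
Proof. by move=> Ix; rewrite -[x in x + _]scale1r; exact: t4_ideal_lin. Qed.

Lemma t4_idealN x : t4_ideal x -> t4_ideal (- x).
Proof. by rewrite -scaleN1r; exact: t4_idealZ. Qed.

Lemma t4_idealB x y : t4_ideal x -> t4_ideal y -> t4_ideal (x - y).
Proof. by move=> Ix Iy; apply: t4_idealD => //; exact: t4_idealN. Qed.

Lemma t4_ideal_bracketl x y : t4_ideal x -> lie_poly y -> t4_ideal (bracket y x).
Proof. by move=> Ix ly; rewrite bracketC; exact/t4_idealN/t4_ideal_bracket. Qed.

Definition eq_t4 x y := t4_ideal (x - y).
Local Infix "≡" := eq_t4 (at level 70).

Lemma eq_t4_refl x : x ≡ x.
Proof. by rewrite /eq_t4 subrr; exact: t4_ideal_zero. Qed.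

Lemma eq_t4_sym x y : x ≡ y -> y ≡ x.
Proof. by rewrite /eq_t4 -opprB => /t4_idealN; rewrite opprK. Qed.

Lemma eq_t4_trans y x z : x ≡ y -> y ≡ z -> x ≡ z.
Proof. by move=> xy yz; have := t4_idealD xy yz; rewrite addrA subrK. Qed.

Lemma eq_t4D x x' y y' : x ≡ x' -> y ≡ y' -> x + y ≡ x' + y'.
Proof. by move=> xx yy; have := t4_idealD xx yy; rewrite /eq_t4 opprD addrACA. Qed.

Lemma eq_t4Z c x x' : x ≡ x' -> c *: x ≡ c *: x'.
Proof. by move=> xx; rewrite /eq_t4 -scalerBr; exact: t4_idealZ. Qed.

Lemma eq_t4_bracket x x' y y' : lie_poly x' -> lie_poly y ->
  x ≡ x' -> y ≡ y' -> bracket x y ≡ bracket x' y'.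
Proof.
move=> lx ly xx yy; apply: (@eq_t4_trans (bracket x' y)).
  by rewrite /eq_t4 -bracketBl; exact: t4_ideal_bracket.
by rewrite /eq_t4 -bracketBr; exact: t4_ideal_bracketl.
Qed.

Lemma tij_gen (a : t4_gen) : tij R (val a).1 (val a).2 = ncletter C a.
Proof. by rewrite /tij -surjective_pairing valK. Qed.

Lemma tijP i j : i != j ->
  exists2 a : t4_gen, val a = (i, j) & tij R i j = ncletter C a.
Proof.
move=> ij; have P : (i, j).1 != (i, j).2 by [].
exists (Sub (i, j) P); first by rewrite SubK.
by rewrite -tij_gen SubK.
Qed.

Lemma lie_tij i j : lie_poly (tij R i j).
Proof. by rewrite /tij; case: insub => [a|]; [exact: lie_letter|exact: lie_zero]. Qed.

Lemma hom_tij i j w : size w != 1 -> tij R i j w = 0.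
Proof.
rewrite /tij; case: insub => [a|//]; rewrite /ncletter.
by case: (eqVneq w [:: a]) => [->|].
Qed.

Lemma tij_nil i j : tij R i j [::] = 0. Proof. exact: hom_tij. Qed.

Lemma tijC i j : i != j -> tij R i j ≡ tij R j i.
Proof. by move=> ij; apply/t4_ideal_rel/t4_sym. Qed.

Lemma lie_t4_relator x : t4_relator x -> lie_poly x.
Proof.
case=> [i j _|i j k _ _ _|i j k l _].
- by apply: lie_polyB; exact: lie_tij.
- by apply: lie_bracket; [apply: lie_polyD|]; exact: lie_tij.
- by apply: lie_bracket; exact: lie_tij.
Qed.

Lemma lie_t4_ideal x : t4_ideal x -> lie_poly x.
Proof.
elim=> [r|c {}x y _ lx _ ly|{}x y _ lx ly|]; first exact: lie_t4_relator.
- exact: lie_lin.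
- exact: lie_bracket.
- exact: lie_zero.
Qed.

Section Matrices.
Variables (K : numFieldType) (N : nat).

Definition t4_mx (a : t4_gen) : 'M[K]_((wdim 'I_3 N).+1) :=
  mxop N (@t4_op K (val a).1 (val a).2).

Lemma raises_t4_mx a : raises (fun m => size (wd m)) 1 (t4_mx a).
Proof. by apply: raises_mxop; exact: shifting_t4_op. Qed.

Lemma t4_mx_prod0 v : (N.+1 <= size v)%N -> word_prod t4_mx v = 0.
Proof. by apply: raises_word_prod0; [exact: size_wd|exact: raises_t4_mx]. Qed.

End Matrices.

Definition t4_ev N (x : S4) : 'M[C]_((wdim 'I_3 N).+1) := evn (@t4_mx C N) N.+1 x.

Lemma t4_evM N x y : t4_ev N (x * y) = t4_ev N x * t4_ev N y.
Proof. by apply: nil_evnM; exact: t4_mx_prod0. Qed.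

Lemma t4_evB N x y : t4_ev N (x - y) = t4_ev N x - t4_ev N y.
Proof. exact: evnB. Qed.

Lemma t4_evD N x y : t4_ev N (x + y) = t4_ev N x + t4_ev N y.
Proof. exact: evnD. Qed.

Lemma t4_ev_bracket N x y :
  t4_ev N (bracket x y) = t4_ev N x * t4_ev N y - t4_ev N y * t4_ev N x.
Proof. by rewrite t4_evB !t4_evM. Qed.

Lemma t4_ev_tij N i j : i != j -> t4_ev N (tij R i j) = mxop N (@t4_op C i j).
Proof.
move=> /tijP[a va ->]; rewrite /t4_ev nil_evn_letter; last exact: t4_mx_prod0.
by rewrite /t4_mx va.
Qed.

Lemma t4_ev_ideal N x : t4_ideal x -> t4_ev N x = 0.
Proof.
have sh i j := @shifting_t4_op C i j; have sh0 i j : forall f, @t4_op C i j f [::] = 0.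
  by case: (sh i j).
elim=> [r|c {}x y _ ex _ ey|{}x y _ ex _|].
- case=> [i j ij|i j k ij ik jk|i j k l ijkl].
  + have ji : j != i by rewrite eq_sym.
    by rewrite t4_evB !t4_ev_tij // [in X in X - _]t4_opC // subrr.
  + rewrite t4_ev_bracket t4_evD !t4_ev_tij // mulrDl mulrDr -!mxop_comp //.
    apply/eqP; rewrite subr_eq0 -!mxop_add; apply/eqP/eq_mxop => f.
    exact: t4_op_tri.
  + have [ij kl] : i != j /\ k != l.
      by move: ijkl; rewrite /= !inE !negb_or => /and4P[/and3P[-> _ _] _ -> _].
    rewrite t4_ev_bracket !t4_ev_tij // -!mxop_comp //.
    by apply/eqP; rewrite subr_eq0; apply/eqP/eq_mxop => f; exact: t4_op_comm.
- by rewrite /t4_ev evn_lin -!/(t4_ev N _) ex ey scaler0 addr0.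
- by rewrite t4_ev_bracket ex mulr0 mul0r subrr.
- exact: evn0.
Qed.

(** The generators of the kernel of the map that forgets the strand 4 *)
Definition to4 (a : 'I_3) : S4 := tij R (lift ord_max a) ord_max.
(** The generators of the kernel of the map that forgets the strand 3, once the
    strand 4 is forgotten *)
Definition to3 (a : 'I_2) : S4 :=
  tij R (lift ord_max (lift ord_max a)) (lift ord_max ord_max).

Lemma to4_nil a : to4 a [::] = 0. Proof. exact: tij_nil. Qed.
Lemma to3_nil a : to3 a [::] = 0. Proof. exact: tij_nil. Qed.

Lemma lift_neq n (h : 'I_n) (a : 'I_n.-1) : lift h a != h.
Proof. by rewrite eq_sym neq_lift. Qed.

Lemma t4_ev_to4 N p :
  t4_ev N (ncsubst to4 p) = evn (fun a => mxop N (lmul (ncletter C a))) N.+1 p.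
Proof.
rewrite /t4_ev evn_ncsubst; [|exact: to4_nil|exact: t4_mx_prod0].
congr (evn _ _ _); apply/funext => a; rewrite -/(t4_ev N _) t4_ev_tij ?lift_neq //.
by rewrite /t4_op liftK unlift_none.
Qed.

Lemma t4_ev_to3 N q : t4_ev N (ncsubst to3 q) =
  evn (fun a => mxop N (@braid_der C (lift ord_max a) ord_max)) N.+1 q.
Proof.
rewrite /t4_ev evn_ncsubst; [|exact: to3_nil|exact: t4_mx_prod0].
congr (evn _ _ _); apply/funext => a; rewrite -/(t4_ev N _) t4_ev_tij.
  by rewrite /t4_op !liftK.
by rewrite (inj_eq (@lift_inj _ ord_max)) lift_neq.
Qed.

Local Notation last3 := (ord_max : 'I_3).
Local Notation lift3 := (map (lift last3)).

Lemma lift3_inj : injective lift3.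
Proof. by apply: inj_map; exact: lift_inj. Qed.

Lemma braid_image_last a b w :
  braid_image C (lift last3 a) last3 b (lift3 w) = 0.
Proof.
have H e e' : (e == last3) || (e' == last3) ->
    (ncletter C e * ncletter C e') (lift3 w) = 0.
  case: w => [|w0 w]; rewrite letterM //= => /orP[/eqP->|/eqP->].
    by rewrite (negbTE (lift_neq _ _)) mul0r.
  rewrite -/lift3 /ncletter; case: w => [|w1 w]; first by rewrite mulr0.
  by rewrite eqseq_cons (negbTE (lift_neq _ _)) mulr0.
rewrite /braid_image; case: ifP => _; last case: ifP => _ //.
all: by rewrite bracketE ncsubE !H ?eqxx ?orbT // subrr.
Qed.

Lemma braid_der_last_words a f w :
  @braid_der C (lift last3 a) last3 f (lift3 w) = 0.
Proof.
elim: w f => [|b w IHw] f; rewrite /braid_der /der /= ?addr0.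
  by rewrite ncsumE big1 // => e _; rewrite nilM (braid_image_last a e [::]) mul0r.
rewrite -[derivation _ _ _]/(@braid_der C _ _ _ _) IHw addr0 ncsumE big1 // => e _.
rewrite ncmulE big1 // => k _.
by rewrite -[lift _ b :: _]/(lift3 (b :: w)) -map_take braid_image_last mul0r.
Qed.

(** For such an f, the only terms of the derivation that reach a word with the
    third letter in front come from the image of this letter. *)
Lemma braid_der_last a (f : ncseries C 'I_3) w : (forall v, f (lift3 v) = 0) ->
  @braid_der C (lift last3 a) last3 f (last3 :: lift3 w) =
  if w is b :: v then (b == a)%:R * f (last3 :: lift3 v) else 0.
Proof.
move=> f0; rewrite /braid_der /der /=.
rewrite -[derivation _ _ _]/(@braid_der C _ _ _ _) braid_der_last_words addr0.
rewrite ncsumE (bigD1 last3) //= (bigD1 (lift last3 a)) ?lift_neq //=.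
rewrite [X in _ + (_ + X)]big1 ?addr0; last first.
  move=> e /andP[/negbTE e3 /negbTE ea].
  by rewrite /braid_image e3 ea mul0r.
rewrite /braid_image !eqxx (negbTE (neq_lift last3 a)) !bracketE !mulrBl !ncsubE -!mulrA.
rewrite !letterM !eqxx (negbTE (neq_lift last3 a)) !mul0r subr0 sub0r !mul1r.
case: w => [|b v] /=; first by rewrite subr0.
rewrite (inj_eq (@lift_inj _ last3)); case: (eqVneq b a) => _; last by rewrite !mul0r subr0.
by rewrite !mul1r /ncshift -[lift _ _ :: _]/(lift3 (a :: v)) f0 subr0.
Qed.

Lemma foldr_braid_der_last v w :
  foldr (fun a => @braid_der C (lift last3 a) last3) (delta C [:: last3]) v
    (last3 :: lift3 w) = (w == v)%:R.
Proof.
elim: v w => [|a v IHv] w.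
  by rewrite /= deltaE eqseq_cons eqxx -(inj_eq lift3_inj).
rewrite [foldr _ _ _]/= braid_der_last => [|u].
  by case: w => [//|b w]; rewrite IHv eqseq_cons -natrM mulnb.
case: v {IHv} => [|b v] /=; last exact: braid_der_last_words.
rewrite deltaE; case: u => [//|b u] /=.
by rewrite eqseq_cons (negbTE (lift_neq _ _)).
Qed.

Lemma foldr_lmul (v : seq 'I_3) : foldr (fun a => lmul (ncletter C a)) (delta C [::]) v = delta C v.
Proof. by elim: v => [//|a v IHv] /=; rewrite IHv lmul_delta. Qed.



Local Notation T12 := (tij R (lift ord_max (lift last3 ord0)) (lift ord_max (lift last3 ord_max))).

Lemma t4_ev_T12 N : t4_ev N T12 = mxop N (@braid_der C (lift last3 ord0) (lift last3 ord_max)).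
Proof. by rewrite t4_ev_tij // /t4_op !liftK. Qed.

(** Applied to the unit series, the operators of t_13, t_23, t_12 vanish and one
    reads off p. Applied to the third letter, at words that contain it only in
    front, one reads off q. *)
Lemma t4_decomposition_uniq (p : ncseries C 'I_3) (q : ncseries C 'I_2) c : p [::] = 0 -> q [::] = 0 ->
    (forall N, t4_ev N (ncsubst to4 p + ncsubst to3 q + c *: T12) = 0) ->
  [/\ p = 0, q = 0 & c = 0].
Proof.
move=> p0 q0 ev0.
have entry N (i j : 'I_(wdim 'I_3 N).+1) : evn (fun a => mxop N (lmul (ncletter C a))) N.+1 p i j +
   evn (fun a => mxop N (@braid_der C (lift ord_max a) ord_max)) N.+1 q i j +
   c * @braid_der C (lift last3 ord0) (lift last3 ord_max) (delta C (wd j)) (wd i) = 0.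
  have /matrixP/(_ i j) := ev0 N; rewrite !t4_evD /t4_ev evnZ -!/(t4_ev N _).
  by rewrite t4_ev_to4 t4_ev_to3 t4_ev_T12 !mxE.
have {}p0 : p = 0.
  apply/ncseriesP => u; have [i ui] := wd_onto (leqnn (size u)).
  have [|j uj] := @wd_onto 'I_3 (size u) [::]; first by [].
  have := entry _ i j; rewrite ui uj !evn_mxop;
    try by move=> a; first [exact: shifting_lmul|exact: shifting_braid_der].
  rewrite uj ui delta_nil.
  have D1 a b : @braid_der C a b 1 = 0 by exact: der1.
  rewrite D1 nczeroE mulr0 addr0 [X in _ + X]big1 ?addr0; last first.
    move=> k _; rewrite /wsum big1 // => v _.
    suff -> : foldr (fun a => @braid_der C (lift ord_max a) ord_max) 1 v =
        if nilp v then 1 else 0.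
      case: (v : seq _) => [|a w] /=; first by rewrite q0 mul0r.
      by rewrite nczeroE mulr0.
    elim: (v : seq _) => [//|a [|b w] /= IHw]; first by rewrite D1.
    by rewrite IHw; exact: der0.
  rewrite big_ord_recr /= big1 ?add0r; last first.
    move=> k _; rewrite /wsum big1 // => v _; rewrite -delta_nil foldr_lmul deltaE.
    case: eqP => [e|_]; last by rewrite mulr0.
    by have := ltn_ord k; rewrite {2}e size_tuple ltnn.
  rewrite (@wsum_pick _ _ _ _ u) // => [|v vu]; rewrite -delta_nil foldr_lmul deltaE.
    by rewrite eqxx mulr1.
  by rewrite eq_sym (negbTE vu) mulr0.
have {}q0 : q = 0.
  apply/ncseriesP => u; pose N := (size u).+1.
  have [|i ui] := @wd_onto 'I_3 N (last3 :: lift3 u); first by rewrite /= size_map.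
  have [|j uj] := @wd_onto 'I_3 N [:: last3]; first by [].
  have := entry _ i j; rewrite p0 evn0 mxE add0r !evn_mxop;
    try by move=> a; exact: shifting_braid_der.
  rewrite uj ui.
  have -> : delta C [:: last3] = ncletter C last3 by [].
  rewrite braid_dern // nczeroE mulr0 addr0 -/(delta C [:: last3]).
  rewrite !big_ord_recr /= big1 ?add0r; last first.
    move=> k _; rewrite /wsum big1 // => v _; rewrite foldr_braid_der_last.
    case: eqP => [e|_]; last by rewrite mulr0.
    by have := ltn_ord k; rewrite {2}e size_tuple ltnn.
  rewrite (@wsum_pick _ _ _ _ u) // => [|v vu]; last first.
    by rewrite foldr_braid_der_last eq_sym (negbTE vu) mulr0.
  rewrite foldr_braid_der_last eqxx mulr1 /wsum [X in _ + X]big1 ?addr0 // => v _.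
  rewrite foldr_braid_der_last; case: eqP => [e|_]; last by rewrite mulr0.
  by have := size_tuple v; rewrite -e => /n_Sn.
split=> //; pose a0 := lift last3 ord0; pose a1 := lift last3 ord_max.
have [|i ui] := @wd_onto 'I_3 2 [:: a0; a1]; first by [].
have [|j uj] := @wd_onto 'I_3 2 [:: a0]; first by [].
have := entry _ i j; rewrite p0 q0 !evn0 !mxE !add0r uj ui.
have -> : delta C [:: a0] = ncletter C a0 by [].
rewrite braid_derl bracketE ncsubE !letterM eqxx mul1r.
have -> : (a0 == lift last3 ord_max) = false by [].
by rewrite mul0r subr0 /ncletter eqxx mulr1.
Qed.

Definition in_image (T : finType) (s : T -> S4) x :=
  exists2 p, lie_poly p & x ≡ ncsubst s p.

Section Image.
Variables (T : finType) (s : T -> S4).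
Hypotheses (s_lie : forall a, lie_poly (s a)) (s_nil : forall a, s a [::] = 0).

Lemma lie_image p : lie_poly p -> lie_poly (ncsubst s p).
Proof. exact: lie_poly_ncsubst. Qed.

Lemma in_image_eq x y : x ≡ y -> in_image s y -> in_image s x.
Proof. by move=> xy [p lp yp]; exists p => //; exact: eq_t4_trans yp. Qed.

Lemma in_image_lin c x y : in_image s x -> in_image s y -> in_image s (c *: x + y).
Proof.
move=> [p lp xp] [q lq yq]; exists (c *: p + q); first exact: lie_lin.
by rewrite ncsubst_lin //; apply: eq_t4D => //; exact: eq_t4Z.
Qed.

Lemma in_imageD x y : in_image s x -> in_image s y -> in_image s (x + y).
Proof. by move=> ix; rewrite -[x in x + _]scale1r; exact: in_image_lin. Qed.

Lemma in_image0 : in_image s 0.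
Proof. by exists 0; [exact: lie_zero|rewrite ncsubst0 //; exact: eq_t4_refl]. Qed.

Lemma in_imageN x : in_image s x -> in_image s (- x).
Proof. by move=> ix; rewrite -scaleN1r -[_ *: _]addr0; exact/in_image_lin/in_image0. Qed.

Lemma in_image_subst p : lie_poly p -> in_image s (ncsubst s p).
Proof. by exists p => //; exact: eq_t4_refl. Qed.

Lemma in_image_bracket x y : lie_poly y ->
  in_image s x -> in_image s y -> in_image s (bracket x y).
Proof.
move=> ly [p lp xp] [q lq yq]; exists (bracket p q); first exact: lie_bracket.
by rewrite ncsubst_bracket //; apply: eq_t4_bracket => //; exact: lie_image.
Qed.

(** The bracket with y is a derivation, so that the generators suffice. *)
Lemma normalizes_image y : lie_poly y ->
    (forall a, in_image s (bracket y (s a))) ->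
  forall p, lie_poly p -> in_image s (bracket y (ncsubst s p)).
Proof.
move=> ly ys p; elim=> [a|c {}p q _ ip _ iq|{}p q lp ip lq iq|].
- by rewrite ncsubst_letter.
- by rewrite ncsubst_lin // bracketDr bracketZr; exact: in_image_lin.
- rewrite ncsubst_bracket // jacobi; apply: in_imageD; apply: in_image_bracket => //.
  + exact: lie_image.
  + exact: in_image_subst.
  + by apply: lie_bracket => //; exact: lie_image.
  + exact: in_image_subst.
- by rewrite ncsubst0 // bracket0r; exact: in_image0.
Qed.

End Image.

Local Notation "x %:4" := (lift (ord_max : 'I_4) (x : 'I_3)) (at level 2, format "x %:4").

Lemma lie_to4 a : lie_poly (to4 a). Proof. exact: lie_tij. Qed.
Lemma lie_to3 a : lie_poly (to3 a). Proof. exact: lie_tij. Qed.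

Lemma t4_swap i j k : i != j -> i != k -> j != k ->
  bracket (tij R i j) (tij R i k) ≡ bracket (tij R i k) (tij R j k).
Proof.
move=> ij ik jk; have ji : j != i by rewrite eq_sym.
apply: (@eq_t4_trans (bracket (tij R j i) (tij R i k))).
  apply: eq_t4_bracket; [exact: lie_tij|exact: lie_tij|exact: tijC|exact: eq_t4_refl].
rewrite /eq_t4 [bracket _ (tij R j k)]bracketC opprK -bracketDl.
exact/t4_ideal_rel/t4_tri.
Qed.

Lemma normalizes_to4 (a b : 'I_3) e : a != b ->
  in_image to4 (bracket (tij R a%:4 b%:4) (to4 e)).
Proof.
move=> ab; have ab4 : a%:4 != b%:4 by rewrite (inj_eq lift_inj).
have swap (f g : 'I_3) : f != g -> in_image to4 (bracket (tij R f%:4 g%:4) (to4 f)).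
  move=> fg; have fg4 : f%:4 != g%:4 by rewrite (inj_eq lift_inj).
  exists (bracket (ncletter C f) (ncletter C g)).
    by apply: lie_bracket; exact: lie_letter.
  rewrite ncsubst_bracket ?ncsubst_letter; try exact: to4_nil.
  by apply: t4_swap => //; exact: lift_neq.
have [->|ea] := eqVneq e a; first exact: swap.
have [->|eb] := eqVneq e b.
  apply: (@in_image_eq _ _ _ (bracket (tij R b%:4 a%:4) (to4 b))); last by apply: swap; rewrite eq_sym.
  apply: eq_t4_bracket; [exact: lie_tij|exact: lie_tij|exact: tijC|exact: eq_t4_refl].
apply: (@in_image_eq _ _ _ 0); last by apply: in_image0; exact: to4_nil.
rewrite /eq_t4 subr0; apply/t4_ideal_rel/t4_comm.
rewrite /= !inE !negb_or !(inj_eq lift_inj) !lift_neq ab.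
by rewrite [a == e]eq_sym ea [b == e]eq_sym eb.
Qed.

Lemma normalizes_to3 a : in_image to3 (bracket T12 (to3 a)).
Proof.
have [a0|a1] : a = ord0 \/ a = ord_max.
  by case: a => -[|[|//]] ?; [left|right]; apply/val_inj.
all: pose b0 := ncletter C (ord0 : 'I_2); pose b1 := ncletter C (ord_max : 'I_2).
- exists (bracket b0 b1); first by apply: lie_bracket; exact: lie_letter.
  rewrite a0 ncsubst_bracket ?ncsubst_letter; try exact: to3_nil.
  by rewrite /to3; exact: t4_swap.
exists (bracket b1 b0); first by apply: lie_bracket; exact: lie_letter.
rewrite a1 ncsubst_bracket ?ncsubst_letter; try exact: to3_nil.
set T21 := tij R (lift ord_max (lift last3 ord_max)) (lift ord_max (lift last3 ord0)).
apply: (@eq_t4_trans (bracket T21 (to3 ord_max))).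
  apply: eq_t4_bracket; [exact: lie_tij|exact: lie_tij|exact: tijC|exact: eq_t4_refl].
by rewrite /to3; exact: t4_swap.
Qed.

Definition decomposed x := exists p q c,
  [/\ lie_poly p, lie_poly q & x ≡ ncsubst to4 p + ncsubst to3 q + c *: T12].

Lemma decomposed_eq x y : x ≡ y -> decomposed y -> decomposed x.
Proof.
move=> xy [p [q [c [lp lq yE]]]]; exists p, q, c; split=> //.
exact: eq_t4_trans yE.
Qed.

Lemma decomposed_lin c x y : decomposed x -> decomposed y -> decomposed (c *: x + y).
Proof.
move=> [p [q [e [lp lq xE]]]] [p' [q' [e' [lp' lq' yE]]]].
exists (c *: p + p'), (c *: q + q'), (c * e + e'); split; [exact: lie_lin..|].
have := eq_t4D (eq_t4Z c xE) yE; congr eq_t4.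
rewrite !ncsubst_lin; try exact: to3_nil; try exact: to4_nil.
by rewrite !scalerDr scalerDl scalerA addrACA [X in X + _]addrACA.
Qed.

Lemma decomposed0 : decomposed 0.
Proof.
exists 0, 0, 0; split; [exact: lie_zero..|].
rewrite !ncsubst0; try exact: to3_nil; try exact: to4_nil.
by rewrite scale0r !addr0; exact: eq_t4_refl.
Qed.

Lemma decomposedD x y : decomposed x -> decomposed y -> decomposed (x + y).
Proof. by move=> dx; rewrite -[x in x + _]scale1r; exact: decomposed_lin. Qed.

Lemma decomposedZ c x : decomposed x -> decomposed (c *: x).
Proof. by move=> dx; rewrite -[_ *: _]addr0; exact/decomposed_lin/decomposed0. Qed.

Lemma decomposedN x : decomposed x -> decomposed (- x).
Proof. by rewrite -scaleN1r; exact: decomposedZ. Qed.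

Lemma decomposed4 x : in_image to4 x -> decomposed x.
Proof.
move=> [p lp xE]; exists p, 0, 0; split=> //; first exact: lie_zero.
by rewrite ncsubst0 ?scale0r ?addr0 //; exact: to3_nil.
Qed.

Lemma decomposed3 x : in_image to3 x -> decomposed x.
Proof.
move=> [q lq xE]; exists 0, q, 0; split=> //; first exact: lie_zero.
by rewrite ncsubst0 ?scale0r ?addr0 ?add0r //; exact: to4_nil.
Qed.

Lemma decomposed_T12 : decomposed T12.
Proof.
exists 0, 0, 1; split; [exact: lie_zero..|].
rewrite !ncsubst0; try exact: to3_nil; try exact: to4_nil.
by rewrite scale1r !add0r; exact: eq_t4_refl.
Qed.

Lemma image3_normalizes q p : lie_poly q -> lie_poly p ->
  in_image to4 (bracket (ncsubst to3 q) (ncsubst to4 p)).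
Proof.
have n4 := lie_to4; have z4 := to4_nil; have n3 := lie_to3; have z3 := to3_nil.
move=> lq; elim: lq p => [a|c {}q q' _ IHq _ IHq'|{}q q' lq IHq lq' IHq'|] p lp.
- rewrite ncsubst_letter //; apply: normalizes_image => // e.
  by apply: normalizes_to4; exact: lift_neq.
- by rewrite ncsubst_lin // bracket_linl; apply: in_image_lin => //; [exact: IHq|exact: IHq'].
- have -> : bracket (ncsubst to3 (bracket q q')) (ncsubst to4 p) =
      bracket (ncsubst to3 q) (bracket (ncsubst to3 q') (ncsubst to4 p)) -
      bracket (ncsubst to3 q') (bracket (ncsubst to3 q) (ncsubst to4 p)).
    by rewrite [X in _ = X - _]jacobi addrK ncsubst_bracket.
  have norm (q1 q2 : ncseries C 'I_2) : lie_poly q1 -> lie_poly q2 ->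
      (forall p, lie_poly p -> in_image to4 (bracket (ncsubst to3 q1) (ncsubst to4 p))) ->
      (forall p, lie_poly p -> in_image to4 (bracket (ncsubst to3 q2) (ncsubst to4 p))) ->
      in_image to4 (bracket (ncsubst to3 q1) (bracket (ncsubst to3 q2) (ncsubst to4 p))).
    move=> l1 l2 i1 i2; have [r lr rE] := i2 p lp.
    apply: in_image_eq (i1 r lr); apply: eq_t4_bracket => //.
    + exact: lie_poly_ncsubst.
    + by apply: lie_bracket; exact: lie_poly_ncsubst.
    + exact: eq_t4_refl.
  apply: in_imageD => //; last apply: in_imageN => //; exact: norm.
- by rewrite ncsubst0 // bracketC bracket0r oppr0; exact: in_image0.
Qed.

(** The images of the two free Lie algebras are subalgebras, each normalized by
    the terms that follow it in the sum. *)
Lemma decomposed_bracket x y : lie_poly y ->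
  decomposed x -> decomposed y -> decomposed (bracket x y).
Proof.
have n4 := lie_to4; have z4 := to4_nil; have n3 := lie_to3; have z3 := to3_nil.
move=> ly [p [q [c [lp lq xE]]]] [p' [q' [c' [lp' lq' yE]]]].
have lT : lie_poly T12 by exact: lie_tij.
have T4 p0 : lie_poly p0 -> in_image to4 (bracket T12 (ncsubst to4 p0)).
  by move=> lp0; apply: normalizes_image => // e; exact: normalizes_to4.
have T3 q0 : lie_poly q0 -> in_image to3 (bracket T12 (ncsubst to3 q0)).
  by move=> lq0; apply: normalizes_image => // e; exact: normalizes_to3.
have lX (p0 : ncseries C 'I_3) (q0 : ncseries C 'I_2) c0 : lie_poly p0 -> lie_poly q0 ->
    lie_poly (ncsubst to4 p0 + ncsubst to3 q0 + c0 *: T12).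
  move=> lp0 lq0; apply: lie_polyD; last exact: lie_polyZ.
  by apply: lie_polyD; exact: lie_poly_ncsubst.
apply: (decomposed_eq (eq_t4_bracket (lX _ _ _ lp lq) ly xE yE)).
rewrite !bracketDl !bracketDr !bracketZl !bracketZr bracketff !scaler0 addr0.
apply: decomposedD; [apply: decomposedD|]; (apply: decomposedD; [apply: decomposedD|]) || apply: decomposedD.
- by rewrite -ncsubst_bracket //; apply/decomposed4/in_image_subst; exact: lie_bracket.
- rewrite bracketC; apply/decomposedN/decomposed4; exact: image3_normalizes.
- rewrite [bracket _ T12]bracketC; apply/decomposedZ/decomposedN/decomposed4; exact: T4.
- by apply: decomposed4; exact: image3_normalizes.
- by rewrite -ncsubst_bracket //; apply/decomposed3/in_image_subst; exact: lie_bracket.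
- rewrite [bracket _ T12]bracketC; apply/decomposedZ/decomposedN/decomposed3; exact: T3.
- by apply/decomposedZ/decomposed4; exact: T4.
- by apply/decomposedZ/decomposed3; exact: T3.
Qed.

Lemma decomposed_tij i j : i != j -> decomposed (tij R i j).
Proof.
have n4 := lie_to4; have z4 := to4_nil; have n3 := lie_to3; have z3 := to3_nil.
have d4 a : decomposed (to4 a).
  by rewrite -(ncsubst_letter to4_nil); apply/decomposed4/in_image_subst/lie_letter.
have d3 a : decomposed (to3 a).
  by rewrite -(ncsubst_letter to3_nil); apply/decomposed3/in_image_subst/lie_letter.
case: (unliftP ord_max i) => [a ->|->]; case: (unliftP ord_max j) => [b ->|->].
- case: (unliftP ord_max a) => [a' ->|->]; case: (unliftP ord_max b) => [b' ->|->].
  + have I2 (z : 'I_2) : z = ord0 \/ z = ord_max.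
      by case: z => -[|[|//]] ?; [left|right]; apply/val_inj.
    case: (I2 a') => ->; case: (I2 b') => -> ab; rewrite ?eqxx // in ab *.
    * exact: decomposed_T12.
    * by apply: (decomposed_eq (tijC ab)); exact: decomposed_T12.
  + by move=> _; exact: d3.
  + by move=> ab; apply: (decomposed_eq (tijC ab)); exact: d3.
  + by rewrite eqxx.
- by move=> _; exact: d4.
- by move=> ab; apply: (decomposed_eq (tijC ab)); exact: d4.
- by rewrite eqxx.
Qed.

(** The sum contains the generators and is stable under brackets. *)
Lemma t4_decomposition x : lie_poly x -> decomposed x.
Proof.
elim=> [a|c {}x y _ dx _ dy|{}x y _ dx ly dy|].
- by rewrite -tij_gen; apply: decomposed_tij; exact: (valP a).
- exact: decomposed_lin.
- exact: decomposed_bracket.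
- exact: decomposed0.
Qed.

(** A decomposed element that acts by 0 has its three components equal to 0. *)
Lemma t4_ev_faithful x : lie_poly x -> (forall N, t4_ev N x = 0) -> t4_ideal x.
Proof.
move=> lx ex; have [p [q [c [lp lq xE]]]] := t4_decomposition lx.
have [|||p0 q0 c0] := @t4_decomposition_uniq p q c; try exact: lie_poly_nil.
  move=> N; have := t4_ev_ideal N xE.
  by rewrite t4_evB ex sub0r => /eqP; rewrite oppr_eq0 => /eqP.
move: xE; rewrite p0 q0 c0 !ncsubst0; try exact: to3_nil; try exact: to4_nil.
by rewrite scale0r !addr0 /eq_t4 subr0.
Qed.

End T4Algebra.

Section CentralElement.
Variable K : numFieldType.
Local Notation S3 := (ncseries K 'I_3).
Local Notation x := (ncletter K).
Implicit Types (f g : S3).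

Let sX : S3 := \sum_a x a.

Lemma ord3P (e : 'I_3) : [\/ e = inord 0, e = inord 1 | e = inord 2].
Proof.
case: e => -[|[|[|//]]] lte; [constructor 1|constructor 2|constructor 3];
by apply/val_inj; rewrite /= inordK.
Qed.

Lemma inord_neq n i j : (i <= n)%N -> (j <= n)%N -> (inord i != inord j :> 'I_n.+1) = (i != j).
Proof. by move=> lei lej; rewrite -val_eqE /= !inordK. Qed.

Lemma lift_max_inord n i : (i < n.+1)%N -> lift (ord_max : 'I_n.+2) (inord i : 'I_n.+1) = inord i.
Proof.
move=> lti; apply/val_inj; rewrite /= /bump !inordK //; last exact: leq_trans lti _.
by rewrite leqNgt lti.
Qed.

Lemma inord_max n : inord n = ord_max :> 'I_n.+1.
Proof. by apply/val_inj; rewrite /= inordK. Qed.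

Definition central_op f : S3 :=
  t4_op (inord 0) (inord 1) f + t4_op (inord 0) (inord 2) f +
  t4_op (inord 0) (inord 3) f + t4_op (inord 1) (inord 2) f +
  t4_op (inord 1) (inord 3) f + t4_op (inord 2) (inord 3) f.

Lemma shifting_central_op : shifting central_op.
Proof. by do !apply: shifting_add; exact: shifting_t4_op. Qed.

Lemma t4_op_strands (a b : 'I_3) :
  t4_op (lift ord_max a) (lift ord_max b) = braid_der a b :> (S3 -> S3).
Proof. by rewrite /t4_op !liftK. Qed.

Lemma t4_op_last (a : 'I_3) : t4_op (lift ord_max a) ord_max = lmul (x a).
Proof. by rewrite /t4_op liftK unlift_none. Qed.

Lemma sum_ord3 (F : 'I_3 -> S3) : \sum_a F a = F (inord 0) + F (inord 1) + F (inord 2).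
Proof.
rewrite !big_ord_recl big_ord0 addr0 addrA.
by congr (F _ + F _ + F _); apply/val_inj; rewrite /= inordK.
Qed.

(** The braid derivations add up to the inner derivation of the sum of the
    letters, by a check on the letters. *)
Lemma central_opE f : central_op f = f * sX.
Proof.
pose G g := braid_der (inord 0) (inord 1) g + braid_der (inord 0) (inord 2) g +
    braid_der (inord 1) (inord 2) g.
have [Gl GM] : is_derivation G  by apply: is_derivationD; [apply: is_derivationD|]; exact: der_is_derivation.
suff GE : G f = bracket f sX.
  rewrite /central_op (inord_max 3) -!(@lift_max_inord 2) // !t4_op_strands !t4_op_last /lmul.
  transitivity (G f + sX * f); last by rewrite GE bracketE subrK.
  rewrite /G /sX sum_ord3 !mulrDl; apply/ncseriesP => w; rewrite !ncaddE; ring.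
apply/eqP; rewrite -subr_eq0; apply/eqP.
apply: (@derivation_eq0 _ _ (fun g => G g - bracket g sX)) => [c g h|g h|e].
- rewrite Gl bracket_linl; apply/ncseriesP => w.
  rewrite !(ncsubE, ncaddE, ncscaleE); ring.
- have sM : bracket (g * h) sX = bracket g sX * h + g * bracket h sX.
    by rewrite !bracketE mulrBl mulrBr !mulrA [RHS]addrC addrA subrK.
  by rewrite GM sM opprD addrACA -mulrBl -mulrBr.
apply/eqP; rewrite subr_eq0; apply/eqP; rewrite /G /sX sum_ord3 !bracketDr.
case: (ord3P e) => ->.
- by rewrite !braid_derl braid_dern ?inord_neq // bracketff add0r addr0.
- rewrite braid_derr ?inord_neq // braid_derl braid_dern ?inord_neq //.
  by rewrite bracketff !addr0.
- rewrite !braid_derr ?inord_neq // braid_dern ?inord_neq //.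
  by rewrite bracketff add0r addr0.
Qed.

Lemma braid_der_sX a b : a != b -> braid_der a b sX = 0.
Proof.
move=> ab; rewrite /sX shifting_sum; last exact: shifting_braid_der.
rewrite (bigD1 a) // (bigD1 b) 1?eq_sym //= big1 => [|e /andP[ea eb]]; last exact: braid_dern.
by rewrite braid_derl braid_derr // addr0 [bracket (x b) _]bracketC subrr.
Qed.

Lemma central_op_comm i j f : i != j -> central_op (t4_op i j f) = t4_op i j (central_op f).
Proof.
rewrite !central_opE -(unlift_eq ord_max) /t4_op.
case: (unlift ord_max i) => [a|]; case: (unlift ord_max j) => [b|] //= ab.
- have [_ DM] := der_is_derivation (braid_image K a b).
  by rewrite [RHS]DM -[der _ sX]/(braid_der a b sX) braid_der_sX // mulr0 addr0.
- by rewrite /lmul mulrA.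
- by rewrite /lmul mulrA.
Qed.

End CentralElement.

Section Center.
Variable R : realType.
Local Notation C := R[i].
Local Notation S4 := (ncseries C t4_gen).
Implicit Types (x y z : S4).

Lemma t4_ZE : t4_Z = t12 + t13 + t14 + t23 + t24 + t34 :> S4.
Proof.
have H i j i' j' : val i = val i' -> val j = val j' -> tij R i j = tij R i' j'.
  by move=> /val_inj-> /val_inj->.
rewrite /t4_Z /t12 /t13 /t14 /t23 /t24 /t34.
under eq_bigr do rewrite big_mkcond.
rewrite !big_ord_recl !big_ord0 /= !addr0 !add0r !addrA.
by congr (_ + _ + _ + _ + _ + _); apply: H; rewrite /= inordK.
Qed.

Lemma strand_neq i j : (i < 4)%N -> (j < 4)%N -> i != j -> inord i != inord j :> 'I_4.
Proof. by move=> lti ltj; rewrite inord_neq. Qed.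

Lemma t4_ev_Z N : t4_ev N t4_Z = mxop N (@central_op C).
Proof.
rewrite t4_ZE !t4_evD !t4_ev_tij ?strand_neq //.
by rewrite -!mxop_add.
Qed.

Lemma lie_t4_Z : lie_poly (t4_Z : S4).
Proof. by do 2!apply: lie_poly_sum => ? _; exact: lie_tij. Qed.

Lemma t4_Z_central y : lie_poly y -> t4_ideal (bracket t4_Z y).
Proof.
move=> ly; apply: t4_ev_faithful => [|N]; first exact: lie_bracket lie_t4_Z ly.
have sh i j := @shifting_t4_op C i j; have sc := shifting_central_op C.
rewrite t4_ev_bracket; apply/eqP; rewrite subr_eq0; apply/eqP.
apply: comm_evn => a; rewrite t4_ev_Z /t4_mx /GRing.comm.
rewrite -!mxop_comp //; [|by case: sc|by case: (sh (val a).1 (val a).2)].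
by apply: eq_mxop => f; apply: central_op_comm; exact: (valP a).
Qed.

(** If f commutes with a letter, its nonempty words all begin with this letter.
    *)
Lemma commutes_two_letters (T : finType) (a b : T) (f : ncseries C T) :
    a != b -> f [::] = 0 ->
    bracket f (ncletter C a) = 0 -> bracket f (ncletter C b) = 0 -> f = 0.
Proof.
move=> ab f0 fa fb.
have head c : bracket f (ncletter C c) = 0 -> forall e w, e != c -> f (e :: w) = 0.
  move=> fc e w ec; have := congr1 (fun h : ncseries C T => h (rcons (e :: w) c)) fc.
  rewrite bracketE ncsubE letterM /= (negbTE ec) mul0r subr0 ncmulE.
  rewrite (bigD1 (inord (size w).+1)) //= inordK ?size_rcons //.
  have -> : take (size w).+1 (e :: rcons w c) = e :: w by rewrite /= -cats1 take_size_cat.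
  have -> : drop (size w).+1 (e :: rcons w c) = [:: c] by rewrite /= -cats1 drop_size_cat.
  rewrite {1}/ncletter eqxx mulr1 big1 ?addr0 // => k nk.
  rewrite /ncletter; case: eqP => [ek|_]; last by rewrite mulr0.
  have := congr1 size ek; rewrite size_drop /= size_rcons => sz.
  case/eqP: nk; apply/val_inj; rewrite /= inordK ?size_rcons //.
  have := ltn_ord k; lia.
apply/ncseriesP => -[|e w]; first exact: f0.
have [ea|ea] := eqVneq e a; last exact: (head a).
by apply: (head b) => //; rewrite ea.
Qed.

(** A central element y without component on t_12 commutes with t_13 and t_23
    modulo the free Lie algebra on the t_i4, which kills its component q; then
    it commutes with all the t_i4, which kills its component p. Subtracting a
    multiple of [t4_Z] removes the component on t_12. *)
Lemma t4_centerP x :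
  t4_central x <-> exists c : C, t4_ideal (x - c *: t4_Z).
Proof.
have n4 := @lie_to4 R; have z4 := @to4_nil R; have n3 := @lie_to3 R; have z3 := @to3_nil R.
split=> [[lx cx]|[c xc]]; last first.
  have lx : lie_poly x.
    have := lie_polyD (lie_t4_ideal xc) (lie_polyZ c lie_t4_Z).
    by rewrite subrK.
  split=> // y ly; have := t4_idealD (t4_ideal_bracket xc ly) (t4_idealZ c (t4_Z_central ly)).
  by rewrite bracketBl bracketZl subrK.
have [p [q [c [lp lq xE]]]] := t4_decomposition lx.
pose y := x - c *: t4_Z; exists c; rewrite -/y.
have ly : lie_poly y by apply: lie_polyB => //; exact/lie_polyZ/lie_t4_Z.
have cy z : lie_poly z -> t4_ideal (bracket y z).
  move=> lz; rewrite bracketBl bracketZl; apply: t4_idealB; first exact: cx.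
  exact/t4_idealZ/t4_Z_central.
have [p' [q' [lp' lq' yE]]] : exists p' q',
    [/\ lie_poly p', lie_poly q' & eq_t4 y (ncsubst (@to4 R) p' + ncsubst (@to3 R) q')].
  exists (p - c *: \sum_a ncletter C a), (q - c *: \sum_a ncletter C a).
  split; try by apply: lie_polyB => //; apply/lie_polyZ/lie_poly_sum => a _; exact: lie_letter.
  have ZE : t4_Z = ncsubst (@to4 R) (\sum_a ncletter C a) +
     ncsubst (@to3 R) (\sum_a ncletter C a) +
     tij R (lift ord_max (lift ord_max ord0)) (lift ord_max (lift ord_max ord_max)).
    rewrite t4_ZE !big_ord_recl !big_ord0 !addr0.
    rewrite !ncsubstD // !ncsubst_letter //.
    have H i j i' j' : val i = val i' -> val j = val j' -> tij R i j = tij R i' j'.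
      by move=> /val_inj-> /val_inj->.
    have -> : to4 R ord0 = t14 by rewrite /to4 /t14; apply: H; rewrite /= inordK.
    have -> : to4 R (lift ord0 ord0) = t24.
      by rewrite /to4 /t24; apply: H; rewrite /= inordK.
    have -> : to4 R (lift ord0 (lift ord0 ord0)) = t34.
      by rewrite /to4 /t34; apply: H; rewrite /= inordK.
    have -> : to3 R ord0 = t13 by rewrite /to3 /t13; apply: H; rewrite /= inordK.
    have -> : to3 R (lift ord0 ord0) = t23.
      by rewrite /to3 /t23; apply: H; rewrite /= inordK.
    rewrite (_ : tij _ _ _ = t12); last by rewrite /t12; apply: H; rewrite /= inordK.
    apply/ncseriesP => w; rewrite !ncaddE; ring.
  rewrite !ncsubstB // !ncsubstZ //.
  have := eq_t4D xE (eq_t4_refl (- (c *: t4_Z))); congr eq_t4.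
  rewrite [in LHS]ZE; apply/ncseriesP => w.
  rewrite !(ncaddE, ncsubE, ncoppE, ncscaleE); ring.
have lie_nil := @lie_poly_nil C.
have uniq_image p0 q0 : lie_poly p0 -> lie_poly q0 ->
    t4_ideal (ncsubst (@to4 R) p0 + ncsubst (@to3 R) q0) -> p0 = 0 /\ q0 = 0.
  move=> lp0 lq0 I0; have [] := @t4_decomposition_uniq R p0 q0 0 => //; try exact: lie_poly_nil.
  by move=> N; rewrite scale0r addr0; exact: t4_ev_ideal.
have q'0 : q' = 0.
  have qa a : bracket q' (ncletter C a) = 0.
    have la : lie_poly (ncletter C a) by exact: lie_letter.
    have [r lr rE] := image3_normalizes la lp'.
    have [|||_ //] := uniq_image (- r) (bracket q' (ncletter C a)).
    - by rewrite -scaleN1r; exact: lie_polyZ.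
    - exact: lie_bracket.
    have ly' : lie_poly (ncsubst (@to4 R) p' + ncsubst (@to3 R) q').
      by apply: lie_polyD; exact: lie_poly_ncsubst.
    have := cy _ (n3 a); have := eq_t4_bracket ly' (n3 a) yE (eq_t4_refl (to3 R a)).
    move=> /eq_t4_sym/t4_idealD H /H {H}; rewrite subrK bracketDl => H.
    rewrite -scaleN1r ncsubstZ // scaleN1r ncsubst_bracket // ncsubst_letter //.
    move: rE; rewrite ncsubst_letter // => /t4_idealD/(_ H).
    rewrite [bracket (to3 R a) _]bracketC; congr t4_ideal.
    apply/ncseriesP => w; rewrite !(ncaddE, ncsubE, ncoppE); ring.
  by apply: (@commutes_two_letters _ ord0 ord_max) => //; exact: lie_nil.
have p'0 : p' = 0.
  have pa a : bracket p' (ncletter C a) = 0.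
    have la : lie_poly (ncletter C a) by exact: lie_letter.
    have [|||//] := uniq_image (bracket p' (ncletter C a)) 0.
    - exact: lie_bracket.
    - exact: lie_zero.
    rewrite ncsubst0 // addr0 ncsubst_bracket // ncsubst_letter //.
    have := cy _ (n4 a); have := yE; rewrite q'0 ncsubst0 // addr0 => yE'.
    have := eq_t4_bracket (lie_poly_ncsubst z4 n4 lp') (n4 a) yE' (eq_t4_refl (to4 R a)).
    by move=> /eq_t4_sym/t4_idealD H /H; rewrite subrK.
  by apply: (@commutes_two_letters _ ord0 ord_max) => //; exact: lie_nil.
by move: yE; rewrite p'0 q'0 !ncsubst0 // addr0 /eq_t4 subr0.
Qed.

(** The representation is graded: the component of degree n occupies the entries
    that raise the length by n. *)
Lemma t4_ev_hom N n x i j :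
  t4_ev N (nchom n x) i j = t4_ev N x i j *+ (size (wd i) == size (wd j) + n)%N.
Proof.
pose F (a : t4_gen) := @t4_op C (val a).1 (val a).2.
have sF a : shifting (F a) by exact: shifting_t4_op.
have evE z : t4_ev N z i j =
    \sum_(k < N.+1) wsum k (fun v => z v * foldr F (delta C (wd j)) v (wd i)).
  exact: evn_mxop sF.
rewrite [LHS]evE [X in _ = X *+ _]evE.
have [e|ne] := eqVneq; last first.
  rewrite mulr0n big1 // => k _; rewrite /wsum big1 // => v _; rewrite nchomE.
  case: eqP => [szv|_]; last by rewrite mulr0n mul0r.
  by rewrite size_foldr_shifting ?mulr0 ?szv.
rewrite mulr1n; apply: eq_bigr => k _; apply: eq_wsum => v _; rewrite nchomE.
have [_|ne] := boolP (size v == n); first by rewrite mulr1n.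
rewrite mulr0n mul0r size_foldr_shifting ?mulr0 //.
by rewrite e eqn_add2l eq_sym.
Qed.

(** The exponential is injective on matrices that raise a degree, so that the
    logarithms agree in the representation, which is graded and faithful. *)
Lemma eq_exp_t4_of_ev (g h : S4) : exp_lie g -> exp_lie h ->
  (forall N, t4_ev N g = t4_ev N h) -> eq_exp_t4 g h.
Proof.
move=> [x lx ->] [y ly ->] exy; exists x, y; split=> // n.
apply: t4_ev_faithful => [|N].
  by rewrite nchomB; apply: lie_polyB; [exact: lx|exact: ly].
apply/matrixP => i j; rewrite t4_ev_hom t4_evB [RHS]mxE.
suff -> : t4_ev N x = t4_ev N y by rewrite subrr mxE mul0rn.
have rt := @raises_t4_mx C N; have szN := @size_wd 'I_3 N.
apply: (mexp_inj szN); try by apply: raises_evn => //; exact: lie_series_nil.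
have E (z : S4) : lie_series z -> t4_ev N (ncexp z) = mexp N.+1 (t4_ev N z).
  by move=> lz; apply: (evn_exp szN rt); exact: lie_series_nil.
exact: etrans (esym (E x lx)) (etrans (exy N) (E y ly)).
Qed.

End Center.

(** * Solutions of Knizhnik-Zamolodchikov equations have real coefficients *)

Section IntervalCalculus.
Variable R : realType.
Implicit Types (f g : R -> R) (a b u v : R).

Lemma mvt_oo f df a b u v : (forall w, a < w < b -> is_derive w 1 f (df w)) ->
  a < u -> u < v -> v < b -> exists2 c, u < c < v & f v - f u = df c * (v - u).
Proof.
move=> fd au uv vb; have [||c] := @MVT _ f df u v uv.
- by move=> w; rewrite in_itv /= => /andP[uw wv]; apply: fd; lra.
- apply: derivable_within_continuous => w; rewrite in_itv /= => /andP[uw wv].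
  have wab : a < w < b by lra.
  by have [] := fd w wab.
by rewrite in_itv /= => cuv ->; exists c.
Qed.

Lemma constant_on_interval f a b u v :
    (forall w, a < w < b -> is_derive w 1 f 0) ->
  a < u < b -> a < v < b -> f u = f v.
Proof.
move=> fd; wlog uv : u v / u < v => [H hu hv|/andP[au _] /andP[_ vb]].
  by have [/H->//|/H->//|->//] := ltgtP u v.
by have [c _ /eqP] := mvt_oo fd au uv vb; rewrite mul0r subr_eq0 => /eqP.
Qed.

Lemma is_derive_continuous f u d : is_derive u 1 f d -> f x @[x --> u] --> f u.
Proof. by case=> /derivable1_diffP/differentiable_continuous. Qed.

Lemma is_derive_big (I : Type) (r : seq I) (F : I -> R -> R) (dF : I -> R) u :
    (forall i, is_derive u 1 (F i) (dF i)) ->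
  is_derive u 1 (fun v => \sum_(i <- r) F i v) (\sum_(i <- r) dF i).
Proof.
move=> FD; elim: r => [|i r IHr].
  rewrite (_ : (fun _ => _) = cst 0) ?big_nil; first exact: is_derive_cst.
  by apply/funext => v; rewrite big_nil.
rewrite (_ : (fun _ => _) = F i + (fun v => \sum_(j <- r) F j v)) ?big_cons.
  exact: is_deriveD.
by apply/funext => v; rewrite big_cons.
Qed.

Lemma is_derive_ext f g u d : (forall v, f v = g v) -> is_derive u 1 f d -> is_derive u 1 g d.
Proof. by move=> /funext->. Qed.

Lemma is_derive_addf f g u df dg : is_derive u 1 f df -> is_derive u 1 g dg ->
  is_derive u 1 (fun v => f v + g v) (df + dg).
Proof. by move=> fd gd; exact: is_deriveD. Qed.

Lemma is_derive_mulf f g u df dg : is_derive u 1 f df -> is_derive u 1 g dg ->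
  is_derive u 1 (fun v => f v * g v) (f u * dg + df * g u).
Proof.
move=> fd gd; apply: (@is_derive_eq _ _ _ _ _ _ _ _ (is_deriveM fd gd)).
by rewrite /GRing.scale /= [g u * _]mulrC.
Qed.

Lemma is_derive_mulc f u c df : is_derive u 1 f df ->
  is_derive u 1 (fun v => c * f v) (c * df).
Proof.
move=> fd; have := is_derive_mulf (is_derive_cst c u 1) fd.
by rewrite mul0r addr0.
Qed.

End IntervalCalculus.

Section RealParts.
Variables (R : realType) (T : finType).
Local Notation C := R[i].
Implicit Types (f g : ncseries R T) (h : ncseries C T) (w : seq T) (u v : R).

Definition nc_complex f : ncseries C T := fun w => (f w)%:C%C.
Definition nc_Re h : ncseries R T := fun w => complex.Re (h w).
Definition nc_Im h : ncseries R T := fun w => complex.Im (h w).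

Lemma ReD (x y : C) : complex.Re (x + y) = complex.Re x + complex.Re y.
Proof. by case: x y => [a b] [c d]. Qed.
Lemma ImD (x y : C) : complex.Im (x + y) = complex.Im x + complex.Im y.
Proof. by case: x y => [a b] [c d]. Qed.
Lemma Re_realM (r : R) (x : C) : complex.Re (r%:C%C * x) = r * complex.Re x.
Proof. by case: x => [a b]; rewrite /= mul0r subr0. Qed.
Lemma Im_realM (r : R) (x : C) : complex.Im (r%:C%C * x) = r * complex.Im x.
Proof. by case: x => [a b]; rewrite /= mul0r addr0. Qed.
Lemma Re_sum I (r : seq I) (F : I -> C) :
  complex.Re (\sum_(i <- r) F i) = \sum_(i <- r) complex.Re (F i).
Proof. by apply: (big_morph _ ReD). Qed.
Lemma Im_sum I (r : seq I) (F : I -> C) :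
  complex.Im (\sum_(i <- r) F i) = \sum_(i <- r) complex.Im (F i).
Proof. by apply: (big_morph _ ImD). Qed.

Lemma nc_Re_mul h f : nc_Re (h * nc_complex f) = nc_Re h * f.
Proof.
apply/ncseriesP => w; rewrite /nc_Re !ncmulE Re_sum; apply: eq_bigr => k _.
by rewrite mulrC Re_realM mulrC.
Qed.

Lemma nc_Im_mul h f : nc_Im (h * nc_complex f) = nc_Im h * f.
Proof.
apply/ncseriesP => w; rewrite /nc_Im !ncmulE Im_sum; apply: eq_bigr => k _.
by rewrite mulrC Im_realM mulrC.
Qed.

Lemma nc_Im_mull f h : nc_Im (nc_complex f * h) = f * nc_Im h.
Proof.
apply/ncseriesP => w; rewrite /nc_Im !ncmulE Im_sum; apply: eq_bigr => k _.
by rewrite Im_realM.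
Qed.

Lemma nc_Re_mull f h : nc_Re (nc_complex f * h) = f * nc_Re h.
Proof.
apply/ncseriesP => w; rewrite /nc_Re !ncmulE Re_sum; apply: eq_bigr => k _.
by rewrite Re_realM.
Qed.

Lemma nc_real h : nc_Im h = 0 -> h = nc_complex (nc_Re h).
Proof.
move=> /ncseriesP h0; apply/ncseriesP => w; have := h0 w.
by rewrite /nc_Im /nc_complex /nc_Re nczeroE; case: (h w) => [a b] /= ->.
Qed.

Lemma nc_complexM f g : nc_complex (f * g) = nc_complex f * nc_complex g.
Proof.
apply/ncseriesP => w; rewrite /nc_complex !ncmulE rmorph_sum.
by apply: eq_bigr => k _; rewrite rmorphM.
Qed.

Lemma nc_complexZ (c : R) f : nc_complex (c *: f) = c%:C%C *: nc_complex f.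
Proof. by apply/ncseriesP => w; rewrite /nc_complex !ncscaleE rmorphM. Qed.

Lemma nc_complexN f : nc_complex (- f) = - nc_complex f.
Proof. by apply/ncseriesP => w; rewrite /nc_complex !ncoppE rmorphN. Qed.

Lemma nc_complex1 : nc_complex 1 = 1.
Proof. by apply/ncseriesP => -[|a w]. Qed.

Lemma nc_complexX f k : nc_complex (f ^+ k) = nc_complex f ^+ k.
Proof. by elim: k => [|k IHk]; rewrite ?expr0 ?nc_complex1 // !exprS nc_complexM IHk. Qed.

Lemma nc_complex_letter a : nc_complex (ncletter R a) = ncletter C a.
Proof. by apply/ncseriesP => w; rewrite /nc_complex /ncletter; case: eqP. Qed.

Lemma nc_complex_exp f : nc_complex (ncexp f) = ncexp (nc_complex f).
Proof.
apply/ncseriesP => w; rewrite /nc_complex /ncexp rmorph_sum.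
apply: eq_bigr => k _; rewrite rmorphM fmorphV rmorph_nat; congr (_ * _).
by rewrite -nc_complexX.
Qed.

(** The equation dG = (\sum_a r_a(u) a) G du, read coefficientwise *)
Definition KZ_solution (r : T -> R -> R) (g : R -> ncseries R T) :=
  forall u, 0 < u < 1 -> forall w,
  is_derive u 1 (g^~ w) (if w is a :: w' then r a u * g u w' else 0).

Lemma exp_solution_parts (r : T -> R -> R) (omega : R -> ncseries C T) G :
    (forall u, omega u = \sum_a (r a u)%:C%C *: ncletter C a) ->
    exp_solution omega G ->
  KZ_solution r (fun u => nc_Re (G u)) /\ KZ_solution r (fun u => nc_Im (G u)).
Proof.
move=> omegaE sG.
have DE u : 0 < u < 1 -> exists2 D, nc_is_derive G u D &
    forall w, D w = if w is a :: w' then (r a u)%:C%C * G u w' else 0.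
  move=> u01; have [eG [D DG DE]] := sG u u01; exists D => // w.
  have -> : D = omega u * G u by rewrite -DE mulrVK // exp_lie_unit.
  rewrite omegaE mulr_suml ncsumE; case: w => [|a w].
    by rewrite big1 // => a _; rewrite -scalerAl ncscaleE letterM mulr0.
  rewrite (bigD1 a) //= -scalerAl ncscaleE letterM eqxx mul1r big1 ?addr0 //.
  by move=> b /negbTE ba; rewrite -scalerAl ncscaleE letterM eq_sym ba mul0r mulr0.
split=> u u01 w; have [D dG DE'] := DE u u01; have [dRe dIm] := dG w.
- have -> : (if w is a :: w' then r a u * nc_Re (G u) w' else 0) = complex.Re (D w).
    by rewrite DE'; case: (w) => [|a w'] //; rewrite Re_realM.
  exact: dRe.
- have -> : (if w is a :: w' then r a u * nc_Im (G u) w' else 0) = complex.Im (D w).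
    by rewrite DE'; case: (w) => [|a w'] //; rewrite Im_realM.
  exact: dIm.
Qed.

(** The coefficients of a solution on words of minimal length are constant, and
    the asymptotics makes them 0. It is applied to the imaginary part of a
    solution. *)
Lemma KZ_solution_eq0 r (g : R -> ncseries R T) (F : set_system R) (e : R -> ncseries R T) :
    ProperFilter F -> (\forall u \near F, 0 < u < 1) -> KZ_solution r g ->
    (forall u, e u [::] = 1) ->
    (forall w, (fun u => (g u * e u) w) @ F --> 0) ->
  forall u, 0 < u < 1 -> g u = 0.
Proof.
move=> PF F01 sg e1 ge0 u u01; apply/ncseriesP => w.
suff H n : forall w, size w = n -> forall u, 0 < u < 1 -> g u w = 0.
  by rewrite (H (size w)).
elim/ltn_ind: n => n IHn {}w szw {}u {}u01.
have gc v : 0 < v < 1 -> g v w = g u w.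
  move=> v01; apply: (@constant_on_interval _ (g^~ w) 0 1) => // x x01.
  have := sg x x01 w; case: (w) szw => [|a w'] //= szw.
  by rewrite (IHn (size w')) ?mulr0 // -szw.
have gew v : 0 < v < 1 -> (g v * e v) w = g u w.
  move=> v01; rewrite ncmulE big_ord_recr /= take_size drop_size e1 mulr1 gc //.
  rewrite big1 ?add0r // => k _.
  by rewrite (IHn k) ?mul0r // -?szw // size_takel // ltnW.
have cvgc : (fun u0 => (g u0 * e u0) w) @ F --> g u w.
  apply: cvg_near_cst; near=> v; rewrite gew //; near: v; exact: F01.
exact: (cvg_unique _ cvgc (ge0 w)).
Unshelve. all: by end_near.
Qed.

Definition nc_lim (F : set_system R) (g : R -> ncseries R T) (l : ncseries R T) :=
  forall w, (fun u => g u w) @ F --> l w.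

(** u^{-a} for the letter a *)
Definition letter_pow (a : T) u : ncseries R T := ncexp (ln u *: - ncletter R a).

Lemma letter_pow_nil a u : letter_pow a u [::] = 1. Proof. exact: ncexp_nil. Qed.

Lemma ncpow_letter a u : ncpow u (- ncletter C a) = nc_complex (letter_pow a u).
Proof.
by rewrite /ncpow /letter_pow nc_complex_exp nc_complexZ nc_complexN nc_complex_letter.
Qed.

Lemma real_of_Im0 r G omega : (forall u, omega u = \sum_a (r a u)%:C%C *: ncletter C a) ->
    exp_solution omega G -> (forall u, 0 < u < 1 -> nc_Im (G u) = 0) ->
  [/\ KZ_solution r (fun u => nc_Re (G u)),
      forall u, 0 < u < 1 -> G u = nc_complex (nc_Re (G u)) &
      forall u, 0 < u < 1 -> nc_Re (G u) [::] = 1].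
Proof.
move=> omegaE sG G0; have [sRe _] := exp_solution_parts omegaE sG; split=> // u u01.
  by rewrite -nc_real // G0.
by rewrite /nc_Re; have [/exp_lie_nil-> _] := sG u u01.
Qed.

Lemma real_solution r omega G a (p : R -> R) (F : set_system R) :
    ProperFilter F -> (\forall u \near F, 0 < u < 1) ->
    (forall u, omega u = \sum_a (r a u)%:C%C *: ncletter C a) ->
    exp_solution omega G ->
    nc_cvg F (fun u => G u * ncpow (p u) (- ncletter C a)) 1 ->
  [/\ KZ_solution r (fun u => nc_Re (G u)),
      forall u, 0 < u < 1 -> G u = nc_complex (nc_Re (G u)),
      forall u, 0 < u < 1 -> nc_Re (G u) [::] = 1 &
      nc_lim F (fun u => nc_Re (G u) * letter_pow a (p u)) 1].
Proof.
move=> PF F01 omegaE sG limG; have [_ sIm] := exp_solution_parts omegaE sG.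
have Im0 u : 0 < u < 1 -> nc_Im (G u) = 0.
  apply: (KZ_solution_eq0 (e := fun u => letter_pow a (p u)) PF F01 sIm).
    by move=> v; exact: letter_pow_nil.
  move=> w; have [_] := limG w; have -> : complex.Im ((1 : ncseries C T) w) = 0.
    by rewrite nc1E; case: nilp.
  apply: cvg_trans; apply: near_eq_cvg; near=> v.
  by rewrite ncpow_letter -/(nc_Im _ w) nc_Im_mul.
have [sRe GE G1] := real_of_Im0 omegaE sG Im0; split=> // w.
have [+ _] := limG w; have -> : complex.Re ((1 : ncseries C T) w) = (1 : ncseries R T) w.
  by rewrite !nc1E; case: nilp.
apply: cvg_trans; apply: near_eq_cvg; near=> v.
by rewrite ncpow_letter -/(nc_Re _ w) nc_Re_mul.
Unshelve. all: by end_near.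
Qed.

Lemma real_quotient (Phi : ncseries C T) G0 G1 (u : R) :
    nc_Re (G1 u) [::] = 1 -> G0 u = nc_complex (nc_Re (G0 u)) ->
    G1 u = nc_complex (nc_Re (G1 u)) -> G1 u * Phi = G0 u ->
  Phi = nc_complex (nc_Re Phi) /\ nc_Re (G1 u) * nc_Re Phi = nc_Re (G0 u).
Proof.
move=> g1 G0E G1E GP; split; last by rewrite -nc_Re_mull -G1E GP.
apply: nc_real; have : nc_Re (G1 u) * nc_Im Phi = 0.
  rewrite -nc_Im_mull -G1E GP G0E; apply/ncseriesP => w.
  by rewrite /nc_Im /nc_complex.
have ug : nc_Re (G1 u) \is a GRing.unit by rewrite nc_unitE g1 oner_eq0.
by move/(congr1 ( *%R (nc_Re (G1 u))^-1)); rewrite mulKr // mulr0.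
Qed.

End RealParts.

Section Associators.
Variable R : realType.
Local Notation C := R[i].
Implicit Types (u : R).

Definition KZ_rate (a : 'I_2) u : R := if a == inord 0 then u^-1 else (u - 1)^-1.

Definition KZ2_rate (a : 'I_3) u : R :=
  if a == inord 0 then u^-1 else if a == inord 1 then (u - 1)^-1 else (u + 1)^-1.

Lemma KZ_formE u : KZ_form u = \sum_a (KZ_rate a u)%:C%C *: ncletter C a.
Proof.
rewrite !big_ord_recl big_ord0 addr0 /KZ_form /KZ_rate /f2A /f2B.
have -> : ord0 = inord 0 :> 'I_2 by apply/val_inj; rewrite /= inordK.
have -> : lift (inord 0) ord0 = inord 1 :> 'I_2 by apply/val_inj; rewrite /= !inordK.
have -> : (inord 1 == inord 0 :> 'I_2) = false by rewrite -val_eqE /= !inordK.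
by rewrite eqxx.
Qed.

Lemma KZ2_formE u : KZ2_form u = \sum_a (KZ2_rate a u)%:C%C *: ncletter C a.
Proof.
rewrite !big_ord_recl big_ord0 addr0 /KZ2_form /KZ2_rate /f3A /f3b0 /f3b1.
have -> : ord0 = inord 0 :> 'I_3 by apply/val_inj; rewrite /= inordK.
have -> : lift (inord 0 : 'I_3) ord0 = inord 1 :> 'I_3 by apply/val_inj; rewrite /= /bump !inordK.
have -> : lift (inord 0 : 'I_3) (lift ord0 ord0) = inord 2 :> 'I_3.
  by apply/val_inj; rewrite /= /bump !inordK.
have -> : (inord 1 == inord 0 :> 'I_3) = false by rewrite -val_eqE /= !inordK.
have -> : (inord 2 == inord 0 :> 'I_3) = false by rewrite -val_eqE /= !inordK.
have -> : (inord 2 == inord 1 :> 'I_3) = false by rewrite -val_eqE /= !inordK.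
by rewrite !eqxx addrA.
Qed.

Let r01 : \forall u \near 0^'+, 0 < u < (1 : R).
Proof.
by near=> u; apply/andP; split.
Unshelve. all: by end_near.
Qed.

Let l01 : \forall u \near 1^'-, 0 < u < (1 : R).
Proof.
by near=> u; apply/andP; split.
Unshelve. all: by end_near.
Qed.

Definition real_assoc n (r : 'I_n -> R -> R) (a b : 'I_n) (phi : ncseries R 'I_n)
    (g0 g1 : R -> ncseries R 'I_n) :=
  [/\ KZ_solution r g0, KZ_solution r g1,
      nc_lim 0^'+ (fun u => g0 u * letter_pow a u) 1,
      nc_lim 1^'- (fun u => g1 u * letter_pow b (1 - u)) 1 &
      forall u, 0 < u < 1 -> [/\ g0 u [::] = 1, g1 u [::] = 1 & g1 u * phi = g0 u]].

Let half01 : (0 : R) < (2^-1 : R) < 1. Proof. lra. Qed.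

Lemma real_assoc_nil n r a b (phi : ncseries R 'I_n) g0 g1 :
  real_assoc r a b phi g0 g1 -> phi [::] = 1.
Proof.
case=> _ _ _ _ /(_ _ half01)[g0n g1n /ncseriesP/(_ [::])].
by rewrite [LHS]ncmul_nil g0n g1n mul1r.
Qed.

Lemma is_Phi_real Phi : is_Phi Phi -> exp_lie Phi /\
  exists phi g0 g1, Phi = nc_complex phi /\
    real_assoc (@KZ_rate) (inord 0) (inord 1) phi g0 g1.
Proof.
move=> [G0 [G1 [s0 l0 s1 l1 PhiE]]].
split.
  rewrite (PhiE _ half01); apply: exp_lieM; last by have [] := s0 _ half01.
  by apply: exp_lieV; have [] := s1 _ half01.
have [s0' G0E G01 l0'] := real_solution _ r01 KZ_formE s0 l0.
have [s1' G1E G11 l1'] := real_solution _ l01 KZ_formE s1 l1.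
have GP u : 0 < u < 1 -> G1 u * Phi = G0 u.
  by move=> u01; rewrite (PhiE u u01) mulVKr // exp_lie_unit //; have [] := s1 u u01.
exists (nc_Re Phi), (fun u => nc_Re (G0 u)), (fun u => nc_Re (G1 u)); split.
  by have [] := real_quotient (G11 _ half01) (G0E _ half01) (G1E _ half01) (GP _ half01).
split; [exact: s0'|exact: s1'|exact: l0'|exact: l1'|move=> u u01].
split; [exact: (G01 u u01)|exact: (G11 u u01)|].
by have [] := real_quotient (G11 _ u01) (G0E _ u01) (G1E _ u01) (GP _ u01).
Qed.

Lemma is_Psi2_real Psi : is_Psi2 Psi -> exp_lie Psi /\
  exists phi g0 g1, Psi = nc_complex phi /\
    real_assoc (@KZ2_rate) (inord 0) (inord 1) phi g0 g1.
Proof.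
move=> [G0 [G1 [s0 l0 s1 l1 PhiE]]].
split.
  rewrite (PhiE _ half01); apply: exp_lieM; last by have [] := s0 _ half01.
  by apply: exp_lieV; have [] := s1 _ half01.
have [s0' G0E G01 l0'] := real_solution _ r01 KZ2_formE s0 l0.
have [s1' G1E G11 l1'] := real_solution _ l01 KZ2_formE s1 l1.
have GP u : 0 < u < 1 -> G1 u * Psi = G0 u.
  by move=> u01; rewrite (PhiE u u01) mulVKr // exp_lie_unit //; have [] := s1 u u01.
exists (nc_Re Psi), (fun u => nc_Re (G0 u)), (fun u => nc_Re (G1 u)); split.
  by have [] := real_quotient (G11 _ half01) (G0E _ half01) (G1E _ half01) (GP _ half01).
split; [exact: s0'|exact: s1'|exact: l0'|exact: l1'|move=> u u01].
split; [exact: (G01 u u01)|exact: (G11 u u01)|].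
by have [] := real_quotient (G11 _ u01) (G0E _ u01) (G1E _ u01) (GP _ u01).
Qed.

Lemma is_Phi_half_real Phi : is_Phi_half Phi -> exp_lie Phi /\
  exists phi g0, [/\ Phi = nc_complex phi, KZ_solution (@KZ_rate) g0,
    nc_lim 0^'+ (fun u => g0 u * letter_pow (inord 0) u) 1,
    forall u, 0 < u < 1 -> g0 u [::] = 1 & g0 2^-1 = phi].
Proof.
move=> [G0 [Gh [s0 l0 sh Gh1 PhiE]]].
have PhiG : Phi = G0 2^-1 by rewrite (PhiE _ half01) Gh1 invr1 mul1r.
split; first by rewrite PhiG; have [] := s0 _ half01.
have [s0' G0E G01 l0'] := real_solution _ r01 KZ_formE s0 l0.
exists (nc_Re Phi), (fun u => nc_Re (G0 u)); split=> //; last by rewrite PhiG.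
by rewrite PhiG -G0E.
Qed.

End Associators.

(** * Growth near 0 *)

Section Growth.
Variable R : realType.
Implicit Types (f g df : R -> R) (a b c u v : R).

(** f grows more slowly than any negative power of u. *)
Definition tame f := forall a, 0 < a ->
  exists c, \forall u \near 0^'+, `|f u| <= c * u `^ (- a).

(** Equivalently, f is smaller than all the powers of u of exponent less than 1.
    *)
Definition negl f := tame (fun u => f u / u).

Lemma near0_lt b : 0 < b -> \forall u \near (0 : R)^'+, 0 < u < b.
Proof. by move=> b0; near=> u; apply/andP; split.
Unshelve. all: by end_near. Qed.

Lemma near0_ex (P : R -> Prop) : (\forall u \near 0^'+, P u) ->
  exists2 b, 0 < b & forall u, 0 < u < b -> P u.
Proof.
move=> [b /= b0 hb]; exists b => // u /andP[u0 ub]; apply: hb => //=.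
by rewrite sub0r normrN gtr0_norm.
Qed.

Lemma tame_eq f g : (\forall u \near 0^'+, f u = g u) -> tame f -> tame g.
Proof.
move=> fg tf a a0; have [c fc] := tf a a0; exists c; near=> u.
by rewrite -(_ : f u = g u); [near: u|near: u].
Unshelve. all: by end_near. Qed.

Lemma tame_le f g : (\forall u \near 0^'+, `|g u| <= `|f u|) -> tame f -> tame g.
Proof.
move=> gf tf a a0; have [c fc] := tf a a0; exists c; near=> u.
by apply: (@le_trans _ _ `|f u|); near: u.
Unshelve. all: by end_near. Qed.

Lemma tame_cst c : tame (fun=> c).
Proof.
move=> a a0; exists `|c|; near=> u.
have u01 : 0 < u < 1 by near: u; exact: near0_lt.
rewrite -[leLHS]mulr1 ler_wpM2l // -(powRr0 u).
by apply: ger_powR; lra.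
Unshelve. all: by end_near. Qed.

Lemma tameD f g : tame f -> tame g -> tame (fun u => f u + g u).
Proof.
move=> tf tg a a0; have [c fc] := tf a a0; have [c' gc] := tg a a0.
exists (c + c'); near=> u; rewrite mulrDl (le_trans (ler_normD _ _)) // lerD //.
  by near: u.
by near: u.
Unshelve. all: by end_near. Qed.

Lemma tameM f g : tame f -> tame g -> tame (fun u => f u * g u).
Proof.
move=> tf tg a a0; have a20 : 0 < a / 2 by lra.
have [c fc] := tf _ a20; have [c' gc] := tg _ a20.
exists (c * c'); near=> u.
have u0 : 0 < u by near: u; exact: nbhs_right_gt.
rewrite normrM.
have -> : u `^ (- a) = u `^ (- (a / 2)) * u `^ (- (a / 2)).
  have aE : - a = - (a / 2) + - (a / 2) by lra.
  by rewrite [in LHS]aE powRD // (gt_eqF u0) implybT.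
by rewrite mulrACA ler_pM //; near: u.
Unshelve. all: by end_near. Qed.

Lemma tameN f : tame f -> tame (fun u => - f u).
Proof. by apply: tame_le; near=> u; rewrite normrN.
Unshelve. all: by end_near. Qed.

Lemma tame_sum (I : Type) (r : seq I) (F : I -> R -> R) :
  (forall i, tame (F i)) -> tame (fun u => \sum_(i <- r) F i u).
Proof.
move=> tF; elim: r => [|i r IHr].
  by apply: (tame_eq _ (tame_cst 0)); near=> u; rewrite big_nil.
by apply: (tame_eq _ (tameD (tF i) IHr)); near=> u; rewrite big_cons.
Unshelve. all: by end_near. Qed.

Lemma tame_bounded f c : (\forall u \near 0^'+, `|f u| <= c) -> tame f.
Proof.
move=> fc; apply: (tame_le _ (tame_cst c)); near=> u.
by rewrite (le_trans _ (ler_norm c)) //; near: u.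
Unshelve. all: by end_near. Qed.

Lemma tame_cvg f (l : R) : f @ 0^'+ --> l -> tame f.
Proof.
move=> fl; apply: (@tame_bounded _ (`|l| + 1)); near=> u.
have : `|l - f u| <= 1.
  by near: u; have /cvgrPdist_le := fl; exact.
move=> lfu; have -> : f u = l - (l - f u) by lra.
by rewrite (le_trans (ler_normB _ _)) // lerD2l.
Unshelve. all: by end_near. Qed.

Lemma tame_ln : tame (@ln R).
Proof.
move=> a a0; exists (a^-1); near=> u.
have /andP[u0 u1] : 0 < u < 1 by near: u; exact: near0_lt.
have lu : ln u < 0 by apply: ln_lt0; rewrite u0.
rewrite (ler0_norm (ltW lu)) ler_pdivlMl // mulrN -mulNr -ln_powR.
by apply/ltW/ln_sublinear; exact: powR_gt0.
Unshelve. all: by end_near. Qed.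

Lemma tame_id : tame (fun u => u).
Proof.
apply: (tame_le _ (tame_cst 1)); near=> u.
have /andP[u0 u1] : 0 < u < 1 by near: u; exact: near0_lt.
by rewrite !ger0_norm // ltW.
Unshelve. all: by end_near. Qed.

Lemma negl_tame f : negl f -> tame f.
Proof.
move=> nf; apply: (tame_eq _ (tameM nf tame_id)); near=> u.
by rewrite mulfVK // gt_eqF.
Unshelve. all: by end_near. Qed.

Lemma neglD f g : negl f -> negl g -> negl (fun u => f u + g u).
Proof. by move=> nf ng; apply: (tame_eq _ (tameD nf ng)); near=> u; rewrite mulrDl.
Unshelve. all: by end_near. Qed.

Lemma neglMr f g : negl f -> tame g -> negl (fun u => f u * g u).
Proof. by move=> nf ng; apply: (tame_eq _ (tameM nf ng)); near=> u; rewrite mulrAC.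
Unshelve. all: by end_near. Qed.

Lemma neglMl f g : tame f -> negl g -> negl (fun u => f u * g u).
Proof. by move=> nf ng; apply: (tame_eq _ (tameM nf ng)); near=> u; rewrite mulrA.
Unshelve. all: by end_near. Qed.

Lemma negl_eq f g : (\forall u \near 0^'+, f u = g u) -> negl f -> negl g.
Proof. by move=> fg; apply: tame_eq; near=> u; congr (_ / _); near: u.
Unshelve. all: by end_near. Qed.

Lemma negl0 : negl (fun=> 0).
Proof. by apply: (tame_eq _ (tame_cst 0)); near=> u; rewrite mul0r.
Unshelve. all: by end_near. Qed.

Lemma negl_sum (I : Type) (r : seq I) (F : I -> R -> R) :
  (forall i, negl (F i)) -> negl (fun u => \sum_(i <- r) F i u).
Proof.
move=> tF; elim: r => [|i r IHr].
  by apply: (negl_eq _ negl0); near=> u; rewrite big_nil.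
by apply: (negl_eq _ (neglD (tF i) IHr)); near=> u; rewrite big_cons.
Unshelve. all: by end_near. Qed.

Lemma negl_bound f c : (\forall u \near 0^'+, `|f u| <= c * u) -> negl f.
Proof.
move=> fc; apply: (@tame_bounded _ c); near=> u.
have u0 : 0 < u by near: u; exact: nbhs_right_gt.
by rewrite normrM normfV (gtr0_norm u0) ler_pdivrMr //; near: u.
Unshelve. all: by end_near. Qed.

Lemma negl_sqrt f : negl f ->
  exists c, \forall u \near 0^'+, `|f u| <= c * Num.sqrt u.
Proof.
move=> /(_ 2^-1); case; first by lra.
move=> c fc; exists c; near=> u.
have u0 : 0 < u by near: u; exact: nbhs_right_gt.
have : `|f u / u| <= c * u `^ (- 2^-1) by near: u.
rewrite normrM normfV (gtr0_norm u0) ler_pdivrMr // -mulrA => /le_trans; apply.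
rewrite powRN (powR12_sqrt (ltW u0)) -[X in _ * (_ * X)](sqr_sqrtr (ltW u0)) expr2.
by rewrite mulKf // (gt_eqF (_ : 0 < Num.sqrt u)) // sqrtr_gt0.
Unshelve. all: by end_near. Qed.

Lemma sqrt_cvg0 : Num.sqrt u @[u --> (0 : R)^'+] --> (0 : R).
Proof.
rewrite -[X in _ --> X]sqrtr0; apply: cvg_at_right_filter.
exact: sqrt_continuous.
Qed.

Lemma negl_cvg f : negl f -> f @ 0^'+ --> 0.
Proof.
move=> /negl_sqrt[c fc]; apply/cvgr0Pnorm_le => e e0.
have /cvgr0Pnorm_le : (fun u => c * Num.sqrt u) @ (0 : R)^'+ --> (0 : R).
  by rewrite -[X in _ --> X](mulr0 c); apply: cvgMr; exact: sqrt_cvg0.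
move=> /(_ e e0) ce; near=> u.
apply: (@le_trans _ _ (c * Num.sqrt u)); first by near: u.
by rewrite (le_trans (ler_norm _)) //; near: u.
Unshelve. all: by end_near. Qed.

Lemma negl_cst c : negl (fun=> c) -> c = 0.
Proof.
move=> /negl_cvg c0; apply: (cvg_unique _ _ c0) => //; exact: cvg_cst.
Qed.

Lemma ge0_of_derive b f df :
    (forall u, 0 < u < b -> is_derive u 1 f (df u)) ->
    (forall u, 0 < u < b -> 0 <= df u) -> f @ 0^'+ --> 0 ->
  forall u, 0 < u < b -> 0 <= f u.
Proof.
move=> fd df0 f0 u /andP[u0 ub].
apply: (cvgr_to_le f0); near=> v.
have /andP[v0 vu] : 0 < v < u by near: v; exact: near0_lt.
have [w /andP[vw wu] fE] := mvt_oo fd v0 vu ub.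
rewrite -subr_ge0 fE; apply: mulr_ge0; last by lra.
by apply: df0; lra.
Unshelve. all: by end_near. Qed.

Lemma le_of_derive b f df g dg :
    (forall u, 0 < u < b -> is_derive u 1 f (df u)) ->
    (forall u, 0 < u < b -> is_derive u 1 g (dg u)) ->
    (forall u, 0 < u < b -> `|df u| <= dg u) -> f @ 0^'+ --> 0 -> g @ 0^'+ --> 0 ->
  forall u, 0 < u < b -> `|f u| <= g u.
Proof.
move=> fd gd dfg f0 g0 u u0b; rewrite ler_norml; apply/andP; split.
  rewrite -subr_ge0 opprK; apply: (@ge0_of_derive b (fun u => f u + g u) (fun u => df u + dg u)) => //.
  - by move=> v v0b; apply: is_derive_addf; [exact: fd|exact: gd].
  - by move=> v v0b; have := dfg v v0b; rewrite ler_norml => /andP[]; lra.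
  - by rewrite -[X in _ --> X]addr0; exact: cvgD.
rewrite -subr_ge0; apply: (@ge0_of_derive b (fun u => g u - f u) (fun u => dg u - df u)) => //.
- move=> v v0b; apply: is_derive_addf; first exact: gd.
  by have := @is_derive_mulc _ _ _ (-1) _ (fd v v0b); rewrite mulN1r; apply: is_derive_ext => w; rewrite mulN1r.
- by move=> v v0b; have := dfg v v0b; rewrite ler_norml => /andP[]; lra.
- by rewrite -[X in _ --> X]subr0; exact: cvgB.
Qed.

(** Integrating c u^(-a) gives a multiple of u^(1 - a). *)
Lemma negl_of_derive f df :
    (\forall u \near (0 : R)^'+, is_derive (u : R) (1 : R) f (df u)) ->
  tame df -> f @ 0^'+ --> 0 -> negl f.
Proof.
move=> fd tdf f0; suff H a : 0 < a < 1 -> exists c, \forall u \near 0^'+,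
    `|f u / u| <= c * u `^ (- a).
  move=> a a0; have [a1|a1] := ltP a 1; first by apply: H; lra.
  have [|c cE] := H 2^-1; first by lra.
  exists `|c|; near=> u; have /andP[u0 u1] : 0 < u < 1 by near: u; exact: near0_lt.
  apply: (@le_trans _ _ (c * u `^ (- 2^-1))); first by near: u.
  apply: (@le_trans _ _ (`|c| * u `^ (- 2^-1))).
    by rewrite ler_wpM2r ?powR_ge0 // ler_norm.
  by rewrite ler_wpM2l //; apply: ger_powR; lra.
move=> /andP[a0 a1]; have [c dfc] := tdf a a0.
have [b b0 fb] : exists2 b, 0 < b & forall u, 0 < u < b ->
    is_derive u 1 f (df u) /\ `|df u| <= c * u `^ (- a).
  have : \forall u \near (0 : R)^'+,
      is_derive (u : R) (1 : R) f (df u) /\ `|df u| <= c * u `^ (- a).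
    by near=> u; split; near: u.
  exact: near0_ex.
exists (c / (1 - a)); near=> u.
have /andP[u0 ub] : 0 < u < b by near: u; exact: near0_lt.
rewrite normrM normfV (gtr0_norm u0) ler_pdivrMr //.
rewrite [leRHS](_ : _ = c / (1 - a) * u `^ (1 - a)); last first.
  have uE : u * u `^ ((1 - a) - 1) = u `^ (1 - a).
    by apply: mulr_powRB1; [exact: ltW|rewrite subr_gt0].
  have aE : 1 - a - 1 = - a by lra.
  by rewrite -uE aE [u * _]mulrC mulrA.
apply: (@le_of_derive b f df (fun u => c / (1 - a) * u `^ (1 - a)) (fun u => c * u `^ (- a))) => //.
- by move=> v /fb[].
- move=> v /andP[v0 _]; have -> : c * v `^ (- a) = c / (1 - a) * ((1 - a) * v `^ (1 - a - 1)).
    rewrite mulrA mulfVK ?gt_eqF ?subr_gt0 //; congr (_ * _ `^ _); lra.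
  by apply: is_derive_mulc; exact: is_derive1_powR.
- by move=> v /fb[].
- rewrite -[X in _ --> X](mulr0 (c / (1 - a))); apply: cvgMr.
  by apply: powR_cvg0; rewrite subr_gt0.
- by rewrite u0.
Unshelve. all: by end_near. Qed.

End Growth.

(** * Matrix-valued functions of a real variable *)

Section MatrixCalculus.
Variables (R : realType) (n : nat) (d : 'I_n.+1 -> nat) (N : nat).
Hypothesis ltdN : forall i, (d i < N)%N.
Local Notation M := 'M[R]_n.+1.
Implicit Types (X Y : M) (f g : R -> M) (u v : R).

Definition mder f u X := forall i j, is_derive u 1 (fun v => f v i j) (X i j).

Lemma mder_eq f u X Y : X = Y -> mder f u X -> mder f u Y.
Proof. by move->. Qed.

Lemma mder_near f g u X : (\forall v \near u, f v = g v) -> mder f u X -> mder g u X.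
Proof.
move=> fg fd i j; apply: near_eq_is_derive (fd i j).
by near=> v; congr (fun_of_matrix _ i j); near: v.
Unshelve. all: by end_near. Qed.

Lemma mder_cst X u : mder (fun=> X) u 0.
Proof. by move=> i j; rewrite mxE; exact: is_derive_cst. Qed.

Lemma mderD f g u X Y : mder f u X -> mder g u Y -> mder (fun v => f v + g v) u (X + Y).
Proof.
move=> fd gd i j; rewrite mxE; apply: is_derive_ext (is_derive_addf (fd i j) (gd i j)).
by move=> v; rewrite mxE.
Qed.

Lemma mderM f g u X Y : mder f u X -> mder g u Y ->
  mder (fun v => f v * g v) u (f u * Y + X * g u).
Proof.
move=> fd gd i j; have := @is_derive_big _ _ (index_enum 'I_n.+1)
  (fun k v => f v i k * g v k j) (fun k => f u i k * Y k j + X i k * g u k j) u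
  (fun k => is_derive_mulf (fd i k) (gd k j)).
rewrite !mxE -big_split; apply: is_derive_ext => v; by rewrite mxE.
Qed.

Lemma mderZ (c : R -> R) dc f u X : is_derive u 1 c dc -> mder f u X ->
  mder (fun v => c v *: f v) u (c u *: X + dc *: f u).
Proof.
move=> cd fd i j; rewrite !mxE; apply: is_derive_ext (is_derive_mulf cd (fd i j)).
by move=> v; rewrite mxE.
Qed.

Lemma mder_comp (phi : R -> R) dphi f u X : is_derive u 1 phi dphi ->
  mder f (phi u) X -> mder (fun v => f (phi v)) u (dphi *: X).
Proof.
move=> pd fd i j; rewrite mxE mulrC.
exact: (@is_derive1_comp _ (fun v => f v i j) phi).
Qed.

Lemma mder_sum (I : Type) (r : seq I) (F : I -> R -> M) (dF : I -> M) u :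
  (forall i, mder (F i) u (dF i)) ->
  mder (fun v => \sum_(i <- r) F i v) u (\sum_(i <- r) dF i).
Proof.
move=> FD; elim: r => [|i r IHr].
  rewrite big_nil (_ : (fun _ => _) = fun=> 0); first exact: mder_cst.
  by apply/funext => v; rewrite big_nil.
rewrite big_cons (_ : (fun _ => _) = fun v => F i v + \sum_(j <- r) F j v).
  exact: mderD.
by apply/funext => v; rewrite big_cons.
Qed.

Lemma mder_exists_exp f u X k : mder f u X -> exists Y, mder (fun v => f v ^+ k) u Y.
Proof.
move=> fd; elim: k => [|k [Y IHk]].
  by exists 0; rewrite (_ : (fun _ => _) = fun=> 1);
    [exact: mder_cst|apply/funext => v; rewrite expr0].
exists (f u * Y + X * f u ^+ k).
rewrite (_ : (fun _ => _) = fun v => f v * f v ^+ k); first exact: mderM.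
by apply/funext => v; rewrite exprS.
Qed.

Definition unipotent X := raises d 1 (X - 1).

Lemma unipotent1 : unipotent 1.
Proof. by rewrite /unipotent subrr; exact: raises0. Qed.

Lemma unipotentM X Y : unipotent X -> unipotent Y -> unipotent (X * Y).
Proof.
move=> uX uY; rewrite /unipotent.
have -> : X * Y - 1 = (X - 1) * (Y - 1) + (X - 1) + (Y - 1).
  by rewrite [(X - 1) * (Y - 1)]mulrBr mulr1 subrK mulrBl mul1r addrA subrK.
apply: raisesD => //; apply: raisesD => //.
by apply: (@raisesW _ _ _ 1 2) => //; exact: (@raisesM _ _ _ 1 1).
Qed.

(** The inverse of a unipotent matrix, as a geometric series that stops since (1
    - X)^N = 0 *)
Definition uinv X : M := \sum_(k < N) (1 - X) ^+ k.

Let N_gt0 : (0 < N)%N. Proof. exact: N_gt0 ltdN. Qed.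

Lemma uinv_comm X : X * uinv X = uinv X * X.
Proof.
rewrite /uinv mulr_sumr mulr_suml; apply: eq_bigr => k _.
by apply: commrX; apply: commrB; [exact: commr1|].
Qed.

Lemma mul_uinv X : unipotent X -> X * uinv X = 1.
Proof.
move=> uX; have := subrX1 (1 - X) N; rewrite (raises_expN ltdN) //; last first.
  by rewrite -opprB; exact: raisesN.
by rewrite addrAC subrr !sub0r mulNr => /oppr_inj ->.
Qed.

Lemma uinv_mul X : unipotent X -> uinv X * X = 1.
Proof. by move=> uX; rewrite -uinv_comm mul_uinv. Qed.

Lemma uinv_eq X Y : unipotent X -> X * Y = 1 -> Y = uinv X.
Proof. by move=> uX XY; rewrite -[Y]mul1r -(uinv_mul uX) -mulrA XY mulr1. Qed.

Lemma unipotent_uinv X : unipotent X -> unipotent (uinv X).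
Proof.
move=> uX; rewrite /unipotent /uinv; case: N N_gt0 => // m _.
rewrite big_ord_recl expr0 addrC addrA addNr add0r; apply: raises_sum => k _.
apply: (@raisesW _ _ _ 1 k.+1) => //; apply: raises_exp.
by rewrite -opprB; exact: raisesN.
Qed.

(** Differentiability follows from the polynomial formula, and the value from
    the derivative of X * uinv X = 1. *)
Lemma mder_uinv f u X : (\forall v \near u, unipotent (f v)) -> mder f u X ->
  mder (fun v => uinv (f v)) u (- (uinv (f u) * X * uinv (f u))).
Proof.
move=> uf fd; have ufu : unipotent (f u) by exact: nbhs_singleton uf.
have [Y gd] : exists Y, mder (fun v => uinv (f v)) u Y.
  have f1d : mder (fun v => 1 - f v) u (- X).
    have := mderD (mder_cst 1 u) (mderZ (is_derive_cst (-1 : R) u (1 : R)) fd).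
    rewrite add0r scale0r addr0 scaleN1r; congr (mder _ u _).
    by apply/funext => v; rewrite scaleN1r.
  have /choice[Y YE] : forall k, exists Y, mder (fun v => (1 - f v) ^+ k) u Y.
    by move=> k; exact: mder_exists_exp f1d.
  by exists (\sum_(k < N) Y k); apply: mder_sum => k; exact: YE.
apply: (mder_eq _ gd); have H := mderM fd gd.
have /mder_near/(_ H) H1 : \forall v \near u, f v * uinv (f v) = 1.
  by near=> v; rewrite mul_uinv //; near: v.
have E : f u * Y + X * uinv (f u) = 0.
  apply/matrixP => i j; have [_ <-] := H1 i j.
  by have [_ <-] := mder_cst 1 u i j.
rewrite -[Y]mul1r -(uinv_mul ufu) -mulrA; apply/eqP.
by rewrite -subr_eq0 opprK -mulrA -mulrDr E mulr0.
Unshelve. all: by end_near. Qed.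

Lemma mder_0_const f u v : (forall w, 0 < w < 1 -> mder f w 0) ->
  0 < u < 1 -> 0 < v < 1 -> f u = f v.
Proof.
move=> fd u01 v01; apply/matrixP => i j.
apply: (@constant_on_interval _ (fun w => f w i j) 0 1) => // w w01.
by have := fd w w01 i j; rewrite mxE.
Qed.

(** The power u^X *)
Definition upow X u : M := mexp N (ln u *: X).

Lemma unipotent_upow X u : raises d 1 X -> unipotent (upow X u).
Proof. by move=> rX; apply: raises_mexp1 => //; exact: raisesZ. Qed.

Lemma upowNr X u : raises d 1 X -> upow X u * upow (- X) u = 1.
Proof. by move=> rX; rewrite /upow scalerN (mexpNr ltdN) //; exact: raisesZ. Qed.

Lemma upowNl X u : raises d 1 X -> upow (- X) u * upow X u = 1.
Proof. by move=> rX; rewrite /upow scalerN (mexpNl ltdN) //; exact: raisesZ. Qed.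

Lemma scale_comm (a b : R) X Y : GRing.comm X Y -> GRing.comm (a *: X) (b *: Y).
Proof. by move=> cXY; rewrite /GRing.comm -!scalerAl -!scalerAr cXY !scalerA mulrC. Qed.

Lemma upowD X Y u : raises d 1 X -> raises d 1 Y -> GRing.comm X Y ->
  upow (X + Y) u = upow X u * upow Y u.
Proof.
move=> rX rY cXY; rewrite /upow scalerDr (mexpD ltdN) //; [exact: raisesZ..|].
exact: scale_comm.
Qed.

Lemma upowM X u v : raises d 1 X -> 0 < u -> 0 < v ->
  upow X (u * v) = upow X u * upow X v.
Proof.
move=> rX u0 v0; rewrite /upow lnM ?posrE // scalerDl (mexpD ltdN) //; [exact: raisesZ..|].
exact: scale_comm.
Qed.

Lemma upowV X u : 0 < u -> upow X u^-1 = upow (- X) u.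
Proof. by move=> u0; rewrite /upow lnV ?posrE // scaleNr scalerN. Qed.

Lemma upow1 X : upow X 1 = 1.
Proof. by rewrite /upow ln1 scale0r (mexp0 R ltdN). Qed.

Lemma comm_upow X Y u : GRing.comm X Y -> GRing.comm X (upow Y u).
Proof. by move=> cXY; apply: comm_mexp; exact: comm_scale. Qed.

Lemma mder_upow X u : raises d 1 X -> 0 < u ->
  mder (upow X) u (u^-1 *: (X * upow X u)).
Proof.
move=> rX u0; pose e (t : R) := mexp N (t *: X).
have ed t : mder e t (X * e t).
  have -> : X * e t = \sum_(k < N) ((k%:R * t ^+ k.-1) / k`!%:R) *: X ^+ k.
    have XN : X ^+ N = 0 by exact: (raises_expN ltdN).
    rewrite /e /mexp; move: XN; case: N N_gt0 => // m _ XN.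
    rewrite big_ord_recr /= [RHS]big_ord_recl mul0r mul0r scale0r add0r mulrDr.
    rewrite exprZn -!scalerAr -exprS XN !scaler0 addr0 mulr_sumr.
    apply: eq_bigr => k _; rewrite exprZn -!scalerAr -exprS scalerA; congr (_ *: _).
    rewrite factS natrM invfM mulrACA mulrA mulrAC -mulrA mulrC -mulrA.
    by rewrite mulrA divff ?pnatr_eq0 // mul1r.
  rewrite (_ : e = fun t => \sum_(k < N) (t ^+ k / k`!%:R) *: X ^+ k); last first.
    apply/funext => s; rewrite /e /mexp; apply: eq_bigr => k _.
    by rewrite exprZn scalerA mulrC.
  apply: mder_sum => k.
  have td : is_derive t 1 (fun s => s ^+ k / k`!%:R) (k%:R * t ^+ k.-1 / k`!%:R).
    have := @is_deriveX _ _ id k t 1 1 (is_derive_id t 1).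
    rewrite /GRing.scale /= mulr1 => H.
    have := is_derive_mulc (k`!%:R)^-1 H; rewrite mulrC; apply: is_derive_ext => s.
    by rewrite mulrC; congr (_ / _); elim: (k : nat) => [|m IHm] //; rewrite !exprS -IHm.
  by have := mderZ td (mder_cst (X ^+ k) t); rewrite scaler0 add0r.
exact: (mder_comp (is_derive1_ln u0) (ed (ln u))).
Qed.

(** ** Growth of matrix-valued functions *)

Definition mtame f := forall i j, tame (fun u => f u i j).
Definition mnegl f := forall i j, negl (fun u => f u i j).

Lemma mtame_eq f g : (\forall u \near 0^'+, f u = g u) -> mtame f -> mtame g.
Proof.
move=> fg tf i j; apply: tame_eq (tf i j).
by near=> u; congr (fun_of_matrix _ i j); near: u.
Unshelve. all: by end_near. Qed.

Lemma mnegl_eq f g : (\forall u \near 0^'+, f u = g u) -> mnegl f -> mnegl g.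
Proof.
move=> fg tf i j; apply: negl_eq (tf i j).
by near=> u; congr (fun_of_matrix _ i j); near: u.
Unshelve. all: by end_near. Qed.

Lemma mtame_cst X : mtame (fun=> X). Proof. by move=> i j; exact: tame_cst. Qed.

Lemma mnegl0 : mnegl (fun=> 0).
Proof. by move=> i j; rewrite (_ : (fun _ => _) = fun=> 0); [exact: negl0|apply/funext => u; rewrite mxE]. Qed.

Lemma mtameD f g : mtame f -> mtame g -> mtame (fun u => f u + g u).
Proof.
move=> tf tg i j; apply: (tame_eq _ (tameD (tf i j) (tg i j))).
by near=> u; rewrite mxE.
Unshelve. all: by end_near. Qed.

Lemma mneglD f g : mnegl f -> mnegl g -> mnegl (fun u => f u + g u).
Proof.
move=> tf tg i j; apply: (negl_eq _ (neglD (tf i j) (tg i j))).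
by near=> u; rewrite mxE.
Unshelve. all: by end_near. Qed.

Lemma mtameM f g : mtame f -> mtame g -> mtame (fun u => f u * g u).
Proof.
move=> tf tg i j; apply: (tame_eq _ (tame_sum (index_enum _) (fun k => tameM (tf i k) (tg k j)))).
by near=> u; rewrite mxE.
Unshelve. all: by end_near. Qed.

Lemma mneglMr f g : mnegl f -> mtame g -> mnegl (fun u => f u * g u).
Proof.
move=> tf tg i j; apply: (negl_eq _ (negl_sum (index_enum _) (fun k => neglMr (tf i k) (tg k j)))).
by near=> u; rewrite mxE.
Unshelve. all: by end_near. Qed.

Lemma mneglMl f g : mtame f -> mnegl g -> mnegl (fun u => f u * g u).
Proof.
move=> tf tg i j; apply: (negl_eq _ (negl_sum (index_enum _) (fun k => neglMl (tf i k) (tg k j)))).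
by near=> u; rewrite mxE.
Unshelve. all: by end_near. Qed.

Lemma mtameZ (c : R -> R) f : tame c -> mtame f -> mtame (fun u => c u *: f u).
Proof.
move=> tc tf i j; apply: (tame_eq _ (tameM tc (tf i j))).
by near=> u; rewrite mxE.
Unshelve. all: by end_near. Qed.

Lemma mneglZ (c : R -> R) f : tame c -> mnegl f -> mnegl (fun u => c u *: f u).
Proof.
move=> tc tf i j; apply: (negl_eq _ (neglMl tc (tf i j))).
by near=> u; rewrite mxE.
Unshelve. all: by end_near. Qed.

Lemma mneglN f : mnegl f -> mnegl (fun u => - f u).
Proof.
move=> nf; apply: (mnegl_eq _ (mneglZ (tame_cst (-1)) nf)).
by near=> u; rewrite scaleN1r.
Unshelve. all: by end_near. Qed.

Lemma mneglB f g : mnegl f -> mnegl g -> mnegl (fun u => f u - g u).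
Proof. by move=> nf ng; apply: mneglD => //; exact: mneglN. Qed.

Lemma mtame_sum (I : Type) (r : seq I) (F : I -> R -> M) :
  (forall i, mtame (F i)) -> mtame (fun u => \sum_(i <- r) F i u).
Proof.
move=> tF i j; apply: (tame_eq _ (tame_sum r (fun k => tF k i j))).
by near=> u; rewrite summxE.
Unshelve. all: by end_near. Qed.

Lemma mtame_exp f k : mtame f -> mtame (fun u => f u ^+ k).
Proof.
move=> tf; elim: k => [|k IHk].
  by rewrite (_ : (fun _ => _) = fun=> 1); [exact: mtame_cst|apply/funext => u; rewrite expr0].
rewrite (_ : (fun _ => _) = fun u => f u * f u ^+ k); first exact: mtameM.
by apply/funext => u; rewrite exprS.
Qed.

Lemma mnegl_tame f : mnegl f -> mtame f.
Proof. by move=> nf i j; exact: negl_tame. Qed.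

Definition near1 f := mnegl (fun u => f u - 1).

Lemma near1_tame f : near1 f -> mtame f.
Proof.
move=> nf; apply: (mtame_eq _ (mtameD (mnegl_tame nf) (mtame_cst 1))).
by near=> u; rewrite subrK.
Unshelve. all: by end_near. Qed.

Lemma near1M f g : near1 f -> near1 g -> near1 (fun u => f u * g u).
Proof.
move=> nf ng; apply: (mnegl_eq _ (mneglD (mneglMr nf (near1_tame ng)) ng)).
by near=> u; rewrite mulrBl mul1r addrA subrK.
Unshelve. all: by end_near. Qed.

Lemma mtame_uinv f : mtame f -> mtame (fun u => uinv (f u)).
Proof.
move=> tf; apply: mtame_sum => k; apply: mtame_exp.
apply: (mtame_eq _ (mtameD (mtame_cst 1) (mtameZ (tame_cst (-1)) tf))).
by near=> u; rewrite scaleN1r.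
Unshelve. all: by end_near. Qed.

Lemma near1_uinv f : (\forall u \near 0^'+, unipotent (f u)) ->
  near1 f -> near1 (fun u => uinv (f u)).
Proof.
move=> uf nf; apply: (mnegl_eq _ (mneglN (mneglMl (mtame_uinv (near1_tame nf)) nf))).
near=> u; rewrite mulrBr mulr1 uinv_mul ?opprB //; near: u; exact: uf.
Unshelve. all: by end_near. Qed.

Lemma mtame_upow X : mtame (upow X).
Proof.
apply: mtame_sum => k; apply: mtameZ; first exact: tame_cst.
by apply: mtame_exp; apply: mtameZ; [exact: tame_ln|exact: mtame_cst].
Qed.

Lemma mnegl_cst X : mnegl (fun=> X) -> X = 0.
Proof. by move=> nX; apply/matrixP => i j; rewrite mxE; exact: negl_cst (nX i j). Qed.

Definition mlim (F : set_system R) f X := forall i j, f u i j @[u --> F] --> X i j.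

(** A solution with a regular singularity at 0 is a power of u with negligible
    error: the derivative of an entry of f u^{-A} is u^{-1} times entries that
    raise the degree less, plus a tame term, and is integrated by
    [negl_of_derive]. *)
Lemma regular_singular_rate (A : M) (m : R -> M) f : raises d 1 A ->
    (forall u, raises d 1 (m u)) -> mtame m ->
    (\forall u \near (0 : R)^'+, mder f u ((u^-1 *: A + m u) * f u)) ->
    mlim 0^'+ (fun u => f u * upow (- A) u) 1 ->
  near1 (fun u => f u * upow (- A) u).
Proof.
move=> rA rm tm fd flim; have rNA : raises d 1 (- A) by exact: raisesN.
pose k u := f u * upow (- A) u; rewrite -/k in flim *.
have kd : \forall u \near (0 : R)^'+,
    mder k u (m u * k u + u^-1 *: (A * (k u - 1) - (k u - 1) * A)).
  near=> u; have u0 : 0 < u by near: u; exact: nbhs_right_gt.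
  have fdu : mder f u ((u^-1 *: A + m u) * f u) by near: u.
  apply: mder_eq (mderM fdu (mder_upow rNA u0)).
  rewrite -mulrA -/(k u) mulrDl -scalerAl -scalerAr addrA addrC; congr (_ + _).
  have -> : - A * upow (- A) u = upow (- A) u * - A by exact: comm_upow.
  rewrite mulrA -/(k u) mulrN -scalerDr; congr (_ *: _).
  by rewrite mulrBr mulrBl mulr1 mul1r opprB addrA subrK addrC.
(* The shift by N makes the induction start with an empty set of entries. *)
suff H r : forall i j, (d i + N < d j + r)%N -> negl (fun u => (k u - 1) i j).
  by move=> i j; apply: (H (d i + N).+1); rewrite ltn_addl.
elim: r => [|r IHr] i j; rewrite ?addn0 ?addnS ?ltnS => ltij.
  by have := leq_ltn_trans (leq_addl (d i) N) ltij; rewrite ltnNge ltnW // ltdN.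
apply: (@negl_of_derive _ _
    (fun u => (m u * k u + u^-1 *: (A * (k u - 1) - (k u - 1) * A)) i j)).
- near=> u; have kdu : mder k u (m u * k u + u^-1 *: (A * (k u - 1) - (k u - 1) * A)).
    by near: u.
  by have := mderD kdu (mder_cst (-1) u) i j; rewrite addr0.
- have nA l : negl (fun u => A i l * (k u - 1) l j - (k u - 1) i l * A l j).
    apply: neglD.
      have [ltli|leil] := ltnP (d l) (d i).
        apply: neglMl (tame_cst _) (IHr l j _).
        by lia.
      rewrite (rA i l) ?addn1 //; apply: (negl_eq _ (@negl0 R)).
      by near=> u; rewrite mul0r.
    apply: (negl_eq _ (neglMl (tame_cst (-1)) (_ : negl (fun u => (k u - 1) i l * A l j)))).
      by near=> u; rewrite mulN1r.
    have [ltjl|lelj] := ltnP (d j) (d l).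
      by apply: neglMr (IHr i l _) (tame_cst _); lia.
    rewrite (rA l j) ?addn1 //; apply: (negl_eq _ (@negl0 R)).
    by near=> u; rewrite mulr0.
  have tM l : tame (fun u => m u i l * k u l j).
    have [ltli|leil] := ltnP (d l) (d i); last first.
      apply: (tame_eq _ (tame_cst 0)); near=> u.
      by rewrite rm ?addn1 // mul0r.
    apply: tameM; first exact: tm.
    have /IHr/negl_tame H : (d l + N < d j + r)%N by lia.
    apply: (tame_eq _ (tameD H (tame_cst ((1 : M) l j)))).
    by near=> u; rewrite !mxE subrK.
  have := tameD (tame_sum (index_enum _) tM) (negl_sum (index_enum _) nA).
  apply: tame_eq; near=> u; rewrite !mxE; congr (_ + _).
  by rewrite sumrB mulrC.
- have H := flim i j.
  have : k u i j - (1 : M) i j @[u --> 0^'+] --> (1 : M) i j - (1 : M) i j.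
    by apply: cvgB => //; exact: cvg_cst.
  by rewrite subrr; apply: cvg_trans; apply: near_eq_cvg; near=> u; rewrite !mxE.
Unshelve. all: by end_near. Qed.

End MatrixCalculus.

(** * Evaluation of solutions at matrices *)

Section KZMatrices.
Variables (R : realType) (n : nat) (d : 'I_n.+1 -> nat) (N : nat).
Hypothesis ltdN : forall i, (d i < N)%N.
Local Notation M := 'M[R]_n.+1.

Lemma mlim_sum (I : Type) (r : seq I) (F : set_system R) (f : I -> R -> M) (l : I -> M) :
  Filter F -> (forall i, mlim F (f i) (l i)) ->
  mlim F (fun u => \sum_(k <- r) f k u) (\sum_(k <- r) l k).
Proof.
move=> FF fl i j; rewrite summxE; elim: r => [|k r IHr].
  rewrite big_nil (_ : (fun _ => _) = cst 0); first exact: cvg_cst.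
  by apply/funext => u; rewrite big_nil mxE.
rewrite big_cons (_ : (fun _ => _) = fun u => f k u i j + (\sum_(k <- r) f k u) i j).
  exact: cvgD (fl k i j) IHr.
by apply/funext => u; rewrite big_cons mxE.
Qed.

Lemma lim_reflect (f : R -> R) (l : R) :
  f @ 1^'- --> l -> f (1 - u) @[u --> 0^'+] --> l.
Proof. by move=> fl A /fl/nbhs_left0P. Qed.

Lemma tame_inv_sub1 : tame (fun u : R => (u - 1)^-1).
Proof.
apply: (@tame_bounded _ _ 2); near=> u.
have /andP[u0 u1] : 0 < u < 2^-1 by near: u; apply: near0_lt; lra.
rewrite normfV ltr0_norm; last lra.
by rewrite -[leRHS]invrK lef_pV2 ?posrE; lra.
Unshelve. all: by end_near. Qed.

Section Letters.
Variables (T : finType) (s : T -> M).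
Hypothesis rs : forall a, raises d 1 (s a).
Implicit Types (g : R -> ncseries R T) (f : ncseries R T).

Let s0 v : (N <= size v)%N -> word_prod s v = 0.
Proof. by move=> lev; exact: (raises_word_prod0 ltdN). Qed.

Lemma evn_lim (F : set_system R) g (l : ncseries R T) :
  Filter F -> nc_lim F g l -> mlim F (fun u => evn s N (g u)) (evn s N l).
Proof.
move=> FF gl; apply: mlim_sum => k; apply: mlim_sum => v i j.
rewrite mxE (_ : (fun _ => _) = fun u => word_prod s v i j * g u v).
  by rewrite mulrC; apply: cvgMr; exact: gl.
by apply/funext => u; rewrite mxE mulrC.
Qed.

Lemma mder_evn (r : T -> R -> R) g u : KZ_solution r g -> 0 < u < 1 ->
  mder (fun v => evn s N (g v)) u ((\sum_a r a u *: s a) * evn s N (g u)).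
Proof.
move=> sg u01; pose D : ncseries R T := (\sum_a r a u *: ncletter R a) * g u.
have DE w : D w = if w is a :: w' then r a u * g u w' else 0.
  rewrite /D mulr_suml ncsumE; case: w => [|a w].
    by rewrite big1 // => a _; rewrite -scalerAl ncscaleE letterM mulr0.
  rewrite (bigD1 a) //= -scalerAl ncscaleE letterM eqxx mul1r big1 ?addr0 //.
  by move=> b /negbTE ba; rewrite -scalerAl ncscaleE letterM eq_sym ba mul0r mulr0.
apply: (@mder_eq _ _ _ _ (evn s N D)).
  rewrite /D (nil_evnM s0) evn_sum; congr (_ * _); apply: eq_bigr => a _.
  by rewrite evnZ (nil_evn_letter s0).
apply: mder_sum => k; apply: mder_sum => v.
have := mderZ (sg u u01 v) (mder_cst (word_prod s v) u).
by rewrite scaler0 add0r -DE.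
Qed.

Lemma evn_letter_pow a u : evn s N (letter_pow a u) = upow N (- s a) u.
Proof.
rewrite /letter_pow (evn_exp ltdN rs) ?ncscaleE ?ncoppE ?oppr0 ?mulr0 //.
by rewrite evnZ -[- ncletter R a]sub0r evnB evn0 sub0r (nil_evn_letter s0).
Qed.

Lemma unipotent_evn f : f [::] = 1 -> unipotent d (evn s N f).
Proof.
move=> f1; rewrite /unipotent -(nil_evn1 s0) -evnB; apply: raises_evn => //.
by rewrite ncsubE f1 nc1E subrr.
Qed.

Lemma KZ_rate_at0 (r : T -> R -> R) g a : KZ_solution r g ->
    (forall u, 0 < u < 1 -> r a u = u^-1) -> (forall b, b != a -> tame (r b)) ->
    nc_lim 0^'+ (fun u => g u * letter_pow a u) 1 ->
  near1 (fun u => evn s N (g u) * upow N (- s a) u).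
Proof.
move=> sg ra rb lg.
apply: (regular_singular_rate ltdN (m := fun u => \sum_(b | b != a) r b u *: s b)) => //.
- by move=> u; apply: raises_sum => b _; exact: raisesZ.
- move=> i j; apply: (tame_eq _ (tame_sum (index_enum T)
    (F := fun b u => (if b == a then 0 else r b u) * s b i j) _)).
    near=> u; rewrite summxE [RHS]big_mkcond; apply: eq_bigr => b _.
    by case: eqP => _; rewrite ?mul0r ?mxE.
  move=> b; apply: tameM (tame_cst _).
  by case: eqP => [_|/eqP/rb //]; exact: tame_cst.
- near=> u; have u01 : 0 < u < 1 by near: u; exact: near0_lt.
  by have := mder_evn sg u01; rewrite (bigD1 a) //= ra.
- have H : mlim 0^'+ (fun u => evn s N (g u * letter_pow a u)) 1.
    by rewrite -(nil_evn1 s0); exact: evn_lim.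
  move=> i j; have := H i j; apply: cvg_trans; apply: near_eq_cvg; near=> u.
  by rewrite (nil_evnM s0) evn_letter_pow.
Unshelve. all: by end_near. Qed.

(** The reflection u |-> 1 - u turns the pole at 1 into a pole at 0 with the
    same residue. *)
Lemma KZ_rate_at1 (r : T -> R -> R) g a : KZ_solution r g ->
    (forall u, 0 < u < 1 -> r a u = (u - 1)^-1) ->
    (forall b, b != a -> tame (fun u => r b (1 - u))) ->
    nc_lim 1^'- (fun u => g u * letter_pow a (1 - u)) 1 ->
  near1 (fun u => evn s N (g (1 - u)) * upow N (- s a) u).
Proof.
move=> sg ra rb lg.
apply: (regular_singular_rate ltdN (m := fun u => \sum_(b | b != a) - r b (1 - u) *: s b)) => //.
- by move=> u; apply: raises_sum => b _; exact: raisesZ.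
- move=> i j; apply: (tame_eq _ (tame_sum (index_enum T)
    (F := fun b u => (if b == a then 0 else - r b (1 - u)) * s b i j) _)).
    near=> u; rewrite summxE [RHS]big_mkcond; apply: eq_bigr => b _.
    by case: eqP => _; rewrite ?mul0r ?mxE.
  move=> b; apply: tameM (tame_cst _).
  by case: eqP => [_|/eqP/rb rbt //]; [exact: tame_cst|exact: tameN].
- near=> u; have u01 : 0 < u < 1 by near: u; exact: near0_lt.
  have v01 : 0 < 1 - u < 1 by lra.
  have dv : is_derive u 1 (fun v : R => 1 - v) (-1).
    by have := is_deriveB (is_derive_cst (1 : R) u 1) (is_derive_id u 1); rewrite sub0r.
  apply: mder_eq (mder_comp dv (mder_evn sg v01)).
  rewrite (bigD1 a) //= ra // scaleN1r -mulNr opprD -scaleNr; congr ((_ + _) * _).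
    by congr (_ *: _); rewrite addrAC subrr sub0r invrN opprK.
  by rewrite -sumrN; apply: eq_bigr => b _; rewrite scaleNr.
- have H : mlim 1^'- (fun u => evn s N (g u * letter_pow a (1 - u))) 1.
    by rewrite -(nil_evn1 s0); exact: evn_lim.
  move=> i j; have /lim_reflect := H i j; apply: cvg_trans; apply: near_eq_cvg; near=> u.
  by rewrite /= (nil_evnM s0) evn_letter_pow subKr.
Unshelve. all: by end_near. Qed.

End Letters.

(** Values at matrices of a series in the letters A, B, and of a series in the
    letters A, b_0, b_1 *)
Definition ev2 (f : ncseries R 'I_2) (A B : M) := evn (tnth [tuple A; B]) N f.
Definition ev3 (f : ncseries R 'I_3) (A B C : M) := evn (tnth [tuple A; B; C]) N f.

Section Two.
Variables A B : M.
Hypotheses (rA : raises d 1 A) (rB : raises d 1 B).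
Let r2 a : raises d 1 (tnth [tuple A; B] a).
Proof. by rewrite (tnth_nth 0); case: a => [[|[|]]]. Qed.

Lemma unipotent_ev2 f : f [::] = 1 -> unipotent d (ev2 f A B).
Proof. exact: unipotent_evn. Qed.

Lemma ev2M f g : ev2 (f * g) A B = ev2 f A B * ev2 g A B.
Proof. by apply: nil_evnM => v lev; exact: (raises_word_prod0 ltdN). Qed.

Let E0 : tnth [tuple A; B] (inord 0) = A.
Proof. by rewrite (tnth_nth 0) /= inordK. Qed.
Let E1 : tnth [tuple A; B] (inord 1) = B.
Proof. by rewrite (tnth_nth 0) /= inordK. Qed.
Let ord2 (a : 'I_2) : a = inord 0 \/ a = inord 1.
Proof.
by case: a => [[|[|//]] lta]; [left|right]; apply/val_inj; rewrite /= inordK.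
Qed.
Let neq10 : (inord 1 == inord 0 :> 'I_2) = false.
Proof. by rewrite -val_eqE /= !inordK. Qed.

Lemma mder_ev2 g u : KZ_solution (@KZ_rate R) g -> 0 < u < 1 ->
  mder (fun v => ev2 (g v) A B) u ((u^-1 *: A + (u - 1)^-1 *: B) * ev2 (g u) A B).
Proof.
move=> sg u01; apply: mder_eq (mder_evn r2 sg u01); congr (_ * _).
rewrite (bigD1 (inord 0)) //= (bigD1 (inord 1)) ?neq10 //= big1 ?addr0.
  by rewrite E0 E1 /KZ_rate neq10 eqxx.
by move=> a; case: (ord2 a) => ->; rewrite eqxx ?andbF.
Qed.

Lemma ev2_at0 g : KZ_solution (@KZ_rate R) g ->
    nc_lim 0^'+ (fun u => g u * letter_pow (inord 0) u) 1 ->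
  near1 (fun u => ev2 (g u) A B * upow N (- A) u).
Proof.
move=> sg lg; have := @KZ_rate_at0 _ _ r2 _ g (inord 0) sg; rewrite E0; apply => //.
  by move=> u _; rewrite /KZ_rate eqxx.
move=> a; case: (ord2 a) => ->; rewrite ?eqxx // => _; rewrite /KZ_rate neq10.
exact: tame_inv_sub1.
Qed.

Lemma ev2_at1 g : KZ_solution (@KZ_rate R) g ->
    nc_lim 1^'- (fun u => g u * letter_pow (inord 1) (1 - u)) 1 ->
  near1 (fun u => ev2 (g (1 - u)) A B * upow N (- B) u).
Proof.
move=> sg lg; have := @KZ_rate_at1 _ _ r2 _ g (inord 1) sg; rewrite E1; apply => //.
  by move=> u _; rewrite /KZ_rate neq10.
move=> a; case: (ord2 a) => ->; rewrite ?eqxx // => _; rewrite /KZ_rate eqxx.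
apply: (tame_eq _ (tameN tame_inv_sub1)); near=> u.
by rewrite -invrN opprB.
Unshelve. all: by end_near. Qed.

End Two.

Section Three.
Variables A B C : M.
Hypotheses (rA : raises d 1 A) (rB : raises d 1 B) (rC : raises d 1 C).
Let r3 a : raises d 1 (tnth [tuple A; B; C] a).
Proof. by rewrite (tnth_nth 0); case: a => [[|[|[|]]]]. Qed.

Lemma unipotent_ev3 f : f [::] = 1 -> unipotent d (ev3 f A B C).
Proof. exact: unipotent_evn. Qed.

Lemma ev3M f g : ev3 (f * g) A B C = ev3 f A B C * ev3 g A B C.
Proof. by apply: nil_evnM => v lev; exact: (raises_word_prod0 ltdN). Qed.

Let E0 : tnth [tuple A; B; C] (inord 0) = A.
Proof. by rewrite (tnth_nth 0) /= inordK. Qed.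
Let E1 : tnth [tuple A; B; C] (inord 1) = B.
Proof. by rewrite (tnth_nth 0) /= inordK. Qed.
Let E2 : tnth [tuple A; B; C] (inord 2) = C.
Proof. by rewrite (tnth_nth 0) /= inordK. Qed.
Let ord3 (a : 'I_3) : [\/ a = inord 0, a = inord 1 | a = inord 2].
Proof.
by case: a => [[|[|[|//]]] lta]; [apply: Or31|apply: Or32|apply: Or33];
  apply/val_inj; rewrite /= inordK.
Qed.
Let neq10 : (inord 1 == inord 0 :> 'I_3) = false.
Proof. by rewrite -val_eqE /= !inordK. Qed.
Let neq20 : (inord 2 == inord 0 :> 'I_3) = false.
Proof. by rewrite -val_eqE /= !inordK. Qed.
Let neq21 : (inord 2 == inord 1 :> 'I_3) = false.
Proof. by rewrite -val_eqE /= !inordK. Qed.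

Lemma mder_ev3 g u : KZ_solution (@KZ2_rate R) g -> 0 < u < 1 ->
  mder (fun v => ev3 (g v) A B C) u
    ((u^-1 *: A + (u - 1)^-1 *: B + (u + 1)^-1 *: C) * ev3 (g u) A B C).
Proof.
move=> sg u01; apply: mder_eq (mder_evn r3 sg u01); congr (_ * _).
rewrite (bigD1 (inord 0)) //= (bigD1 (inord 1)) ?neq10 //=.
rewrite (bigD1 (inord 2)) ?neq20 ?neq21 //= big1 ?addr0.
  by rewrite E0 E1 E2 /KZ2_rate neq10 neq20 neq21 !eqxx addrA.
by move=> a; case: (ord3 a) => ->; rewrite eqxx ?andbF.
Qed.

Lemma ev3_at0 g : KZ_solution (@KZ2_rate R) g ->
    nc_lim 0^'+ (fun u => g u * letter_pow (inord 0) u) 1 ->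
  near1 (fun u => ev3 (g u) A B C * upow N (- A) u).
Proof.
move=> sg lg; have := @KZ_rate_at0 _ _ r3 _ g (inord 0) sg; rewrite E0; apply => //.
  by move=> u _; rewrite /KZ2_rate eqxx.
move=> a; case: (ord3 a) => ->; rewrite ?eqxx // => _; rewrite /KZ2_rate ?neq10 ?neq20 ?neq21 ?eqxx.
  exact: tame_inv_sub1.
apply: (@tame_bounded _ _ 1); near=> u; have u01 : 0 < u < 1 by near: u; exact: near0_lt.
rewrite normfV gtr0_norm; last lra.
by rewrite invf_le1; lra.
Unshelve. all: by end_near. Qed.

Lemma ev3_at1 g : KZ_solution (@KZ2_rate R) g ->
    nc_lim 1^'- (fun u => g u * letter_pow (inord 1) (1 - u)) 1 ->
  near1 (fun u => ev3 (g (1 - u)) A B C * upow N (- B) u).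
Proof.
move=> sg lg; have := @KZ_rate_at1 _ _ r3 _ g (inord 1) sg; rewrite E1; apply => //.
  by move=> u _; rewrite /KZ2_rate neq10 eqxx.
move=> a; case: (ord3 a) => ->; rewrite ?eqxx // => _; rewrite /KZ2_rate ?neq10 ?neq20 ?neq21 ?eqxx.
  apply: (tame_eq _ (tameN tame_inv_sub1)); near=> u.
  by rewrite -invrN opprB.
apply: (@tame_bounded _ _ 1); near=> u; have u01 : 0 < u < 1 by near: u; exact: near0_lt.
rewrite normfV gtr0_norm; last lra.
by rewrite invf_le1; lra.
Unshelve. all: by end_near. Qed.

End Three.

End KZMatrices.

(** * Primitives and linear equations on ]0, 1[ *)

Section Primitives.
Variable R : realType.
Implicit Types (f F : R -> R) (u v : R).

Lemma primitive_exists f : (forall u, -1 < u < 1 -> {for u, continuous f}) ->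
  exists F : R -> R, forall u, -1/2 < u < 1 -> is_derive u 1 F (f u).
Proof.
move=> cf; pose F := fun x : R => (\int[lebesgue_measure]_(t in `[-1/2, x]) f t)%R.
exists F => u /andP[u0 u1]; have ui : u < (u + 1) / 2 by lra.
have [||] := @continuous_FTC1_closed _ f (-1/2) u ((u + 1) / 2) ui _ u0.
- apply: continuous_compact_integrable; first exact: segment_compact.
  apply/continuous_in_subspaceT => w; rewrite inE /= in_itv /= => /andP[w0 w1].
  by apply: cf; lra.
- by apply: cf; lra.
by rewrite -/F derive1E => dF FE; apply: DeriveDef.
Qed.

Lemma tame_comp f (phi : R -> R) c p : 0 < c ->
    (\forall u \near (0 : R)^'+, c * u ^+ p.+1 <= phi u <= u) ->
  tame f -> tame (fun u => f (phi u)).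
Proof.
move=> c0 cphi tf a a0; have ap0 : 0 < a / p.+1%:R by rewrite divr_gt0.
have [k fk] := tf _ ap0; have [b b0 fb] := near0_ex fk.
exists (`|k| * c `^ (- (a / p.+1%:R))); near=> u.
have /andP[u0 ub] : 0 < u < b by near: u; exact: near0_lt.
have /andP[lphi phil] : c * u ^+ p.+1 <= phi u <= u by near: u.
have up0 : 0 < c * u ^+ p.+1 by rewrite mulr_gt0 // exprn_gt0.
have phi0 := lt_le_trans up0 lphi.
have := fb (phi u); rewrite phi0 (le_lt_trans phil ub) => /(_ isT) /le_trans; apply.
apply: (le_trans (ler_wpM2r (powR_ge0 _ _) (ler_norm k))).
rewrite -mulrA ler_wpM2l //.
have -> : u `^ (- a) = (u ^+ p.+1) `^ (- (a / p.+1%:R)).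
  rewrite -powR_mulrn ?ltW // -powRrM; congr (_ `^ _).
  by rewrite mulrN mulrCA mulfV ?mulr1 // pnatr_eq0.
rewrite -(powRM _ (ltW c0) (exprn_ge0 _ (ltW u0))) !powRN lef_pV2 ?posrE ?powR_gt0 //.
by apply: ge0_ler_powR; rewrite ?nnegrE // ltW.
Unshelve. all: by end_near. Qed.

(** The substitution u = s^2 turns a tame function into one which extends
    continuously by 0 to s <= 0, where an ordinary primitive exists. *)
Lemma tame_primitive f : (forall u, 0 < u < 1 -> {for u, continuous f}) -> tame f ->
  exists2 F : R -> R, (forall u, 0 < u < 1 -> is_derive u 1 F (f u)) & F @ 0^'+ --> 0.
Proof.
move=> cf tf; pose h (s : R) : R := if 0 < s then f (s ^+ 2) * (2 * s) else 0.
have ch (s : R) : -1 < s < 1 -> {for s, continuous h}.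
  move=> /andP[s0 s1]; have [lts|lts|->] := ltgtP s 0.
  - rewrite /prop_for /continuous_at [X in _ --> X]/h ltNge ltW //=.
    apply: cvg_near_cst; near=> t; have t0 : t < 0 by near: t; exact: lt_nbhsl.
    by rewrite /h !ltNge !ltW.
  - have h2 : f (t ^+ 2) * (2 * t) @[t --> s] --> f (s ^+ 2) * (2 * s).
      apply: cvgM; last by apply: cvgMr; exact: cvg_id.
      have s2 : 0 < s ^+ 2 < 1 by rewrite exprn_gt0 //= exprn_ilt1 // ltW.
      apply: (cvg_comp (fun t => t ^+ 2) f _ (cf _ s2)); exact: exprn_continuous.
    rewrite /prop_for /continuous_at [X in _ --> X]/h lts; apply: cvg_trans h2.
    apply: near_eq_cvg; near=> t; have t0 : 0 < t by near: t; exact: lt_nbhsr.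
    by rewrite /h t0.
  have h0 : h 0 = 0 by rewrite /h ltxx.
  apply/left_right_continuousP; split; rewrite h0.
    apply: cvg_near_cst; near=> t; have t0 : t < 0 by near: t; exact: nbhs_left_lt.
    by rewrite /h ltNge ltW.
  have tf2 : tame (fun t => f (t ^+ 2)).
    apply: (@tame_comp f (fun t => t ^+ 2) 1 1) => //; near=> t.
    have /andP[t0 t1] : 0 < t < 1 by near: t; exact: near0_lt.
    by rewrite mul1r lexx /= expr2 ger_pMl // ltW.
  have n2 : negl (fun t : R => 2 * t).
    apply: (@negl_bound _ _ 2); near=> t; rewrite normrM !ger0_norm //.
  have := negl_cvg (neglMl tf2 n2); apply: cvg_trans; apply: near_eq_cvg.
  near=> t; have t0 : 0 < t by near: t; exact: nbhs_right_gt.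
  by rewrite /h t0.
have [F FD] := primitive_exists ch.
exists (fun u => F (Num.sqrt u) - F 0).
  move=> u /andP[u0 u1].
  have s0 : 0 < Num.sqrt u by rewrite sqrtr_gt0.
  have s1 : -1/2 < Num.sqrt u < 1.
    have : Num.sqrt u < Num.sqrt 1 by rewrite ltr_sqrt.
    rewrite sqrtr1; lra.
  have := @is_derive1_comp _ F (@Num.sqrt R) u _ _ (FD _ s1) (is_derive1_sqrt u0).
  move=> /is_derive_addf /(_ (is_derive_cst (- F 0) u 1)).
  rewrite addr0 /h s0 sqr_sqrtr ?ltW // -mulrA divff ?mulr1 //.
  by rewrite mulf_neq0 // gt_eqF.
have F0 : -1/2 < (0 : R) < 1 by lra.
have FsF : F (Num.sqrt u) @[u --> 0^'+] --> F 0.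
  apply: (cvg_comp _ _ (@sqrt_cvg0 R)); exact: is_derive_continuous (FD _ F0).
by rewrite -[X in _ --> X](subrr (F 0)); apply: cvgB => //; exact: cvg_cst.
Unshelve. all: by end_near. Qed.

End Primitives.

Section LinearEquation.
Variables (R : realType) (n : nat) (d : 'I_n.+1 -> nat) (N : nat).
Hypothesis ltdN : forall i, (d i < N)%N.
Local Notation M := 'M[R]_n.+1.
Implicit Types (f g V P Q : R -> M) (u v : R) (X : M).

Definition mcont f u := forall i j, {for u, continuous (fun v => f v i j)}.

Lemma mcont_cst X u : mcont (fun=> X) u.
Proof. by move=> i j; exact: cvg_cst. Qed.

Lemma mcontM f g u : mcont f u -> mcont g u -> mcont (fun v => f v * g v) u.
Proof.
move=> cf cg i j; rewrite /prop_for /continuous_at mxE.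
rewrite (_ : (fun _ => _) = fun v => \sum_k f v i k * g v k j); last first.
  by apply/funext => v; rewrite mxE.
elim: index_enum => [|k r IHr].
  rewrite big_nil (_ : (fun _ => _) = cst 0); first exact: cvg_cst.
  by apply/funext => v; rewrite big_nil.
rewrite big_cons (_ : (fun _ => _) =
  fun v => f v i k * g v k j + \sum_(k <- r) f v i k * g v k j).
  by apply: cvgD IHr; apply: cvgM; [exact: cf|exact: cg].
by apply/funext => v; rewrite big_cons.
Qed.

Lemma mder_cont f u X : mder f u X -> mcont f u.
Proof. by move=> fd i j; exact: is_derive_continuous (fd i j). Qed.

Lemma mcontZ (c : R -> R) f u : {for u, continuous c} -> mcont f u ->
  mcont (fun v => c v *: f v) u.
Proof.
move=> cc cf i j; rewrite /prop_for /continuous_at mxE.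
rewrite (_ : (fun _ => _) = fun v => c v * f v i j); first exact: cvgM cc (cf i j).
by apply/funext => v; rewrite mxE.
Qed.

Lemma matrix_primitive k f : (forall u, 0 < u < 1 -> raises d k (f u)) ->
    (forall u, 0 < u < 1 -> mcont f u) -> mtame f ->
  exists F : R -> M, [/\ forall u, 0 < u < 1 -> mder F u (f u),
    forall u, raises d k (F u) & mnegl F].
Proof.
move=> rf cf tf.
have /choice[G GE] (p : 'I_n.+1 * 'I_n.+1) : exists F : R -> R,
    (forall u, 0 < u < 1 -> is_derive u 1 F (f u p.1 p.2)) /\ F @ 0^'+ --> 0.
  have [|F FD F0] := @tame_primitive _ (fun u => f u p.1 p.2) _ (tf p.1 p.2).
    by move=> u u01; exact: cf.
  by exists F.
pose F u : M := \matrix_(i, j) if (d i < d j + k)%N then 0 else G (i, j) u.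
have FD u : 0 < u < 1 -> mder F u (f u).
  move=> u01 i j; rewrite (_ : (fun _ => _) = fun v => if (d i < d j + k)%N then 0 else G (i, j) v).
    by case: ltnP => [lt|_]; [rewrite rf //; exact: is_derive_cst|exact: (GE (i, j)).1].
  by apply/funext => v; rewrite mxE.
exists F; split=> // [u i j lt|i j]; first by rewrite mxE lt.
apply: (negl_of_derive _ (tf i j)).
  by near=> u; apply: FD; near: u; exact: near0_lt.
rewrite (_ : (fun _ => _) = fun v => if (d i < d j + k)%N then 0 else G (i, j) v).
  by case: ltnP => _; [exact: cvg_cst|exact: (GE (i, j)).2].
by apply/funext => v; rewrite mxE.
Unshelve. all: by end_near. Qed.

(** Picard iteration stops: the error P of the k-th iterate raises the degree by
    k, hence vanishes for k = N. *)
Lemma linear_equation_exists V : (forall u, 0 < u < 1 -> raises d 1 (V u)) ->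
    (forall u, 0 < u < 1 -> mcont V u) -> mtame V ->
  exists Q : R -> M, [/\ forall u, 0 < u < 1 -> mder Q u (V u * Q u),
    forall u, unipotent d (Q u) & near1 Q].
Proof.
move=> rV cV tV.
suff H k : exists Q P : R -> M, [/\ forall u, 0 < u < 1 -> mder Q u (V u * (Q u - P u)),
    forall u, unipotent d (Q u), near1 Q, forall u, raises d k (P u) &
    mtame P /\ forall u, 0 < u < 1 -> mcont P u].
  have [Q [P [QD uQ nQ rP _]]] := H N; exists Q; split=> // u u01.
  by rewrite -[Q u in X in mder _ _ X]subr0 -(raises_eq0 ltdN (leqnn N) (rP u)); exact: QD.
elim: k => [|k [Q [P [QD uQ nQ rP [tP cP]]]]].
  exists (fun=> 1), (fun=> 1); split=> [u _|u||u|].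
  - by rewrite subrr mulr0; exact: mder_cst.
  - exact: unipotent1.
  - by apply: (mnegl_eq _ (@mnegl0 _ _)); near=> u; rewrite subrr.
  - exact: raises_1.
  - by split=> [|u _]; [exact: mtame_cst|exact: mcont_cst].
have [u|u u01|i j|P' [P'D rP' nP']] := @matrix_primitive k.+1 (fun u => V u * P u).
- by move=> u01; rewrite -add1n; apply: raisesM => //; exact: rV.
- by apply: mcontM; [exact: cV|exact: cP].
- exact: mtameM.
exists (fun u => Q u + P' u), P'; split=> [u u01|u||//|].
- rewrite addrK; apply: mder_eq (mderD (QD u u01) (P'D u u01)).
  by rewrite -mulrDr subrK.
- rewrite /unipotent addrAC; apply: raisesD; first exact: uQ.
  by apply: (@raisesW _ _ _ 1 k.+1).
- apply: (mnegl_eq _ (mneglD nQ nP')); near=> u; exact: addrAC.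
- split=> [|u u01]; first exact: mnegl_tame.
  exact: mder_cont (P'D u u01).
Unshelve. all: by end_near. Qed.

End LinearEquation.

(** * Estimates uniform on an interval *)

Section Weight.
Variable R : realType.
Implicit Types (f : R -> R) (u v b c : R).

(** An integrable weight on ]0, 1[ that dominates the tame functions *)
Definition weight u : R := (Num.sqrt u)^-1 + (Num.sqrt (1 - u))^-1.
(** A primitive of [weight] that vanishes at 0 *)
Definition weight_int u : R := 2 * Num.sqrt u + 2 * (1 - Num.sqrt (1 - u)).

Lemma sqrt_01 u : 0 < u < 1 -> 0 < Num.sqrt u < 1.
Proof.
move=> /andP[u0 u1]; rewrite sqrtr_gt0 u0 /=.
have : Num.sqrt u < Num.sqrt 1 by rewrite ltr_sqrt.
by rewrite sqrtr1.
Qed.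

Lemma reflect_01 u : 0 < u < 1 -> 0 < 1 - u < 1. Proof. lra. Qed.

Lemma weight_ge u : 0 < u < 1 -> 1 <= (Num.sqrt u)^-1 <= weight u.
Proof.
move=> u01; have /andP[s0 s1] := sqrt_01 u01.
have /andP[t0 t1] := sqrt_01 (reflect_01 u01).
by rewrite invf_ge1 // (ltW s1) /= lerDl invr_ge0 ltW.
Qed.

Lemma weight_ge1 u : 0 < u < 1 -> 1 <= weight u.
Proof. by move=> /weight_ge/andP[]; exact: le_trans. Qed.

Lemma weightC u : weight (1 - u) = weight u.
Proof. by rewrite /weight subKr addrC. Qed.

Lemma weight_intD u : 0 < u < 1 -> is_derive u 1 weight_int (weight u).
Proof.
move=> u01; have /andP[u0 u1] := u01; have v0 : 0 < 1 - u by lra.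
have dv : is_derive u 1 (fun v : R => 1 - v) (-1).
  by have := is_deriveB (is_derive_cst (1 : R) u 1) (is_derive_id u 1); rewrite sub0r.
have ds := @is_derive1_comp _ (@Num.sqrt R) _ u _ _ (is_derive1_sqrt v0) dv.
have := is_derive_addf (is_derive_mulc 2 (is_derive1_sqrt u0))
  (is_derive_mulc 2 (is_derive_addf (is_derive_cst (1 : R) u 1) (is_derive_mulc (-1) ds))).
have E : 2 * (2 * Num.sqrt u)^-1 + 2 * (0 + -1 * ((2 * Num.sqrt (1 - u))^-1 * -1)) = weight u.
  rewrite /weight; have /andP[s0 _] := sqrt_01 u01.
  have /andP[t0 _] := sqrt_01 (reflect_01 u01).
  by field; rewrite !gt_eqF.
rewrite E; apply: is_derive_ext => w; rewrite /weight_int /=; congr (_ + _ * (_ + _)).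
by rewrite mulN1r.
Qed.

Lemma weight_int_le u : 0 < u < 1 -> weight_int u <= 4.
Proof.
move=> u01; have /andP[s0 s1] := sqrt_01 u01.
by have /andP[t0 t1] := sqrt_01 (reflect_01 u01); rewrite /weight_int; lra.
Qed.

Lemma weight_int0 : weight_int @ 0^'+ --> 0.
Proof.
have H : Num.sqrt (1 - u) @[u --> (0 : R)^'+] --> (1 : R).
  rewrite -[X in _ --> X]sqrtr1 -[X in Num.sqrt X]subr0.
  apply: (cvg_comp (fun u => 1 - u) (@Num.sqrt R)); last exact: sqrt_continuous.
  apply: cvg_at_right_filter; apply: cvgB; [exact: cvg_cst|exact: cvg_id].
rewrite [X in _ --> X](_ : 0 = 2 * 0 + 2 * (1 - 1)); last by lra.
apply: cvgD; apply: cvgMr; first exact: sqrt_cvg0.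
by apply: cvgB H; exact: cvg_cst.
Qed.

Definition dominated b f := exists c, forall u, 0 < u < b -> `|f u| <= c * weight u.

Lemma dominated_left f b : 0 < b < 1 -> (forall u, 0 < u < 1 -> {for u, continuous f}) ->
  tame f -> dominated b f.
Proof.
move=> /andP[b0 b1] cf /(_ 2^-1); case; first by lra.
move=> c /near0_ex[e e0 fe]; pose e' := Num.min e b / 2.
have [e'0 e'e e'b] : [/\ 0 < e', e' < e & e' < b].
  rewrite /e'; split; first by rewrite divr_gt0 // lt_min e0.
    by apply: (@le_lt_trans _ _ (e / 2)); [rewrite ler_pM2r ?ge_min ?lexx|lra].
  by apply: (@le_lt_trans _ _ (b / 2)); [rewrite ler_pM2r ?ge_min ?lexx ?orbT|lra].
have [||t /= _ ft] := @EVT_max _ (fun u => `|f u|) e' b; first exact: ltW.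
  apply/continuous_in_subspaceT => w; rewrite inE /= in_itv /= => /andP[w0 w1].
  by apply: cvg_norm; apply: cf; lra.
exists (`|c| + `|f t|) => u /andP[u0 ub]; have u01 : 0 < u < 1 by lra.
have w1 := weight_ge1 u01; have w0 : 0 <= weight u by lra.
have [ue|e'u] := ltP u e'.
  have ue0 : 0 < u < e by lra.
  apply: (le_trans (fe _ ue0)); rewrite powRN (powR12_sqrt (ltW u0)).
  apply: (@le_trans _ _ (`|c| * weight u)).
    apply: (@le_trans _ _ (`|c| * (Num.sqrt u)^-1)).
      by rewrite ler_wpM2r ?ler_norm // invr_ge0 sqrtr_ge0.
    by rewrite ler_wpM2l //; have /andP[] := weight_ge u01.
  by rewrite ler_wpM2r // lerDl.
apply: (@le_trans _ _ (`|f t| * weight u)).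
  apply: (@le_trans _ _ `|f t|); last by rewrite ler_peMr.
  by apply: ft; rewrite in_itv /= e'u ltW.
by rewrite ler_wpM2r // lerDr.
Qed.

Lemma dominated_01 f : (forall u, 0 < u < 1 -> {for u, continuous f}) ->
  tame f -> tame (fun u => f (1 - u)) -> dominated 1 f.
Proof.
move=> cf tf tf1; have b01 : 0 < (2/3 : R) < 1 by lra.
have [c fc] := dominated_left b01 cf tf.
have [|c' fc'] := dominated_left b01 _ tf1.
  move=> u /reflect_01 u01; apply: (@continuous_comp _ _ _ (fun v => 1 - v) f); last exact: cf.
  by apply: cvgB; [exact: cvg_cst|exact: cvg_id].
exists (`|c| + `|c'|) => u u01; have w1 := weight_ge1 u01.
have [u23|u23] := ltP u (2/3).
  apply: (@le_trans _ _ (c * weight u)); first by apply: fc; lra.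
  by rewrite ler_wpM2r; [|lra|rewrite (le_trans (ler_norm c)) // lerDl].
apply: (@le_trans _ _ (c' * weight u)); last first.
  by rewrite ler_wpM2r; [|lra|rewrite (le_trans (ler_norm c')) // lerDr].
by rewrite -weightC -[X in f X](subKr 1); apply: fc'; lra.
Qed.

End Weight.

Section UniformEstimates.
Variables (R : realType) (n : nat) (d : 'I_n.+1 -> nat) (N : nat).
Hypothesis ltdN : forall i, (d i < N)%N.
Local Notation M := 'M[R]_n.+1.
Implicit Types (V Q W : R -> M) (b c h u : R).

Definition mdominated b V := exists2 c, 0 <= c &
  forall u i j, 0 < u < b -> `|V u i j| <= c * weight u.

Lemma mdominatedP b V : b <= 1 -> (forall i j, dominated b (fun u => V u i j)) -> mdominated b V.
Proof.
move=> b1 H; have /choice[G GE] (p : 'I_n.+1 * 'I_n.+1) : exists c, forall u, 0 < u < b ->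
  `|V u p.1 p.2| <= c * weight u by exact: H.
exists (\sum_p `|G p|) => [|u i j ub]; first exact: sumr_ge0.
have w1 : 1 <= weight u by apply: weight_ge1; lra.
apply: (le_trans (GE (i, j) u ub)); rewrite ler_wpM2r //; first lra.
rewrite (bigD1 (i, j)) //=; apply: (le_trans (ler_norm _)).
by rewrite lerDl sumr_ge0.
Qed.

(** The bound on the entries of Q - 1 that raise the degree by r follows, by
    integration of the weight, from the bound on those that raise it less. The
    constant k does not depend on V and Q, which makes the comparison of nearby
    solutions uniform. *)
Lemma small_solution b c : b <= 1 -> 0 <= c -> exists2 k, 0 <= k & forall V Q h,
    0 <= h <= 1 -> (forall u, 0 < u < b -> raises d 1 (V u)) ->
    (forall u i j, 0 < u < b -> `|V u i j| <= h * c * weight u) ->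
    (forall u, 0 < u < b -> mder Q u (V u * Q u)) -> near1 Q ->
  forall u i j, 0 < u < b -> `|(Q u - 1) i j| <= k * h.
Proof.
move=> b1 c0; suff H r : exists2 k, 0 <= k & forall V Q h,
    0 <= h <= 1 -> (forall u, 0 < u < b -> raises d 1 (V u)) ->
    (forall u i j, 0 < u < b -> `|V u i j| <= h * c * weight u) ->
    (forall u, 0 < u < b -> mder Q u (V u * Q u)) -> near1 Q ->
  forall u i j, (d i + N < d j + r)%N -> 0 < u < b -> `|(Q u - 1) i j| <= k * h.
  have [k k0 kE] := H N.*2; exists k => // V Q h h01 rV Vh QD Q1 u i j ub.
  by apply: (kE V) => //; have := ltdN i; lia.
elim: r => [|r [k k0 kE]].
  exists 0 => // V Q h _ _ _ _ _ u i j lt; have := ltdN j; lia.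
exists (4 * (c * (1 + k) * n.+1%:R)) => [|V Q h h01 rV Vh QD Q1 u i j lt ub].
  by rewrite !mulr_ge0 // addr_ge0.
have /andP[h0 h1] := h01.
have IH := kE V Q h h01 rV Vh QD Q1.
apply: (@le_trans _ _ (c * (1 + k) * n.+1%:R * h * weight_int u)); last first.
  rewrite [leRHS](_ : _ = c * (1 + k) * n.+1%:R * h * 4); last by ring.
  rewrite ler_wpM2l ?mulr_ge0 ?addr_ge0 // weight_int_le //; lra.
move: u ub; apply: (@le_of_derive _ b (fun u => (Q u - 1) i j)
  (fun u => (V u * Q u) i j) (fun u => c * (1 + k) * n.+1%:R * h * weight_int u)
  (fun u => c * (1 + k) * n.+1%:R * h * weight u)).
- move=> v vb; have := mderD (QD v vb) (mder_cst (-1) v) i j.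
  by rewrite addr0.
- by move=> v vb; apply: is_derive_mulc; apply: weight_intD; lra.
- move=> v vb; rewrite mxE; apply: (le_trans (ler_norm_sum _ _ _)).
  have E : c * (1 + k) * n.+1%:R * h * weight v = \sum_(l < n.+1) (h * c * weight v * (1 + k)).
    by rewrite sumr_const card_ord -mulr_natr; ring.
  rewrite E; apply: ler_sum => l _; rewrite normrM.
  have [ltli|leil] := ltnP (d l) (d i); last first.
    have w1 : 1 <= weight v by apply: weight_ge1; lra.
    by rewrite (rV v vb) ?addn1 // normr0 mul0r !mulr_ge0 //; lra.
  apply: ler_pM => //; first exact: Vh.
  have -> : Q v l j = (1 : M) l j + (Q v - 1) l j by rewrite !mxE; ring.
  apply: (le_trans (ler_normD _ _)); apply: lerD.
    by rewrite mxE; case: eqP => _; rewrite ?normr1 ?normr0.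
  apply: (le_trans (IH v l j _ vb)); first by lia.
  by rewrite ler_piMr.
- exact: negl_cvg (Q1 i j).
- by rewrite -[X in _ --> X](mulr0 (c * (1 + k) * n.+1%:R * h)); apply: cvgMr; exact: weight_int0.
Qed.

End UniformEstimates.

(** * A flat connection on the square *)

Section Connection.
Variables (R : realType) (n : nat) (d : 'I_n.+1 -> nat) (N : nat).
Hypothesis ltdN : forall i, (d i < N)%N.
Local Notation M := 'M[R]_n.+1.
Variables A B C D E : M.
Hypotheses (rA : raises d 1 A) (rB : raises d 1 B) (rC : raises d 1 C)
  (rD : raises d 1 D) (rE : raises d 1 E).
Hypotheses (cAC : GRing.comm A C) (cBC : GRing.comm B C) (cAD : GRing.comm A D)
  (cBED : GRing.comm (B + E) D) (cDEB : GRing.comm (D + E) B)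
  (cCDAE : GRing.comm (C + D - A) E).
Implicit Types (U Q : R -> M) (u x y h b c : R).
Local Notation uinv := (uinv N).
Local Notation upow := (upow N).
Local Notation unipotent := (unipotent d).

Lemma is_derive_invf (f : R -> R) u df : f u != 0 -> is_derive u 1 f df ->
  is_derive u 1 (fun v => (f v)^-1) (- df / f u ^+ 2).
Proof.
move=> fu0 fd; have := is_deriveV fu0 fd; rewrite /GRing.scale /=.
by rewrite mulNr mulrC -mulNr.
Qed.

Lemma near_01 u : 0 < u < 1 -> \forall v \near u, 0 < v < 1.
Proof.
move=> /andP[u0 u1]; near=> v; apply/andP; split; near: v; [exact: lt_nbhsr|exact: lt_nbhsl].
Unshelve. all: by end_near. Qed.

Definition kap x y := (1 - x * y)^-1.

Lemma kap_gt0 x y : 0 <= x <= 1 -> 0 < y < 1 -> 0 < kap x y.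
Proof. by move=> /andP[x0 x1] /andP[y0 y1]; rewrite invr_gt0; nra. Qed.

Lemma kap_neq0 x y : 0 <= x <= 1 -> 0 < y < 1 -> 1 - x * y != 0.
Proof. by move=> hx hy; have := kap_gt0 hx hy; rewrite invr_gt0 => /gt_eqF->. Qed.

(** The connection d - omega_x dx - omega_y dy has its poles on x = 0, x = 1, y
    = 0, y = 1 and xy = 1. The form d(xy)/(xy - 1) has coefficients - y * kap x
    y and - x * kap x y. *)
Definition omega_y x y := y^-1 *: C + (y - 1)^-1 *: D - (x * kap x y) *: E.
Definition omega_x x y := x^-1 *: A + (x - 1)^-1 *: B - (y * kap x y) *: E.

(** With the commutation relations, all the brackets reduce to [B, D] and [A,
    E], whose coefficients cancel. As omega_x dx + omega_y dy is closed, this is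
    the flatness of the connection. *)
Lemma omega_comm x y : 0 < x < 1 -> 0 < y < 1 ->
  omega_x x y * omega_y x y = omega_y x y * omega_x x y.
Proof.
move=> x01 y01.
have k0 : 1 - x * y != 0 by apply: kap_neq0 => //; lra.
have [x0 x1 y0 y1] : [/\ x != 0, x - 1 != 0, y != 0 & y - 1 != 0].
  by split; rewrite ?subr_eq0; apply/eqP; lra.
apply/eqP; rewrite -subr_eq0; apply/eqP.
pose brk (X Y : M) := X * Y - Y * X.
have brkDl X Y Z : brk (X + Y) Z = brk X Z + brk Y Z.
  by rewrite /brk mulrDl mulrDr opprD addrACA.
have brkDr X Y Z : brk X (Y + Z) = brk X Y + brk X Z.
  by rewrite /brk mulrDl mulrDr opprD addrACA.
have brkNl X Y : brk (- X) Y = - brk X Y by rewrite /brk mulNr mulrN opprB opprK addrC.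
have brkNr X Y : brk X (- Y) = - brk X Y by rewrite /brk mulNr mulrN opprB opprK addrC.
have brkZl a X Y : brk (a *: X) Y = a *: brk X Y by rewrite /brk -scalerAl -scalerAr scalerBr.
have brkZr a X Y : brk X (a *: Y) = a *: brk X Y by rewrite /brk -scalerAl -scalerAr scalerBr.
have brkC X Y : brk Y X = - brk X Y by rewrite /brk opprB.
have brk0 X Y : GRing.comm X Y -> brk X Y = 0 by move=> cXY; rewrite /brk cXY subrr.
have brkEE : brk E E = 0 by rewrite /brk subrr.
have brkED : brk E D = - brk B D by apply/eqP; rewrite -addr_eq0 addrC -brkDl brk0.
have brkBE : brk B E = - brk B D.
  apply/eqP; rewrite -addr_eq0 addrC -brkDr brk0 //; exact: commr_sym.
have brkEC : brk E C = brk B D - brk A E.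
  have := brk0 _ _ cCDAE; rewrite !brkDl brkNl (brkC E C) (brkC E D) brkED opprK => H.
  by apply/esym/eqP; rewrite -subr_eq0 addrC addrA H.
rewrite -/(brk _ _) /omega_x /omega_y !(brkDl, brkDr, brkNl, brkNr, brkZl, brkZr).
rewrite (brk0 _ _ cAC) (brk0 _ _ cBC) (brk0 _ _ cAD) brkEE brkED brkBE brkEC.
move: (brk B D) (brk A E) => beta gamma; apply/matrixP => i j; rewrite !mxE /kap.
by field; rewrite k0 x0 x1 y0 y1.
Qed.

(** The section over the line of constant x with standard asymptotics at y = 0
    *)
Definition Usol x U := [/\ forall y, 0 < y < 1 -> mder U y (omega_y x y * U y),
  forall y, 0 < y < 1 -> unipotent (U y) & near1 (fun y => U y * upow (- C) y)].

Let rNC : raises d 1 (- C). Proof. exact: raisesN. Qed.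

Section OneSolution.
Variables (x : R) (U : R -> M).
Hypotheses (x01 : 0 <= x <= 1) (sU : Usol x U).

Lemma Usol_tame : mtame U.
Proof.
have [_ _ nU] := sU.
apply: (mtame_eq _ (mtameM (near1_tame nU) (mtame_upow N C))).
by near=> y; rewrite -mulrA (upowNl ltdN) ?mulr1.
Unshelve. all: by end_near. Qed.

Lemma Usol_V y : 0 < y < 1 -> uinv (U y) * U y = 1.
Proof. by case: sU => _ uU _ y01; exact: (uinv_mul ltdN (uU _ y01)). Qed.

Lemma Usol_K y : 0 < y < 1 -> U y * uinv (U y) = 1.
Proof. by case: sU => _ uU _ y01; exact: (mul_uinv ltdN (uU _ y01)). Qed.

Lemma mder_Usol_inv y : 0 < y < 1 ->
  mder (fun v => uinv (U v)) y (- (uinv (U y) * omega_y x y)).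
Proof.
move=> y01; have [dU uU _] := sU.
apply: mder_eq (mder_uinv ltdN _ (dU y y01)).
  by rewrite -[in LHS]mulrA -[X in _ * X]mulrA Usol_K // mulr1.
by near=> v; apply: uU; near: v; exact: near_01.
Unshelve. all: by end_near. Qed.

Definition conj_U (X : M) y := uinv (U y) * X * U y.

Lemma raises_conj_U X y : 0 < y < 1 -> raises d 1 X -> raises d 1 (conj_U X y).
Proof.
case: sU => _ uU _ y01 rX.
have r0 (Y : M) : unipotent Y -> raises d 0 Y.
  move=> uY; rewrite -[Y](subrK 1); apply: raisesD; last exact: raises_1.
  exact: (@raisesW _ _ _ 0 1).
have := raisesM (raisesM (r0 _ (unipotent_uinv ltdN (uU _ y01))) rX) (r0 _ (uU _ y01)).
by rewrite add0n addn0.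
Qed.

Lemma mtame_conj_U X : mtame (conj_U X).
Proof.
by apply: mtameM Usol_tame; apply: mtameM (mtame_cst X); apply: mtame_uinv; exact: Usol_tame.
Qed.

Lemma mcont_conj_U X y : 0 < y < 1 -> mcont (conj_U X) y.
Proof.
move=> y01; have [dU _ _] := sU.
apply: mcontM; last exact: mder_cont (dU y y01).
by apply: mcontM; [exact: mder_cont (mder_Usol_inv y01)|exact: mcont_cst].
Qed.

Lemma mdominated_conj_U X b : 0 < b < 1 -> mdominated b (conj_U X).
Proof.
move=> b01; apply: mdominatedP => [|i j]; first by lra.
by apply: dominated_left => // [u u01|]; [exact: mcont_conj_U|exact: mtame_conj_U].
Qed.

End OneSolution.

(** The derivative of U^-1 U' involves the difference of the two connection
    forms, which only retains the pole along xy = 1 and is proportional to x' -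
    x. *)
Lemma Usol_quotient x x' U U' : 0 <= x <= 1 -> 0 <= x' <= 1 -> Usol x U -> Usol x' U' ->
  let Q y := uinv (U y) * U' y in
  (forall y, 0 < y < 1 -> mder Q y ((- ((x' - x) * kap x y * kap x' y) *: conj_U U E y) * Q y)) /\
  near1 Q.
Proof.
move=> x01 x'01 sU sU' Q; have [dU uU nU] := sU; have [dU' uU' nU'] := sU'.
split=> [y y01|].
  have k0 : 1 - x * y != 0 by exact: kap_neq0.
  have k0' : 1 - x' * y != 0 by exact: kap_neq0.
  apply: mder_eq (mderM (mder_Usol_inv sU y01) (dU' y y01)).
  rewrite mulNr -[X in _ - X]mulrA -mulrBr -mulrBl.
  have -> : omega_y x' y - omega_y x y = - ((x' - x) * kap x y * kap x' y) *: E.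
    have y0 : y != 0 by apply/eqP; lra.
    have y1 : y - 1 != 0 by rewrite subr_eq0; apply/eqP; lra.
    apply/matrixP => i j; rewrite /omega_y /kap !mxE.
    by field; rewrite k0 k0' y0 y1.
  rewrite /conj_U -!scalerAl -!scalerAr -!mulrA; congr (_ *: (_ * (_ * _))).
  by rewrite /Q mulrA (Usol_K sU y01) mul1r.
have uN : \forall y \near (0 : R)^'+, unipotent (U y * upow (- C) y).
  near=> y; apply: unipotentM; last exact: (unipotent_upow ltdN).
  by apply: uU; near: y; exact: near0_lt.
have nQ := near1M (near1_uinv ltdN uN nU) nU'.
apply: (mnegl_eq _ (mneglMr (mneglMl (mtame_upow N (- C)) nQ) (mtame_upow N C))).
near=> y; have y01 : 0 < y < 1 by near: y; exact: near0_lt.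
rewrite mulrBr mulrBl mulr1 (upowNl ltdN) // -!mulrA (upowNl ltdN) // mulr1 mulrA.
congr (_ * _ - _); apply: (uinv_eq ltdN); first exact: uU.
rewrite mulrA (mul_uinv ltdN) //; near: y; exact: uN.
Unshelve. all: by end_near. Qed.

Lemma Usol_estimate x U b c k : 0 <= x <= 1 -> Usol x U -> b <= 1 -> 0 <= c ->
    (forall y i j, 0 < y < b -> `|conj_U U E y i j| <= c * weight y) ->
    (forall y, 0 < y < b -> kap x y <= k) -> 0 <= k ->
  exists2 K, 0 <= K & forall x' U', 0 <= x' <= 1 -> Usol x' U' ->
    (forall y, 0 < y < b -> kap x' y <= k) ->
  forall y i j, 0 < y < b -> `|(uinv (U y) * U' y - 1) i j| <= K * `|x' - x|.
Proof.
move=> x01 sU b1 c0 WE kx k0.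
have [|K K0 KE] := small_solution ltdN b1 (_ : 0 <= k * k * c); first by rewrite !mulr_ge0.
exists K => // x' U' x'01 sU' kx' y i j yb.
have [QD nQ] := Usol_quotient x01 x'01 sU sU'.
have b01 u : 0 < u < b -> 0 < u < 1 by lra.
apply: (KE (fun y => - ((x' - x) * kap x y * kap x' y) *: conj_U U E y) (fun y => uinv (U y) * U' y)) => //.
- by rewrite normr_ge0 ler_norml; lra.
- by move=> u ub; apply: raisesZ; exact: (raises_conj_U sU (b01 _ ub) rE).
- move=> u i' j' ub; rewrite mxE normrM normrN !normrM.
  have kx0 := kap_gt0 x01 (b01 _ ub); have kx'0 := kap_gt0 x'01 (b01 _ ub).
  rewrite (gtr0_norm kx0) (gtr0_norm kx'0) -!mulrA ler_wpM2l //.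
  apply: ler_pM; [exact: ltW|by rewrite mulr_ge0 // ltW|exact: kx|].
  by apply: ler_pM; [exact: ltW|exact: normr_ge0|exact: kx'|exact: WE].
- by move=> u ub; apply: QD; exact: b01.
Qed.

(** ** The derivative of a solution with respect to x *)

Section FlatDerivative.
Variables (x : R) (U : R -> M).
Hypotheses (x01 : 0 < x < 1) (sU : Usol x U).

Let x01' : 0 <= x <= 1. Proof. by case/andP: x01 => x0 x1; rewrite !ltW. Qed.
Let P : M := x^-1 *: A + (x - 1)^-1 *: B.

(** If U g is flat, where dg/dx = (A / x + B / (x - 1)) g, then dU/dx = U J. *)
Definition flat_J y := conj_U U (omega_x x y) y - (x^-1 *: A + (x - 1)^-1 *: B).

(** By flatness, only the derivative of omega_x in y remains. *)
Lemma mder_flat_J y : 0 < y < 1 -> mder flat_J y (- kap x y ^+ 2 *: conj_U U E y).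
Proof.
move=> y01; have k0 := kap_neq0 x01' y01; have [dU _ _] := sU.
have dw : mder (omega_x x) y (- kap x y ^+ 2 *: E).
  have dk : is_derive y 1 (kap x) (x * kap x y ^+ 2).
    have dl : is_derive y 1 (fun v => 1 - x * v) (- x).
      have := is_derive_addf (is_derive_cst (1 : R) y 1) (is_derive_mulc (- x) (is_derive_id y 1)).
      by rewrite add0r mulr1; apply: is_derive_ext => v; rewrite /= mulNr.
    have -> : x * kap x y ^+ 2 = x / (1 - x * y) ^+ 2 by rewrite /kap exprVn.
    by have := @is_derive_invf (fun v => 1 - x * v) y _ k0 dl; rewrite opprK.
  have dyk := is_derive_mulf (is_derive_id y 1) dk.
  have := mderD (mder_cst P y) (mderZ (is_derive_mulc (-1) dyk) (mder_cst E y)).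
  rewrite scaler0 !add0r mulN1r.
  have -> : y * (x * kap x y ^+ 2) + 1 * kap x y = kap x y ^+ 2.
    by rewrite /kap; field.
  apply: mder_near; near=> v; rewrite /omega_x /P -scaleNr; congr (_ + _ *: _).
  by rewrite mulN1r.
have := mderD (mderM (mderM (mder_Usol_inv sU y01) dw) (dU y y01)) (mder_cst (- P) y).
apply: mder_eq; rewrite addr0 /conj_U scalerAl scalerAr.
have H (a w o Z u : M) : w * o = o * w ->
    a * w * (o * u) + (a * Z + - (a * o) * w) * u = a * Z * u.
  by move=> wo; rewrite mulrDl !mulNr -!mulrA [w * (o * u)]mulrA wo -!mulrA addrCA subrr addr0.
by apply: H; exact: omega_comm.
Unshelve. all: by end_near. Qed.

(** At y = 0 the form omega_x becomes A / x + B / (x - 1), which commutes with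
    the power y^C. *)
Lemma flat_J_negl : mnegl flat_J.
Proof.
have [dU uU nU] := sU.
have uN : \forall y \near (0 : R)^'+, unipotent (U y * upow (- C) y).
  near=> y; apply: unipotentM; last exact: (unipotent_upow ltdN).
  by apply: uU; near: y; exact: near0_lt.
have cPC : GRing.comm P C.
  apply: commr_sym; apply: commrD; rewrite /GRing.comm -scalerAl -scalerAr; congr (_ *: _).
  exact: commr_sym. exact: commr_sym.
have tN := near1_tame nU; have tNV := near1_tame (near1_uinv ltdN uN nU).
(* (1 + n)^-1 P (1 + n) - P = (1 + n)^-1 [P, n] for n negligible *)
have nNPN : mnegl (fun y => uinv (U y * upow (- C) y) *
    (P * (U y * upow (- C) y - 1) - (U y * upow (- C) y - 1) * P)).
  apply: mneglMl tNV _; apply: mneglB; first exact: mneglMl (mtame_cst P) nU.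
  exact: mneglMr nU (mtame_cst P).
have nyk : negl (fun y => - (y * kap x y)).
  apply: (@negl_bound _ _ (1 - x)^-1); near=> y.
  have y01 : 0 < y < 1 by near: y; exact: near0_lt.
  have k0 := kap_gt0 x01' y01.
  rewrite normrN ger0_norm; last by rewrite mulr_ge0 // ltW //; lra.
  have /andP[x0 x1] := x01; have /andP[y0 y1] := y01.
  rewrite [leLHS]mulrC; apply: ler_wpM2r; first exact: ltW.
  by rewrite lef_pV2 ?posrE; nra.
have nE : mnegl (fun y => - (y * kap x y) *: conj_U U E y).
  move=> i j; apply: (negl_eq _ (neglMr nyk (mtame_conj_U sU E i j))).
  by near=> y; rewrite [in RHS]mxE.
apply: (mnegl_eq _ (mneglD (mneglMr (mneglMl (mtame_upow N (- C)) nNPN) (mtame_upow N C)) nE)).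
near=> y; have y01 : 0 < y < 1 by near: y; exact: near0_lt.
have uy : unipotent (U y * upow (- C) y) by near: y; exact: uN.
have UE : U y = (U y * upow (- C) y) * upow C y by rewrite -mulrA (upowNl ltdN) // mulr1.
have VE : uinv (U y) = upow (- C) y * uinv (U y * upow (- C) y).
  by apply/esym/(uinv_eq ltdN); [exact: uU|rewrite mulrA (mul_uinv ltdN)].
have PU : upow (- C) y * P * upow C y = P.
  by rewrite -mulrA (comm_upow _ _ cPC) mulrA (upowNl ltdN) // mul1r.
have -> (m : M) : P * (m - 1) - (m - 1) * P = P * m - m * P.
  by rewrite mulrBr mulrBl mulr1 mul1r opprB addrA subrK.
rewrite /flat_J /omega_x -/P /conj_U [in RHS]mulrBr [in RHS]mulrBl addrAC.
congr (_ + _); last by rewrite -scalerAr -scalerAl scaleNr.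
have H (a b m v : M) : v * m = 1 ->
    a * (v * (P * m - m * P)) * b = a * v * P * (m * b) - a * P * b.
  by move=> vm; rewrite mulrBr mulrBr mulrBl [v * (m * P)]mulrA vm mul1r !mulrA.
by rewrite H ?(uinv_mul ltdN) // -UE -VE PU.
Unshelve. all: by end_near. Qed.

(** U' = U (1 + (x' - x) J + O((x' - x)^2)): both sides have the same derivative
    in y up to second order. This replaces the differentiability of U in the
    parameter x. *)
Lemma Usol_estimate2 b c k : b <= 1 -> 0 <= c ->
    (forall y i j, 0 < y < b -> `|conj_U U E y i j| <= c * weight y) ->
    (forall y, 0 < y < b -> kap x y <= k) -> 0 <= k ->
  exists2 K, 0 <= K & forall x' U', 0 <= x' <= 1 -> Usol x' U' ->
    (forall y, 0 < y < b -> kap x' y <= k) ->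
  forall y i j, 0 < y < b ->
  `|(uinv (U y) * U' y - 1 - (x' - x) *: flat_J y) i j| <= K * `|x' - x| ^+ 2.
Proof.
move=> b1 c0 WE kx k0; have [K K0 KE] := Usol_estimate x01' sU b1 c0 WE kx k0.
(* The derivative of Q - 1 - h J is - h kap(x) W (kap(x') Q - kap(x)), where
   kap(x') Q - kap(x) = kap(x') (Q - 1) + (kap(x') - kap(x)) is O(h). *)
pose K' := k * (n.+1%:R * c * (k * K + k * k)).
have K'0 : 0 <= K' by rewrite !mulr_ge0 // addr_ge0 ?mulr_ge0.
exists (K' * 4) => [|x' U' x'01 sU' kx' y i j yb]; first by rewrite mulr_ge0.
have b01 u : 0 < u < b -> 0 < u < 1 by lra.
have [QD nQ] := Usol_quotient x01' x'01 sU sU'.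
have QE := KE x' U' x'01 sU' kx'; set h := x' - x in QD QE *.
set Q := fun y => uinv (U y) * U' y in QD nQ QE.
apply: (@le_trans _ _ (K' * `|h| ^+ 2 * weight_int y)); last first.
  rewrite [leRHS]mulrAC; apply: ler_wpM2l; last exact: weight_int_le (b01 _ yb).
  by rewrite mulr_ge0.
move: y yb; apply: (@le_of_derive _ b (fun y => (Q y - 1 - h *: flat_J y) i j)
  (fun y => (- (h * kap x y) *: (conj_U U E y * (kap x' y *: Q y - kap x y *: 1))) i j)
  (fun y => K' * `|h| ^+ 2 * weight_int y) (fun y => K' * `|h| ^+ 2 * weight y)).
- move=> u ub; have u01 := b01 _ ub.
  have JD := mderZ (is_derive_cst (- h : R) u 1) (mder_flat_J u01).
  have := mderD (mderD (QD u u01) (mder_cst (-1) u)) JD.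
  rewrite addr0 scale0r addr0 => /(_ i j) GD.
  apply: (is_derive_ext _ (_ : is_derive u 1 _ _)); last first.
    apply: is_derive_eq GD _; congr (fun_of_matrix _ i j).
    rewrite mulrBr -!scalerAr mulr1 -scalerAl -/(Q u).
    move: (conj_U U E u) => W; rewrite /=; move: (W * Q u) => WQ.
    by apply/matrixP => i' j'; rewrite !mxE; ring.
  by move=> v; rewrite /= scaleNr.
- by move=> u ub; apply: is_derive_mulc; exact: weight_intD (b01 _ ub).
- move=> u ub; have u01 := b01 _ ub; have kx0 := kap_gt0 x01' u01.
  have kx'0 := kap_gt0 x'01 u01.
  rewrite [X in `|X|]mxE mxE normrM normrN normrM (gtr0_norm kx0).
  have -> : K' * `|h| ^+ 2 * weight u =
      `|h| * k * (\sum_(l < n.+1) c * weight u * (k * (K * `|h|) + k * k * `|h|)).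
    by rewrite sumr_const card_ord -mulr_natr /K'; ring.
  apply: ler_pM => //; first by rewrite mulr_ge0 // ltW.
    by rewrite ler_wpM2l // kx.
  apply: (le_trans (ler_norm_sum _ _ _)); apply: ler_sum => l _; rewrite normrM.
  apply: ler_pM => //; first exact: WE.
  have -> : (kap x' u *: Q u - kap x u *: 1) l j =
      kap x' u * (Q u - 1) l j + (kap x' u - kap x u) * (1 : M) l j.
    rewrite !mxE; case: eqP => _; ring.
  apply: (le_trans (ler_normD _ _)); apply: lerD; rewrite normrM.
    by apply: ler_pM => //; [rewrite gtr0_norm // kx'|exact: QE].
  have -> : kap x' u - kap x u = kap x u * kap x' u * (u * h).
    by rewrite /kap /h; field; rewrite !kap_neq0.
  have /andP[u0 u1] := u01.
  rewrite -[leRHS]mulr1; apply: ler_pM => //.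
    rewrite normrM; apply: ler_pM => //.
      rewrite normrM (gtr0_norm kx0) (gtr0_norm kx'0).
      by apply: ler_pM; [exact: ltW|exact: ltW|exact: kx|exact: kx'].
    by rewrite normrM (gtr0_norm u0) ler_piMl // ltW.
  by rewrite mxE; case: eqP => _; rewrite ?normr1 ?normr0.
- apply: negl_cvg; have nJ := mneglZ (tame_cst (- h)) flat_J_negl.
  have := mneglD nQ nJ; move=> /(_ i j); apply: negl_eq; near=> u.
  by rewrite scaleNr.
- by rewrite -[X in _ --> X](mulr0 (K' * `|h| ^+ 2)); apply: cvgMr; exact: weight_int0.
Unshelve. all: by end_near. Qed.

End FlatDerivative.

(** ** Restriction of the flat sections to the hyperbola y = 1 / (1 + x) *)

(** Solve for the quotient by the section over x = 0, whose equation has a tame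
    coefficient. *)
Lemma Usol_exists x U0 : 0 <= x <= 1 -> Usol 0 U0 -> exists U, Usol x U.
Proof.
move=> x01 sU; have [dU uU nU] := sU.
have [y y01|y y01||Q [QD uQ nQ]] := @linear_equation_exists _ _ d N ltdN
    (fun y => - (x * kap x y) *: conj_U U0 E y).
- by apply: raisesZ; exact: (raises_conj_U sU y01 rE).
- apply: (mcontZ (c := fun y => - (x * kap x y)) _ (mcont_conj_U sU y01)).
  rewrite /prop_for /continuous_at; apply: cvgN; apply: cvgMr.
  have k0 := kap_neq0 x01 y01.
  apply: (cvgV (f := fun v => 1 - x * v) k0).
  by apply: cvgB; [exact: cvg_cst|apply: cvgMr; exact: cvg_id].
- move=> i j; apply: (@tame_eq _ (fun y => - (x * kap x y) * conj_U U0 E y i j)).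
    by near=> y; rewrite [in RHS]mxE.
  apply: tameM (mtame_conj_U sU E i j); apply: (@tame_bounded _ _ 2); near=> y.
  have y12 : 0 < y < 2^-1 by near: y; apply: near0_lt; lra.
  have y01 : 0 < y < 1 by lra.
  have k0 := kap_gt0 x01 y01; have /andP[x0 x1] := x01; have /andP[y0 y2] := y12.
  rewrite normrN normrM (gtr0_norm k0) ger0_norm //.
  apply: (@le_trans _ _ (1 * kap x y)); first by rewrite ler_wpM2r // ltW.
  by rewrite mul1r -[leRHS]invrK lef_pV2 ?posrE; [nra|nra|lra].
exists (fun y => U0 y * Q y); split=> [y y01|y y01|].
- apply: mder_eq (mderM (dU y y01) (QD y y01)).
  rewrite /conj_U -!scalerAl -scalerAr -!mulrA [U0 y * (uinv (U0 y) * _)]mulrA (Usol_K sU y01).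
  rewrite mul1r addrC scalerAl -mulrDl; congr (_ * _).
  by rewrite /omega_y mul0r scale0r subr0 scaleNr.
- by apply: unipotentM; [exact: uU|exact: uQ].
apply: (mnegl_eq _ (mneglD (mneglMr (mneglMl (Usol_tame sU) nQ) (mtame_upow N (- C))) nU)).
by near=> y; rewrite mulrBr mulrBl mulr1 addrA subrK.
Unshelve. all: by end_near. Qed.

Lemma is_derive_quadratic (e : R -> R) u (k : R) :
  (\forall v \near u, `|e v| <= k * (v - u) ^+ 2) -> is_derive u 1 e 0.
Proof.
move=> ek; have eu : e u = 0.
  have := nbhs_singleton ek; rewrite subrr expr0n mulr0 => /=.
  by rewrite normr_le0 => /eqP.
suff H : h^-1 *: ((e \o shift u) (h *: 1) - e u) @[h --> (0 : R)^'] --> (0 : R).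
  by apply: DeriveDef; [exact: (cvgP _ H)|exact: (cvg_lim _ H)].
have [r /= r0 er] := (nbhs_ballP _ _).1 ek.
apply/cvgr0Pnorm_le => eps eps0.
have k0 : 0 < `|k| + 1 by rewrite ltr_wpDl.
near=> h; have h0 : h != 0 by near: h; exact: nbhs_dnbhs_neq.
have hr : `|h| < r by near: h; exact: dnbhs0_lt.
have he : `|h| < eps / (`|k| + 1) by near: h; apply: dnbhs0_lt; rewrite divr_gt0.
have /er : ball u r (h + u) by rewrite /ball /= [h + u]addrC opprD addrA subrr sub0r normrN.
rewrite addrK eu subr0 /= [h *: _]mulr1 normrM normfV => /= ehu.
rewrite ler_pdivrMl ?normr_gt0 //; apply: (le_trans ehu).
rewrite -real_normK ?num_real // expr2 mulrA [leRHS]mulrC.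
apply: ler_wpM2r => //; apply: (@le_trans _ _ (`|h| * (`|k| + 1))).
  rewrite mulrC ler_wpM2l // (le_trans (ler_norm k)) // lerDl //.
by rewrite -ler_pdivlMr // ltW.
Unshelve. all: by end_near. Qed.

Section Hyperbola.
Variable U : R -> R -> M.
Hypothesis sU : forall x, 0 <= x <= 1 -> Usol x (U x).

Definition hyp (z : R) : R := (1 + z)^-1.

Lemma hyp_01 (z : R) : 0 < z < 1 -> 2^-1 < hyp z < 1.
Proof.
move=> z01; rewrite /hyp invf_lt1 ?ltf_pV2 ?posrE; lra.
Qed.

Lemma is_derive_hyp (z : R) : 1 + z != 0 -> is_derive z 1 hyp (- hyp z ^+ 2).
Proof.
move=> z0; have := is_derive_invf z0 (is_derive_addf (is_derive_cst (1 : R) z 1) (is_derive_id z 1)).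
by rewrite add0r mulN1r -exprVn.
Qed.

(** The chain rule along the hyperbola, with [Usol_estimate2] for the variation
    of x. *)
Lemma mder_hyperbola z : 0 < z < 1 -> mder (fun x => U x (hyp x)) z
  ((omega_x z (hyp z) - hyp z ^+ 2 *: omega_y z (hyp z)) * U z (hyp z)
   - U z (hyp z) * (z^-1 *: A + (z - 1)^-1 *: B)).
Proof.
move=> z01; have z01' : 0 <= z <= 1 by have /andP[? ?] := z01; rewrite !ltW.
have sz := sU z01'; have [dU uU _] := sz.
have y01 : 0 < hyp z < 1 by have := hyp_01 z01; lra.
(* The estimates are used for y < b, away from the pole at y = 1. *)
pose b := (1 + hyp z) / 2; have b01 : 0 < b < 1 by rewrite /b; lra.
have yb : 0 < hyp z < b by rewrite /b; lra.
have [c c0 WE] := mdominated_conj_U sz E b01.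
pose k := (1 - b)^-1; have k0 : 0 <= k by rewrite invr_ge0; lra.
have kE x y : 0 <= x <= 1 -> 0 < y < b -> kap x y <= k.
  move=> /andP[x0 x1] /andP[y0 yb']; have /andP[b0 b1] := b01.
  by rewrite lef_pV2 ?posrE; nra.
have [|K K0 KE] := Usol_estimate2 z01 sz _ c0 WE (fun y yb => kE z y z01' yb) k0.
  by lra.
pose q x := uinv (U z (hyp x)) * U x (hyp x).
have dhyp : is_derive z 1 hyp (- hyp z ^+ 2) by apply: is_derive_hyp; apply/eqP; lra.
have hypb : \forall x \near z, 0 < x < 1 /\ 0 < hyp x < b.
  near=> x; split; first by near: x; exact: near_01.
  have : hyp x < b.
    near: x; have /andP[_ hb] := yb.
    exact: (is_derive_continuous dhyp (lt_nbhsl hb)).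
  have : 0 < hyp x.
    near: x; have /andP[h0 _] := yb.
    exact: (is_derive_continuous dhyp (lt_nbhsr h0)).
  by move=> -> ->.
have dJ := mder_comp dhyp (mder_flat_J z01 sz y01).
have dq : mder q z (flat_J z (U z) (hyp z)).
  move=> i j.
  have e0 : is_derive z 1
      (fun x => (q x - 1 - (x - z) *: flat_J z (U z) (hyp x)) i j) 0.
    apply: (@is_derive_quadratic _ _ K); near=> x.
    have [x01 xb] : 0 < x < 1 /\ 0 < hyp x < b by near: x; exact: hypb.
    have x01' : 0 <= x <= 1 by have /andP[? ?] := x01; rewrite !ltW.
    rewrite -real_normK ?num_real //.
    by apply: (KE x (U x) x01' (sU x01')) => // y; exact: kE.
  have dxz : is_derive z 1 (fun x => x - z) 1.
    have := is_derive_addf (is_derive_id z 1) (is_derive_cst (- z) z 1).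
    by rewrite addr0.
  have := is_derive_addf (is_derive_addf e0 (is_derive_mulf dxz (dJ i j))) (is_derive_cst ((1 : M) i j) z 1).
  rewrite subrr mul0r !add0r mul1r addr0; apply: is_derive_ext => x.
  by rewrite !mxE subrK subrK.
have := mderM (mder_comp dhyp (dU _ y01)) dq.
have -> : q z = 1 by rewrite /q (Usol_V sz).
rewrite mulr1 /flat_J /conj_U mulrBr !mulrA (Usol_K sz) // mul1r addrC => H.
apply: mder_near (mder_eq _ H).
  near=> x; rewrite /q mulrA (Usol_K sz) ?mul1r //.
  have [_ +] : 0 < x < 1 /\ 0 < hyp x < b by near: x; exact: hypb.
  by move: b01; lra.
rewrite [(omega_x _ _ - _) * _]mulrBl -[_ *: omega_y _ _ * _]scalerAl scaleNr addrA.
by congr (_ + _); exact: addrC.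
Unshelve. all: by end_near. Qed.

End Hyperbola.

(** ** Comparison of the asymptotics at both ends of the hyperbola *)

Lemma meqvM (f f' g g' : R -> M) :
    mnegl (fun u => f u - f' u) -> mnegl (fun u => g u - g' u) -> mtame f' -> mtame g ->
  mnegl (fun u => f u * g u - f' u * g' u).
Proof.
move=> nf ng tf' tg; apply: (mnegl_eq _ (mneglD (mneglMr nf tg) (mneglMl tf' ng))).
by near=> u; rewrite mulrBl mulrBr addrA subrK.
Unshelve. all: by end_near. Qed.

Lemma mnegl_of_mder0 (f : R -> M) X : mder f 0 X -> mnegl (fun u => f u - f 0).
Proof.
move=> fd i j; have [dfd dfE] := fd i j.
have := cvg_dnbhs_at_right dfd; rewrite -/(derive _ _ _) dfE => H.
apply: (tame_eq _ (tame_cvg H)); near=> u.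
by rewrite /= [u%:A]mulr1 addr0 !mxE /GRing.scale /= mulrC.
Unshelve. all: by end_near. Qed.

Lemma near1_upow (phi : R -> R) (dphi : R) (X : M) : is_derive (0 : R) (1 : R) phi dphi -> phi 0 = 1 ->
  raises d 1 X -> near1 (fun u => upow X (phi u)).
Proof.
move=> dp p0 rX; have p1 : 0 < phi 0 by rewrite p0.
have := mnegl_of_mder0 (mder_comp dp (mder_upow ltdN rX p1)).
by rewrite p0 (upow1 ltdN).
Qed.

Lemma comm_ev2 (f : ncseries R 'I_2) (X A' B' : M) : GRing.comm X A' -> GRing.comm X B' -> GRing.comm X (ev2 N f A' B').
Proof.
by move=> cXA cXB; apply: comm_evn => a; rewrite (tnth_nth 0); case: a => [[|[|]]].
Qed.

Section Twisted.
Variables (X Y : M) (g : R -> ncseries R 'I_2).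
Hypotheses (rX : raises d 1 X) (rY : raises d 1 Y) (cXC : GRing.comm X C) (cXY : GRing.comm X Y).
Hypotheses (sg : KZ_solution (@KZ_rate R) g)
  (lg : nc_lim 0^'+ (fun u => g u * letter_pow (inord 0) u) 1)
  (g1 : forall u, 0 < u < 1 -> g u [::] = 1).

(** The section over the sides x = 0 and x = 1, with X = A, Y = D and with X =
    B, Y = D + E: the two equations have Y as residue at y = 1, and X commutes
    with C and Y, so that the factor y^X corrects the residue at 0. *)
Definition twisted y := ev2 N (g y) (C - X) Y * upow X y.

Let rCX : raises d 1 (C - X). Proof. exact: raisesB. Qed.

Lemma comm_twist f : GRing.comm X (ev2 N f (C - X) Y).
Proof. by apply: comm_ev2 => //; apply: commrB. Qed.

Lemma mder_twisted y : 0 < y < 1 ->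
  mder twisted y ((y^-1 *: C + (y - 1)^-1 *: Y) * twisted y).
Proof.
move=> y01; have y0 : 0 < y by lra.
apply: mder_eq (mderM (mder_ev2 ltdN rCX rY sg y01) (mder_upow ltdN rX y0)).
rewrite -scalerAr mulrA -comm_twist -[X * _ * _]mulrA scalerAl -[X in _ + X]mulrA -mulrDl.
by congr (_ * _); rewrite addrA -scalerDr [X + _]addrC subrK.
Qed.

Lemma unipotent_twisted y : 0 < y < 1 -> unipotent (twisted y).
Proof.
move=> y01; apply: unipotentM; last exact: (unipotent_upow ltdN).
by apply: (unipotent_ev2 ltdN) => //; exact: g1.
Qed.

Lemma twisted_at0 : near1 (fun y => twisted y * upow (- C) y).
Proof.
apply: (mnegl_eq _ (ev2_at0 ltdN rCX rY sg lg)); near=> y; congr (_ - _).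
rewrite /twisted -mulrA; congr (_ * _).
have -> : - (C - X) = X + - C by rewrite opprB.
rewrite (upowD ltdN) //; exact: commrN.
Unshelve. all: by end_near. Qed.

End Twisted.

Section Comparison.
Variable Z : M.
Hypotheses (rZ : raises d 1 Z) (cZA : GRing.comm Z A) (cZB : GRing.comm Z B)
  (cZC : GRing.comm Z C) (cZD : GRing.comm Z D) (cZE : GRing.comm Z E).
Local Notation F := (Z - C - D - E).
Variables (phi : ncseries R 'I_2) (g0 g1 : R -> ncseries R 'I_2).
Hypothesis phi_assoc : real_assoc (@KZ_rate R) (inord 0) (inord 1) phi g0 g1.
Variables (k0 : R -> ncseries R 'I_2).
Hypotheses (sk0 : KZ_solution (@KZ_rate R) k0)
  (lk0 : nc_lim 0^'+ (fun u => k0 u * letter_pow (inord 0) u) 1)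
  (k01 : forall u, 0 < u < 1 -> k0 u [::] = 1).
Variables (psi : ncseries R 'I_3) (h0 h1 : R -> ncseries R 'I_3).
Hypothesis psi_assoc : real_assoc (@KZ2_rate R) (inord 0) (inord 1) psi h0 h1.

Let cDEC : GRing.comm B (D + E). Proof. exact: commr_sym. Qed.
Let rDE : raises d 1 (D + E). Proof. exact: raisesD. Qed.
Let rAD : raises d 1 (A + D). Proof. exact: raisesD. Qed.
Let rCA : raises d 1 (C - A). Proof. exact: raisesB. Qed.
Let rF : raises d 1 F. Proof. by do 3!apply: raisesB => //. Qed.

Lemma Usol_twisted0 : Usol 0 (twisted A D g0).
Proof.
have [sg0 _ lg0 _ g01] := phi_assoc.
have g0_1 u : 0 < u < 1 -> g0 u [::] = 1 by move=> /g01[].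
split=> [y y01|y y01|]; first 1 last.
- exact: unipotent_twisted.
- exact: twisted_at0.
rewrite /omega_y mul0r scale0r subr0; exact: mder_twisted.
Qed.

Lemma Usol_twisted1 : Usol 1 (twisted B (D + E) k0).
Proof.
split=> [y y01|y y01|]; first 1 last.
- exact: unipotent_twisted.
- exact: twisted_at0.
have -> : omega_y 1 y = y^-1 *: C + (y - 1)^-1 *: (D + E).
  by rewrite /omega_y /kap !mul1r scalerDr addrA -[1 - y]opprB invrN scaleNr opprK.
exact: mder_twisted.
Qed.

Lemma Usol_family : exists U : R -> R -> M, forall x, 0 <= x <= 1 -> Usol x (U x).
Proof.
have /choice[U UE] (x : R) : exists Ux, 0 <= x <= 1 -> Usol x Ux.
  have [x01|] := boolP (0 <= x <= 1); last by exists (fun=> 0).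
  by have [Ux UxE] := Usol_exists x01 Usol_twisted0; exists Ux.
by exists U.
Qed.

(** The connection form on the hyperbola, with residue t14 - Z at -1 *)
Definition hyp_form (z : R) : M :=
  z^-1 *: (A + D) + (z - 1)^-1 *: B + (z + 1)^-1 *: - (C + D + E).

Lemma omega_hyp z : 0 < z < 1 ->
  omega_x z (hyp z) - hyp z ^+ 2 *: omega_y z (hyp z) = hyp_form z.
Proof.
move=> z01; have z0 : z != 0 by apply/eqP; lra.
have z1 : z - 1 != 0 by apply/eqP; lra.
have z2 : 1 + z != 0 by apply/eqP; lra.
apply/matrixP => i j; rewrite /omega_x /omega_y /hyp_form /kap /hyp !mxE.
by field; apply/and5P; split; apply/eqP; lra.
Qed.

(** The factor (1 + z)^(-Z), Z being central, changes the residue F at -1 into F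
    - Z. *)
Definition hyp_psi z := upow (- Z) (1 + z) * ev3 N (h0 z) (A + D) B F.

Lemma mder_hyp_psi z : 0 < z < 1 -> mder hyp_psi z (hyp_form z * hyp_psi z).
Proof.
move=> z01; have [sh0 _ _ _ _] := psi_assoc; have rNZ := raisesN rZ.
have z1 : 0 < 1 + z by lra.
have dz : is_derive z 1 (fun v : R => 1 + v) 1.
  by have := is_derive_addf (is_derive_cst (1 : R) z 1) (is_derive_id z 1); rewrite add0r.
apply: mder_eq (mderM (mder_comp dz (mder_upow ltdN rNZ z1)) (mder_ev3 ltdN rAD rB rF sh0 z01)).
have cZ X : GRing.comm Z X -> GRing.comm (upow (- Z) (1 + z)) X.
  by move=> cZX; apply/commr_sym/comm_upow/commrN/commr_sym.
have cZF : GRing.comm Z F by do 3!apply: commrB => //.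
rewrite scale1r /hyp_psi [upow _ _ * (_ * _)]mulrA (cZ (_ + _ + _)); last first.
  have cZAD : GRing.comm Z (A + D) by exact: commrD.
  apply: commrD; last exact: comm_scale cZF.
  by apply: commrD; [exact: comm_scale cZAD|exact: comm_scale cZB].
rewrite scalerAl -mulrA -mulrA -mulrDl; congr (_ * _).
by apply/matrixP => i j; rewrite /hyp_form !mxE [1 + z]addrC; ring.
Qed.

(** The quotient of two solutions of the same equation has derivative 0. *)
Lemma hyp_psi_right_multiple (T : R -> M) :
    (forall z, 0 < z < 1 -> mder T z (hyp_form z * T z)) ->
  exists c : M, forall z : R, 0 < z < 1 -> T z = hyp_psi z * c.
Proof.
move=> dT; have [_ _ _ _ h01] := psi_assoc.
have uS z : 0 < z < 1 -> unipotent (hyp_psi z).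
  move=> z01; apply: unipotentM; first by apply: (unipotent_upow ltdN); exact: raisesN.
  by apply: (unipotent_ev3 ltdN) => //; have [] := h01 z z01.
exists (uinv (hyp_psi 2^-1) * T 2^-1) => z z01.
have half : 0 < (2^-1 : R) < 1 by lra.
rewrite (@mder_0_const _ _ (fun w => uinv (hyp_psi w) * T w) 2^-1 z) //.
  by rewrite mulrA (mul_uinv ltdN) ?mul1r //; exact: uS.
move=> w w01; have dS := mder_hyp_psi w01.
have uSw : \forall v \near w, unipotent (hyp_psi v).
  by near=> v; apply: uS; near: v; exact: near_01.
apply: mder_eq (mderM (mder_uinv ltdN uSw dS) (dT w w01)).
have H (v s t o : M) : s * v = 1 -> v * (o * t) + - (v * (o * s) * v) * t = 0.
  by move=> sv; rewrite mulNr -!mulrA [s * _]mulrA sv mul1r subrr.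
by apply: H; apply: (mul_uinv ltdN); exact: uS.
Unshelve. all: by end_near. Qed.

Section Ends.
Variable U : R -> R -> M.
Hypothesis sU : forall x, 0 <= x <= 1 -> Usol x (U x).

(** The restriction to the hyperbola of the flat section: the section over x = z
    times the section over y = 0 *)
Definition hyp_square z := U z (hyp z) * ev2 N (g0 z) A B.

Lemma mder_hyp_square z : 0 < z < 1 -> mder hyp_square z (hyp_form z * hyp_square z).
Proof.
move=> z01; have [sg0 _ _ _ _] := phi_assoc.
apply: mder_eq (mderM (mder_hyperbola sU z01) (mder_ev2 ltdN rA rB sg0 z01)).
rewrite omega_hyp // /hyp_square [X in _ + X]mulrBl addrC -!mulrA subrK //.
Qed.



Lemma mnegl_refl (f : R -> M) : mnegl (fun u => f u - f u).
Proof. by apply: (mnegl_eq _ (@mnegl0 _ _)); near=> u; rewrite subrr.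
Unshelve. all: by end_near. Qed.

Lemma near1_absorb (f X : R -> M) : mtame f -> near1 X -> mnegl (fun u => f u * X u - f u).
Proof.
move=> tf nX; apply: (mnegl_eq _ (mneglMl tf nX)).
by near=> u; rewrite mulrBr mulr1.
Unshelve. all: by end_near. Qed.

Lemma hyp_comp z : 0 < z < 1 -> 2^-1 * z ^+ 1 <= 1 - hyp z <= z.
Proof.
move=> z01; have -> : 1 - hyp z = z * hyp z by rewrite /hyp; field; apply/eqP; lra.
have /andP[hz0 hz1] := hyp_01 z01; have /andP[z0 z1] := z01.
by rewrite expr1 mulrC; apply/andP; split; nra.
Qed.

Lemma mnegl_hyp (f : R -> M) : mnegl f -> mnegl (fun z => f (1 - hyp z)).
Proof.
move=> nf i j.
have hc : \forall z \near (0 : R)^'+, 2^-1 * z ^+ 1 <= 1 - hyp z <= z.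
  by near=> z; apply: hyp_comp; near: z; exact: near0_lt.
have c0 : 0 < (2^-1 : R) by lra.
have tv : tame (fun z : R => (1 - hyp z) / z).
  apply: (@tame_bounded _ _ 1); near=> z; have z01 : 0 < z < 1 by near: z; exact: near0_lt.
  have /andP[v0 vz] := hyp_comp z01; have /andP[z0 z1] := z01.
  rewrite normrM normfV (gtr0_norm z0) ler_pdivrMr // mul1r ger0_norm //.
  by apply: le_trans v0; rewrite mulr_ge0 // expr1 ltW.
apply: (tame_eq _ (tameM (tame_comp c0 hc (nf i j)) tv)); near=> z.
have z01 : 0 < z < 1 by near: z; exact: near0_lt.
have /andP[v0 vz] := hyp_comp z01; have /andP[z0 z1] := z01.
have v1 : 1 - hyp z != 0 by rewrite gt_eqF // (lt_le_trans _ v0) // expr1 mulr_gt0.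
by rewrite mulrA divfK.
Unshelve. all: by end_near. Qed.

Let PhiAB := ev2 N phi A B.
Let PhiCD := ev2 N phi (C - A) D.
Let U0 := twisted A D g0.

Lemma twisted0E y : 0 < y < 1 -> U0 y = ev2 N (g1 y) (C - A) D * PhiCD * upow A y.
Proof.
move=> y01; have [_ _ _ _ /(_ y y01) [_ _ gE]] := phi_assoc.
by rewrite /U0 /twisted -gE (ev2M ltdN).
Qed.

Let rate1 : near1 (fun u => ev2 N (g1 (1 - u)) (C - A) D * upow (- D) u).
Proof. by have [_ sg1 _ lg1 _] := phi_assoc; exact: (ev2_at1 ltdN rCA rD sg1 lg1). Qed.

Lemma mtame_twisted0_at1 : mtame (fun u => U0 (1 - u)).
Proof.
have t1 := mtameM (near1_tame rate1) (mtame_upow N D).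
have d1 : is_derive (0 : R) (1 : R) (fun u : R => 1 - u) (-1).
  by have := is_deriveB (is_derive_cst (1 : R) (0 : R) 1) (is_derive_id (0 : R) 1); rewrite sub0r.
have t2 : mtame (fun u => upow A (1 - u)).
  by apply: near1_tame; apply: (near1_upow d1) => //; rewrite subr0.
apply: (mtame_eq _ (mtameM (mtameM t1 (mtame_cst PhiCD)) t2)); near=> u.
have u01 : 0 < 1 - u < 1.
  have : 0 < u < 1 by near: u; exact: near0_lt.
  lra.
by rewrite twisted0E // -[ev2 _ _ _ _ * _ * upow D u]mulrA (upowNl ltdN) // mulr1.
Unshelve. all: by end_near. Qed.

Lemma mdominated_conj_twisted0 : mdominated 1 (conj_U U0 E).
Proof.
apply: mdominatedP => // i j; apply: dominated_01.
- by move=> u u01; exact: (mcont_conj_U Usol_twisted0).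
- exact: (mtame_conj_U Usol_twisted0).
have tU := mtame_twisted0_at1.
exact: (mtameM (mtameM (mtame_uinv N tU) (mtame_cst E)) tU).
Qed.

(** The estimate is uniform up to y = 1, because the section over x = 0 is tame
    at both ends. *)
Lemma near1_twisted0 : near1 (fun z => uinv (U0 (hyp z)) * U z (hyp z)).
Proof.
have [c c0 WE] := mdominated_conj_twisted0; have x0 : 0 <= (0 : R) <= 1 by rewrite lexx ler01.
have kx y : 0 < y < 1 -> kap 0 y <= 2 by rewrite /kap mul0r subr0 invr1; lra.
have [K K0 KE] := Usol_estimate x0 Usol_twisted0 (lexx 1) c0 WE kx (ler0n R 2).
move=> i j; apply: (@negl_bound _ _ K); near=> z.
have z12 : 0 < z < 2^-1 by near: z; apply: near0_lt; lra.
have z01 : 0 < z < 1 by lra.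
have z01' : 0 <= z <= 1 by have /andP[? ?] := z01; rewrite !ltW.
have y01 : 0 < hyp z < 1 by have := hyp_01 z01; lra.
have /andP[z0 _] := z12.
have kz y : 0 < y < 1 -> kap z y <= 2.
  by move=> /andP[y0 y1]; rewrite -[leRHS]invrK lef_pV2 ?posrE; nra.
by have := KE z (U z) z01' (sU z01') kz (hyp z) i j y01; rewrite subr0 (gtr0_norm z0).
Unshelve. all: by end_near. Qed.

(** At the end (0, 1) of the hyperbola, with v = 1 - y = z y: the section over x
    = 0 is v^D Phi(C - A, D) y^A up to factors close to 1, and the section over
    y = 0 is close to z^A, so that the product is close to z^(A + D) Phi(C - A,
    D). *)
Lemma hyp_match_at0 (c : M) : (forall z, 0 < z < 1 -> hyp_square z = hyp_psi z * c) -> c = PhiCD.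
Proof.
move=> TE; have [sg0 _ lg0 _ g01] := phi_assoc; have [sh0 _ lh0 _ h01] := psi_assoc.
have rNZ := raisesN rZ; have rNAD := raisesN rAD.
have M2 := ev2_at0 ltdN rA rB sg0 lg0; have M3 := ev3_at0 ltdN rAD rB rF sh0 lh0.
have M1 := mnegl_hyp rate1.
have d1 : is_derive (0 : R) (1 : R) (fun z => 1 + z) 1.
  by have := is_derive_addf (is_derive_cst (1 : R) (0 : R) 1) (is_derive_id (0 : R) 1); rewrite add0r.
have n1 : near1 (fun z => upow Z (1 + z)) by apply: (near1_upow d1) => //; rewrite addr0.
have dh : is_derive (0 : R) (1 : R) hyp (- hyp 0 ^+ 2).
  by apply: is_derive_hyp; rewrite addr0 oner_eq0.
have hyp0 : hyp 0 = 1 by rewrite /hyp addr0 invr1.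
have nA := near1_upow dh hyp0 rA; have nD := near1_upow dh hyp0 rD.
have u3 : \forall z \near (0 : R)^'+, unipotent (ev3 N (h0 z) (A + D) B F * upow (- (A + D)) z).
  near=> z; apply: unipotentM; last exact: (unipotent_upow ltdN).
  apply: (unipotent_ev3 ltdN) => //.
  have z01 : 0 < z < 1 by near: z; exact: near0_lt.
  by have [] := h01 z z01.
have X1 := near1M (near1M (near1_uinv ltdN u3 M3) n1) M1.
have X3 := near1M (near1M nA near1_twisted0) M2.
(* The factors close to 1 are removed group by group. *)
have E1 := meqvM (near1_absorb (mtame_upow N (- (A + D))) X1)
  (near1_absorb (mtame_upow N D) nD) (mtame_upow N _) (mtameM (mtame_upow N D) (near1_tame nD)).
have E2 := meqvM (near1_absorb (mtame_cst PhiCD) X3) (mnegl_refl (upow A)) (mtame_cst PhiCD) (mtame_upow N A).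
have E3 := meqvM E1 E2 (mtameM (mtame_upow N _) (mtame_upow N D))
  (mtameM (mtameM (mtame_cst PhiCD) (near1_tame X3)) (mtame_upow N A)).
apply/eqP; rewrite -subr_eq0; apply/eqP; apply: mnegl_cst.
apply: (mnegl_eq _ E3); near=> z; have z01 : 0 < z < 1 by near: z; exact: near0_lt.
have y01 : 0 < hyp z < 1 by have := hyp_01 z01; lra.
have /andP[z0 _] := z01; have /andP[y0 _] := y01.
have u3z : unipotent (ev3 N (h0 z) (A + D) B F * upow (- (A + D)) z) by near: z; exact: u3.
congr (_ - _).
  (* s and s', P and p', dd are the powers of z, 1 + z and 1 - y; m1, m2, m3 are
     the three solutions normalized by such powers *)
  have H (s' s um3 m3 p' P m1 dd Phi ay q m2 az e3 G1 G0 UU U0y c' : M) :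
      s' * s = 1 -> um3 * m3 = 1 -> p' * P = 1 -> m1 * dd = G1 -> m2 * az = G0 ->
      U0y = G1 * Phi * ay -> U0y * q = UU -> e3 = m3 * s -> UU * G0 = P * e3 * c' ->
    s' * (um3 * p' * m1) * dd * (Phi * (ay * q * m2) * az) = c'.
    move=> s's um pP m1d m2a UE qE eE TE'.
    transitivity (s' * um3 * p' * (((m1 * dd) * Phi * ay) * q * (m2 * az))); first by rewrite !mulrA.
    rewrite m1d m2a -UE qE TE' eE !mulrA -[s' * um3 * p' * P]mulrA pP mulr1.
    by rewrite -[s' * um3 * m3]mulrA um mulr1 s's mul1r.
  apply: (H _ (upow (A + D) z) _ _ _ (upow (- Z) (1 + z)) _ _ _ _ _ _ _
    (ev3 N (h0 z) (A + D) B F) (ev2 N (g1 (hyp z)) (C - A) D) (ev2 N (g0 z) A B)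
    (U z (hyp z)) (U0 (hyp z))) => //.
  - exact: (upowNl ltdN).
  - exact: (uinv_mul ltdN).
  - exact: (upowNr ltdN).
  - rewrite -(upowM ltdN) // subKr -mulrA.
    have -> : 1 - hyp z = z * hyp z by rewrite /hyp; field; apply/eqP; lra.
    by rewrite (upowNl ltdN) // mulr1.
  - by rewrite -mulrA (upowNl ltdN) // mulr1.
  - exact: twisted0E.
  - by rewrite mulrA (Usol_K Usol_twisted0 y01) mul1r.
  - by rewrite -mulrA (upowNl ltdN) // mulr1.
  - exact: TE.
have cPA : GRing.comm PhiCD A by apply/commr_sym/comm_twist.
have -> : - (A + D) = - A + - D by rewrite opprD.
rewrite (upowD ltdN) //; first 1 last; [exact: raisesN|exact: raisesN| |].
  by apply/commrN/commr_sym/commrN/commr_sym.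
rewrite (comm_upow _ _ cPA) mulrA -[_ * _ * upow D z]mulrA (upowNl ltdN) // mulr1.
by rewrite (upowNl ltdN) // mul1r.
Unshelve. all: by end_near. Qed.

Let K := twisted B (D + E) k0 2^-1.
Let U1 := twisted B (D + E) k0.

Lemma comm_twisted_half : GRing.comm B K.
Proof.
apply: commrM; last exact: comm_upow.
by apply: comm_twist => //.
Qed.

(** Here y tends to 1/2, so that no control at y = 1 is required. *)
Lemma near1_twisted1 : near1 (fun u => uinv (U1 (hyp (1 - u))) * U (1 - u) (hyp (1 - u))).
Proof.
have x1 : 0 <= (1 : R) <= 1 by rewrite lexx ler01.
(* any bound between 1/2 and 1 *)
have b01 : 0 < (3/4 : R) < 1 by lra.
have [c c0 WE] := mdominated_conj_U Usol_twisted1 E b01.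
have kx (x y : R) : 0 <= x <= 1 -> 0 < y < 3/4 -> kap x y <= 4.
  by move=> /andP[x0 x1'] /andP[y0 y1]; rewrite -[leRHS]invrK lef_pV2 ?posrE; nra.
have b1 : (3/4 : R) <= 1 by lra.
have [K' K'0 KE] := Usol_estimate x1 Usol_twisted1 b1 c0 WE (fun y => kx 1 y x1) (ler0n R 4).
move=> i j; apply: (@negl_bound _ _ K'); near=> u.
have u12 : 0 < u < 2^-1 by near: u; apply: near0_lt; lra.
have z01 : 0 < 1 - u < 1 by lra.
have z01' : 0 <= 1 - u <= 1 by have /andP[? ?] := z01; rewrite !ltW.
have y01 : 0 < hyp (1 - u) < 3/4.
  have := hyp_01 z01; rewrite /hyp => /andP[h _]; apply/andP; split; first lra.
  by rewrite -[ltRHS]invrK ltf_pV2 ?posrE; lra.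
have /andP[u0 _] := u12.
have := KE (1 - u) (U (1 - u)) z01' (sU z01') (fun y => kx (1 - u) y z01') (hyp (1 - u)) i j y01.
have -> : 1 - u - 1 = - u by ring.
by rewrite normrN (gtr0_norm u0).
Unshelve. all: by end_near. Qed.

(** At the end (1, 1/2) of the hyperbola: the section over x = 1 takes its value
    K at y = 1/2, which commutes with B, and the section over y = 0 is close to
    (1 - z)^B Phi(A, B), whereas (1 + z)^(-Z) H_0 is close to 2^(-Z) (1 - z)^B
    Psi. *)
Lemma hyp_match_at1 : (forall z, 0 < z < 1 -> hyp_square z = hyp_psi z * PhiCD) ->
  K * PhiAB = upow (- Z) 2 * ev3 N psi (A + D) B F * PhiCD.
Proof.
move=> TE; have [sg0 sg1 _ lg1 g01] := phi_assoc; have [sh0 sh1 _ lh1 h01] := psi_assoc.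
have rNZ := raisesN rZ; have rNB := raisesN rB.
have M4 := ev2_at1 ltdN rA rB sg1 lg1; have M5 := ev3_at1 ltdN rAD rB rF sh1 lh1.
have d1 : is_derive (0 : R) (1 : R) (fun u : R => 1 - u) (-1).
  by have := is_deriveB (is_derive_cst (1 : R) (0 : R) 1) (is_derive_id (0 : R) 1); rewrite sub0r.
have [y0 yd] : hyp (1 - 0) = 2^-1 /\ is_derive (1 - 0 : R) (1 : R) hyp (- hyp (1 - 0) ^+ 2).
  by rewrite subr0; split; [rewrite /hyp|apply: is_derive_hyp; apply/eqP; lra].
have half : 0 < hyp (1 - 0) < 1 by rewrite y0; lra.
have [dU1 _ _] := Usol_twisted1.
have nK := mnegl_of_mder0 (mder_comp d1 (mder_comp yd (dU1 _ half))).
rewrite /= y0 -/K in nK.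
have d2 : is_derive (0 : R) (1 : R) (fun u : R => 1 + (1 - u)) (-1).
  by have := is_derive_addf (is_derive_cst (1 : R) (0 : R) 1) d1; rewrite add0r.
have p2 : 0 < 1 + (1 - 0) :> R by lra.
have nP := mnegl_of_mder0 (mder_comp d2 (mder_upow ltdN rNZ p2)).
rewrite /= subr0 in nP.
pose L := ev3 N psi (A + D) B F * PhiCD.
have tU1 : mtame (fun u => U1 (hyp (1 - u))).
  apply: (mtame_eq _ (mtameD (mnegl_tame nK) (mtame_cst K))).
  by near=> u; rewrite subrK.
have tP : mtame (fun u => upow (- Z) (1 + (1 - u))).
  apply: (mtame_eq _ (mtameD (mnegl_tame nP) (mtame_cst (upow (- Z) (1 + 1))))).
  by near=> u; rewrite subrK.
have X4 := near1M near1_twisted1 M4.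
have E4 := meqvM (meqvM nK X4 (mtame_cst K) (near1_tame X4)) (mnegl_refl (fun u => upow B u * PhiAB))
  (mtameM (mtame_cst K) (mtame_cst 1)) (mtameM (mtame_upow N B) (mtame_cst PhiAB)).
have E5 := meqvM (meqvM nP M5 (mtame_cst _) (near1_tame M5)) (mnegl_refl (fun u => upow B u * L))
  (mtameM (mtame_cst _) (mtame_cst 1)) (mtameM (mtame_upow N B) (mtame_cst L)).
have E6 := mneglMl (mtame_upow N (- B)) (mneglB E5 E4).
apply/eqP; rewrite -subr_eq0; apply/eqP; apply: mnegl_cst.
apply: (mnegl_eq _ E6); near=> u.
have u01 : 0 < u < 1 by near: u; exact: near0_lt.
have z01 : 0 < 1 - u < 1 by lra.
have y01 : 0 < hyp (1 - u) < 1 by have := hyp_01 z01; lra.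
have /andP[u0 _] := u01.
have [_ _ gE] := g01 _ z01; have [_ _ hE] := h01 _ z01.
have A1 : upow (- Z) (1 + (1 - u)) * (ev3 N (h1 (1 - u)) (A + D) B F * upow (- B) u) *
    (upow B u * L) = hyp_psi (1 - u) * PhiCD.
  rewrite /hyp_psi -hE (ev3M ltdN) // !mulrA; congr (_ * _ * _).
  by rewrite -[_ * upow (- B) u * upow B u]mulrA (upowNl ltdN) // mulr1.
have A2 : U1 (hyp (1 - u)) * (uinv (U1 (hyp (1 - u))) * U (1 - u) (hyp (1 - u)) *
    (ev2 N (g1 (1 - u)) A B * upow (- B) u)) * (upow B u * PhiAB) = hyp_square (1 - u).
  rewrite /hyp_square -gE (ev2M ltdN) // !mulrA (Usol_K Usol_twisted1 y01) mul1r; congr (_ * _).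
  by rewrite -[_ * upow (- B) u * upow B u]mulrA (upowNl ltdN) // mulr1.
have diff (X a b : M) : X - a - (X - b) = b - a by rewrite opprB addrC addrA subrK.
rewrite A1 A2 TE // !mulr1 diff mulrBr.
have cK X : GRing.comm B X -> GRing.comm (upow (- B) u) X.
  by move=> cBX; apply/commr_sym/comm_upow/commrN/commr_sym.
have cBP : GRing.comm B (upow (- Z) (1 + 1)).
  by apply/comm_upow/commrN/commr_sym.
have H (b b' k X : M) : b' * k = k * b' -> b' * b = 1 -> b' * (k * (b * X)) = k * X.
  by move=> cbk b1; rewrite mulrA cbk -mulrA [b' * _]mulrA b1 mul1r.
rewrite (H _ _ _ _ (cK _ comm_twisted_half)) ?(upowNl ltdN) //.
by rewrite (H _ _ _ _ (cK _ cBP)) ?(upowNl ltdN) // /L mulrA.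
Unshelve. all: by end_near. Qed.

End Ends.

(** The identity for real matrices A = t12, B = t23, C = t12 + t13 + t23, D =
    t34, E = t24 *)
Theorem ev3_psiE : ev3 N psi (A + D) B F =
  upow (Z - B) 2 * ev2 N (k0 2^-1) (C - B) (D + E) * ev2 N phi A B *
  uinv (ev2 N phi (C - A) D).
Proof.
have [U sU] := Usol_family; have rNB := raisesN rB.
have [c cE] := hyp_psi_right_multiple (mder_hyp_square sU).
have TE : forall z, 0 < z < 1 -> hyp_square U z = hyp_psi z * ev2 N phi (C - A) D.
  by move=> z z01; rewrite cE // (hyp_match_at0 sU cE).
have H := hyp_match_at1 sU TE.
have uphi : unipotent (ev2 N phi (C - A) D).
  by apply: (unipotent_ev2 ltdN) => //; exact: real_assoc_nil phi_assoc.
have -> : ev3 N psi (A + D) B F = upow Z 2 *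
    (upow (- Z) 2 * ev3 N psi (A + D) B F * ev2 N phi (C - A) D) * uinv (ev2 N phi (C - A) D).
  rewrite !mulrA (upowNr ltdN) // mul1r -[_ * _ * uinv _]mulrA (mul_uinv ltdN) // mulr1.
  by [].
rewrite -H !mulrA; congr (_ * _ * _); rewrite /twisted.
rewrite (upowD ltdN) //; last exact: commrN.
have -> : upow B 2^-1 = upow (- B) 2.
  exact: upowV.
rewrite -!mulrA; congr (_ * _).
suff : GRing.comm (ev2 N (k0 2^-1) (C - B) (D + E)) (upow (- B) 2) by [].
by apply: comm_upow; apply/commrN/commr_sym/comm_twist.
Qed.

End Comparison.

End Connection.

(** * The identity in the group of t_4 *)

Section ComplexMatrices.
Variable R : realType.
Local Notation C := R[i].
Local Notation cmap := (map_mx (real_complex R)).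

Lemma nc_complex_der (T : finType) (s : T -> ncseries R T) f :
  der (fun a => nc_complex (s a)) (nc_complex f) = nc_complex (der s f).
Proof.
apply/ncseriesP => u; rewrite /der /nc_complex.
elim: u f => [|b u IHu] f /=; rewrite rmorphD; congr (_ + _).
- rewrite !ncsumE rmorph_sum; apply: eq_bigr => a _.
  by have /ncseriesP/(_ [::]) := nc_complexM (s a) (ncshift a f).

- rewrite !ncsumE rmorph_sum; apply: eq_bigr => a _.
  by have /ncseriesP/(_ (b :: u)) := nc_complexM (s a) (ncshift a f).
exact: IHu.
Qed.

Lemma nc_complex_braid_image a b c :
  nc_complex (braid_image R a b c) = braid_image C a b c.
Proof.
rewrite /braid_image /bracket.
have E e : nc_complex (ncletter R e) = ncletter C e by exact: nc_complex_letter.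
have B (f g : ncseries R 'I_3) : nc_complex (f * g - g * f) =
    nc_complex f * nc_complex g - nc_complex g * nc_complex f.
  rewrite -!nc_complexM; apply/ncseriesP => w.
  by rewrite /nc_complex !ncsubE rmorphB.
case: eqP => _; first by rewrite B !E.
case: eqP => _; first by rewrite B !E.
by apply/ncseriesP => w; rewrite /nc_complex rmorph0.
Qed.

Lemma nc_complex_t4_op i j (f : ncseries R 'I_3) :
  t4_op i j (nc_complex f) = nc_complex (t4_op i j f).
Proof.
rewrite /t4_op; case: unlift => [a|]; case: unlift => [b|].
- rewrite /braid_der -nc_complex_der; congr der; apply/funext => c.
  by rewrite nc_complex_braid_image.
- by rewrite /lmul nc_complexM nc_complex_letter.
- by rewrite /lmul nc_complexM nc_complex_letter.
- by apply/ncseriesP => w; rewrite /nc_complex rmorph0.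
Qed.

Lemma map_mxop_t4 N i j : cmap (mxop N (@t4_op R i j)) = mxop N (@t4_op C i j).
Proof.
apply/matrixP => k l; rewrite mxE !mxopE.
have -> : delta C (wd l) = nc_complex (delta R (wd l)).
  by apply/ncseriesP => w; rewrite /nc_complex !deltaE rmorph_nat.
by rewrite nc_complex_t4_op.
Qed.

Lemma map_evn n (T : finType) (s : T -> 'M[R]_n.+1) k (f : ncseries R T) :
  cmap (evn s k f) = evn (fun a => cmap (s a)) k (nc_complex f).
Proof.
rewrite /evn raddf_sum; apply: eq_bigr => j _.
rewrite /wsum raddf_sum; apply: eq_bigr => v _; rewrite /= map_mxZ; congr (_ *: _).
exact: (rmorph_prod (map_mx (real_complex R))).
Qed.

Lemma map_mexp n k (X : 'M[R]_n.+1) : cmap (mexp k X) = mexp k (cmap X).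
Proof.
rewrite /mexp raddf_sum; apply: eq_bigr => j _.
rewrite /= map_mxZ fmorphV rmorph_nat; congr (_ *: _).
exact: (rmorphXn (map_mx (real_complex R))).
Qed.

End ComplexMatrices.

Section Transfer.
Variables (R : realType) (N : nat).
Local Notation C := R[i].
Local Notation cmap := (map_mx (real_complex R)).
Local Notation S4 := (ncseries C t4_gen).
Local Notation M := 'M[R]_((wdim 'I_3 N).+1).
Local Notation wdeg := (fun m : 'I_(wdim 'I_3 N).+1 => size (wd m)).

Definition t4_real (i j : nat) : M := mxop N (@t4_op R (inord i) (inord j)).

Lemma t4_ev_real i j : (i < 4)%N -> (j < 4)%N -> i != j ->
  t4_ev N (tij R (inord i) (inord j)) = cmap (t4_real i j).
Proof. by move=> lti ltj ij; rewrite t4_ev_tij ?strand_neq // map_mxop_t4. Qed.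

Lemma raises_t4_real i j : raises wdeg 1 (t4_real i j).
Proof. by apply: raises_mxop; exact: shifting_t4_op. Qed.

Lemma t4_real_sym i j : (i < 4)%N -> (j < 4)%N -> i != j -> t4_real i j = t4_real j i.
Proof. by move=> lti ltj ij; rewrite /t4_real t4_opC // strand_neq. Qed.

Let t4_op_nil (i j : 'I_4) (f : ncseries R 'I_3) : t4_op i j f [::] = 0.
Proof. by have [_ ->] := shifting_t4_op R i j. Qed.

Lemma t4_real_tri i j k : (i < 4)%N -> (j < 4)%N -> (k < 4)%N ->
    i != j -> i != k -> j != k ->
  GRing.comm (t4_real i j + t4_real i k) (t4_real j k).
Proof.
move=> lti ltj ltk ij ik jk; have sh := @shifting_t4_op R.
rewrite /GRing.comm mulrDl mulrDr /t4_real -!mxop_comp // -!mxop_add.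
by apply: eq_mxop => f; apply: t4_op_tri; exact: strand_neq.
Qed.

Lemma t4_real_comm i j k l : (i < 4)%N -> (j < 4)%N -> (k < 4)%N -> (l < 4)%N ->
  uniq [:: i; j; k; l] -> GRing.comm (t4_real i j) (t4_real k l).
Proof.
move=> lti ltj ltk ltl u; have sh := @shifting_t4_op R.
rewrite /GRing.comm /t4_real -!mxop_comp //; apply: eq_mxop => f; apply: t4_op_comm.
move: u; rewrite /= !inE -!(inj_eq val_inj) /= !inordK //.
Qed.

Definition t4_realZ : M := mxop N (@central_op R).

Lemma t4_realZ_comm i j : (i < 4)%N -> (j < 4)%N -> i != j -> GRing.comm t4_realZ (t4_real i j).
Proof.
move=> lti ltj ij; have sh := @shifting_t4_op R; have sc := shifting_central_op R.
have [_ c0 _] := sc.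
rewrite /GRing.comm /t4_real /t4_realZ -!mxop_comp //; apply: eq_mxop => f.
by apply: central_op_comm; exact: strand_neq.
Qed.

Lemma t4_realZE : t4_realZ = t4_real 0 1 + t4_real 0 2 + t4_real 0 3 + t4_real 1 2 +
  t4_real 1 3 + t4_real 2 3.
Proof. by rewrite /t4_realZ /t4_real -!mxop_add. Qed.

Lemma t4_ev_eval2 phi x y A B : x [::] = 0 -> y [::] = 0 ->
    t4_ev N x = cmap A -> t4_ev N y = cmap B ->
  t4_ev N (eval2 (nc_complex phi) x y) = cmap (ev2 N.+1 phi A B).
Proof.
move=> x0 y0 xA yB; rewrite /eval2 /t4_ev evn_ncsubst; last exact: t4_mx_prod0.
  rewrite /ev2 map_evn; congr evn; apply/funext => a.
  by rewrite !(tnth_nth 0); case: a => [[|[|]]].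
by move=> a; rewrite (tnth_nth 0); case: a => [[|[|]]].
Qed.

Lemma t4_ev_eval3 phi x y z A B D : x [::] = 0 -> y [::] = 0 -> z [::] = 0 ->
    t4_ev N x = cmap A -> t4_ev N y = cmap B -> t4_ev N z = cmap D ->
  t4_ev N (eval3 (nc_complex phi) x y z) = cmap (ev3 N.+1 phi A B D).
Proof.
move=> x0 y0 z0 xA yB zD; rewrite /eval3 /t4_ev evn_ncsubst; last exact: t4_mx_prod0.
  rewrite /ev3 map_evn; congr evn; apply/funext => a.
  by rewrite !(tnth_nth 0); case: a => [[|[|[|]]]].
by move=> a; rewrite (tnth_nth 0); case: a => [[|[|[|]]]].
Qed.

Lemma t4_ev_pow (a : R) x X : x [::] = 0 -> t4_ev N x = cmap X ->
  t4_ev N (ncpow a x) = cmap (upow N.+1 X a).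
Proof.
move=> x0 xX; rewrite /t4_ev /ncpow (evn_exp (@size_wd _ N)); first last.
- by rewrite ncscaleE x0 mulr0.
- exact: raises_t4_mx.
by rewrite evnZ -/(t4_ev N x) xX /upow map_mexp map_mxZ.
Qed.

Lemma t4_ev_inv g X : exp_lie g -> t4_ev N g = cmap X -> unipotent wdeg X ->
  t4_ev N g^-1 = cmap (uinv N.+1 X).
Proof.
move=> eg gX uX; have XV : X * uinv N.+1 X = 1 := mul_uinv (@size_wd _ N) uX.
have Vg : t4_ev N g^-1 * cmap X = 1.
  rewrite -gX -t4_evM mulVr ?exp_lie_unit //; apply: nil_evn1; exact: t4_mx_prod0.
by rewrite -[LHS]mulr1 -(rmorph1 (map_mx (real_complex R))) -XV rmorphM mulrA Vg mul1r.
Qed.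

End Transfer.

Section Identity.
Variable R : realType.
Local Notation C := R[i].
Local Notation S4 := (ncseries C t4_gen).

Definition degree1 (x : S4) := lie_poly x /\ forall w, size w != 1 -> x w = 0.

Lemma degree1_tij i j : degree1 (tij R i j).
Proof. by split; [exact: lie_tij|move=> w; exact: hom_tij]. Qed.

Lemma degree1D x y : degree1 x -> degree1 y -> degree1 (x + y).
Proof.
move=> [lx hx] [ly hy]; split; first exact: lie_polyD.
by move=> w sz; rewrite ncaddE hx // hy // addr0.
Qed.

Lemma degree1_nil x : degree1 x -> x [::] = 0.
Proof. by case=> _ ->. Qed.

Lemma exp_lie_eval2 Phi x y : degree1 x -> degree1 y -> exp_lie Phi -> exp_lie (eval2 Phi x y).
Proof.
move=> [lx hx] [ly hy]; apply: exp_lie_ncsubst => [a|a w].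
  by rewrite (tnth_nth 0); case: a => [[|[|]]].
by rewrite (tnth_nth 0); case: a => [[|[|]]] //= _; [exact: hx|exact: hy].
Qed.

Lemma exp_lie_eval3 Psi x y z : degree1 x -> degree1 y -> degree1 z ->
  exp_lie Psi -> exp_lie (eval3 Psi x y z).
Proof.
move=> [lx hx] [ly hy] [lz hz]; apply: exp_lie_ncsubst => [a|a w].
  by rewrite (tnth_nth 0); case: a => [[|[|[|]]]].
by rewrite (tnth_nth 0); case: a => [[|[|[|]]]] //= _; [exact: hx|exact: hy|exact: hz].
Qed.

Theorem eq_exp_t4_Psi2 (Phi Phi_half : ncseries C 'I_2) (Psi2 : ncseries C 'I_3) :
    is_Phi Phi -> is_Phi_half Phi_half -> is_Psi2 Psi2 ->
  eq_exp_t4 (eval3 Psi2 (t12 + t34) t23 t14)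
    (ncpow 2 (t4_Z - t23) * eval2 Phi_half (t12 + t13) (t24 + t34) *
     eval2 Phi t12 t23 * (eval2 Phi (t13 + t23) t34)^-1).
Proof.
move=> /is_Phi_real[ePhi [phi [g0 [g1 [PhiE aphi]]]]].
move=> /is_Phi_half_real[eHalf [half [k0 [HalfE sk0 lk0 k01 k0half]]]].
move=> /is_Psi2_real[ePsi [psi [h0 [h1 [PsiE apsi]]]]].
have [d12 d13 d14] : [/\ degree1 t12, degree1 t13 & degree1 t14] by split; exact: degree1_tij.
have [d23 d24 d34] : [/\ degree1 t23, degree1 t24 & degree1 t34] by split; exact: degree1_tij.
have eCD : exp_lie (eval2 Phi (t13 + t23) t34).
  by apply: exp_lie_eval2 => //; exact: degree1D.
have lZ : lie_poly (t4_Z - t23 : S4) by apply: lie_polyB; [exact: lie_t4_Z|exact: lie_tij].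
have Z0 : (t4_Z - t23 : S4) [::] = 0.
  by rewrite t4_ZE ncsubE !ncaddE !degree1_nil // !addr0 subrr.
apply: eq_exp_t4_of_ev => [||N].
- by apply: exp_lie_eval3 => //; exact: degree1D.
- apply: exp_lieM; last exact: exp_lieV.
  apply: exp_lieM; last by apply: exp_lie_eval2.
  apply: exp_lieM; last by apply: exp_lie_eval2 => //; exact: degree1D.
  by exists ((ln 2)%:C%C *: (t4_Z - t23)) => //; apply/lie_seriesZ/lie_poly_series.
pose m i j := t4_real R N i j; pose Z := t4_realZ R N.
pose A := m 0 1; pose B := m 1 2; pose Cm := m 0 1 + m 0 2 + m 1 2; pose D := m 2 3; pose E := m 1 3.
have rm i j : raises (fun k => size (wd k)) 1 (m i j) by exact: raises_t4_real.
have rZ : raises (fun k => size (wd k)) 1 Z.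
  by rewrite /Z t4_realZE; do !apply: raisesD.
have sym i j : (i < 4)%N -> (j < 4)%N -> i != j -> m i j = m j i by exact: t4_real_sym.
have tri i j k : (i < 4)%N -> (j < 4)%N -> (k < 4)%N -> i != j -> i != k -> j != k ->
  GRing.comm (m i j + m i k) (m j k) by exact: t4_real_tri.
have cZ i j : (i < 4)%N -> (j < 4)%N -> i != j -> GRing.comm Z (m i j) by exact: t4_realZ_comm.
have rC : raises (fun k => size (wd k)) 1 Cm by do !apply: raisesD.
have cAC : GRing.comm A Cm.
  rewrite /Cm -addrA; apply: commrD; first by [].
  apply: commr_sym; rewrite (sym 0 2) // (sym 1 2) //; exact: tri.
have cBC : GRing.comm B Cm.
  by rewrite /Cm; apply: commrD => //; apply: commr_sym; exact: tri.
have cAD : GRing.comm A D by exact: t4_real_comm.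
have cBED : GRing.comm (B + E) D by exact: tri.
have cDEB : GRing.comm (D + E) B.
  rewrite /D /E /B (sym 2 3) // (sym 1 3) // (sym 1 2) //; exact: tri.
have cCDAE : GRing.comm (Cm + D - A) E.
  have -> : Cm + D - A = m 0 2 + (m 2 1 + m 2 3).
    by rewrite /Cm /A /D (sym 2 1) // -!addrA [LHS]addrC -!addrA addNr addr0.
  apply: commr_sym; apply: commrD; apply: commr_sym; first exact: t4_real_comm.
  exact: tri.
have cZC : GRing.comm Z Cm by apply: commrD; [apply: commrD|]; exact: cZ.
have ltd := @size_wd 'I_3 N.
have := ev3_psiE ltd (rm 0 1) (rm 1 2) rC (rm 2 3) (rm 1 3) cAC cBC cAD cBED cDEB cCDAE
  rZ (cZ 0 1 isT isT isT) (cZ 1 2 isT isT isT) cZC (cZ 2 3 isT isT isT) (cZ 1 3 isT isT isT)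
  aphi sk0 lk0 k01 apsi.
rewrite k0half => H.
have e (i j : nat) : (i < 4)%N -> (j < 4)%N -> i != j ->
    t4_ev N (tij R (inord i) (inord j)) = map_mx (real_complex R) (m i j).
  exact: t4_ev_real.
have eD x y X Y : t4_ev N x = map_mx (real_complex R) X -> t4_ev N y = map_mx (real_complex R) Y ->
    t4_ev N (x + y) = map_mx (real_complex R) (X + Y).
  by move=> xX yY; rewrite t4_evD xX yY map_mxD.
have eF : t4_ev N t14 = map_mx (real_complex R) (Z - Cm - D - E).
  have H6 (a b c f g h : 'M[R]_((wdim 'I_3 N).+1)) :
      a + b + c + f + g + h - (a + b + f) - h - g = c.
    by apply/matrixP => i j; rewrite !mxE; ring.
  by rewrite /Z t4_realZE H6; exact: e.
have eZ : t4_ev N (t4_Z - t23) = map_mx (real_complex R) (Z - B).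
  have eT : t4_ev N t4_Z = map_mx (real_complex R) Z.
    by rewrite t4_ZE /Z t4_realZE; do 5!(apply: (eD); last exact: e); exact: e.
  by rewrite t4_evB eT map_mxB; congr (_ - _); exact: e.
have eCA : t4_ev N (t13 + t23) = map_mx (real_complex R) (Cm - A).
  have -> : Cm - A = m 0 2 + m 1 2 by rewrite /Cm /A -!addrA [LHS]addrC -!addrA addNr addr0.
  by apply: eD; exact: e.
have eCB : t4_ev N (t12 + t13) = map_mx (real_complex R) (Cm - B).
  have -> : Cm - B = m 0 1 + m 0 2 by rewrite /Cm /B addrK.
  by apply: eD; exact: e.
have eDE : t4_ev N (t24 + t34) = map_mx (real_complex R) (D + E).
  by rewrite addrC; apply: eD; exact: e.
have eAD : t4_ev N (t12 + t34) = map_mx (real_complex R) (A + D) by apply: eD; exact: e.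
have n x : degree1 x -> x [::] = 0 by exact: degree1_nil.
have phi1 := real_assoc_nil aphi.
have uCD : unipotent (fun k => size (wd k)) (ev2 N.+1 phi (Cm - A) D).
  by apply: (unipotent_ev2 ltd) phi1; [apply: raisesB; [exact: rC|exact: rm]|exact: rm].
have ePsiN := t4_ev_eval3 psi (n _ (degree1D d12 d34)) (n _ d23) (n _ d14) eAD (e 1 2 isT isT isT) eF.
have eHalfN := t4_ev_eval2 half (n _ (degree1D d12 d13)) (n _ (degree1D d24 d34)) eCB eDE.
have ePhiN := t4_ev_eval2 phi (n _ d12) (n _ d23) (e 0 1 isT isT isT) (e 1 2 isT isT isT).
have eCDN := t4_ev_eval2 phi (n _ (degree1D d13 d23)) (n _ d34) eCA (e 2 3 isT isT isT).
rewrite !t4_evM (t4_ev_pow _ Z0 eZ) PsiE HalfE PhiE ePsiN eHalfN ePhiN.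
rewrite PhiE in eCD; rewrite (t4_ev_inv eCD eCDN uCD) H.
by rewrite !(rmorphM (map_mx (real_complex R))).
Qed.

End Identity.

Theorem proposition2p5 (R : realType)
    (Phi Phi_half : ncseries R[i] 'I_2) (Psi2 : ncseries R[i] 'I_3)
    (hPhi : is_Phi Phi) (hPhi_half : is_Phi_half Phi_half)
    (hPsi2 : is_Psi2 Psi2) :
  let Phi_12_3_4 := eval2 Phi (t13 + t23) t34 in
  let Phi_1_2_3 := eval2 Phi t12 t23 in
  let Phi_half_1_23_4 := eval2 Phi_half (t12 + t13) (t24 + t34) in
  eq_exp_t4 (eval3 Psi2 (t12 + t34) t23 t14)
    (ncpow 2 (t4_Z - t23) * Phi_half_1_23_4 * Phi_1_2_3 * Phi_12_3_4^-1) /\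
  (forall x : ncseries R[i] t4_gen,
     t4_central x <-> exists c : R[i], t4_ideal (x - c *: t4_Z)).
Proof. by split; [exact: eq_exp_t4_Psi2|exact: t4_centerP]. Qed.
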